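(* There exist an integer $k_0$ and a positive real $c$ such that $m_k(n) = m_k(\tau_{k,n})$ for all positive integers $k$ and $n$ satisfying $k \ge k_0$ and $n \le k^2 + c\,k^{3/2}/\log k$. Moreover, for such $k$ and $n$, if $n \neq k^2+k+1$ and $m_k(\sigma) = m_k(n)$ for some $\sigma \in S_n$, then $\sigma$ contains monotone subsequences of length $k+1$ of only one type (increasing or decreasing); that is, $\sigma$ does not contain both an increasing and a decreasing subsequence of length $k+1$.
   Context: $S_n$ is the set of all permutations of $[n]=\{1,\dots,n\}$, viewed as sequences $\sigma(1),\dots,\sigma(n)$. A subsequence is monotone if it is increasing or decreasing. For $\sigma\in S_n$, $m_k(\sigma)$ denotes the number of monotone subsequences of length $k+1$ in $\sigma$, and $m_k(n)=\min\{m_k(\sigma):\sigma\in S_n\}$. The permutation $\tau_{k,n}\in S_n$ is the concatenation, for $j=k,k-1,\dots,1$ in this order, of the increasing blocks $\lfloor (j-1)n/k\rfloor+1,\ \lfloor (j-1)n/k\rfloor+2,\ \dots,\ \lfloor jn/k\rfloor$. *)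

(* Defs.v *)
From mathcomp Require Import all_boot all_fingroup.

Set Implicit Arguments.
Unset Strict Implicit.
Unset Printing Implicit Defensive.

(* S_n is ['S_n]: both positions and values are 0-based.  A subsequence of
   [s : 'S_n] is given by its set of positions. *)

Definition increasing_on n (s : 'S_n) (A : {set 'I_n}) : bool :=
  [forall i in A, forall j in A, (i < j) ==> (s i < s j)].

Definition decreasing_on n (s : 'S_n) (A : {set 'I_n}) : bool :=
  [forall i in A, forall j in A, (i < j) ==> (s j < s i)].

Definition mono_count k n (s : 'S_n) : nat :=
  #|[set A : {set 'I_n} |
      (#|A| == k.+1) && (increasing_on s A || decreasing_on s A)]|.

Definition min_mono_count k n : nat :=
  mono_count k [arg min_(s < (1%g : 'S_n)) mono_count k s].

Definition has_increasing k n (s : 'S_n) : Prop :=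
  exists A : {set 'I_n}, #|A| = k.+1 /\ increasing_on s A.

Definition has_decreasing k n (s : 'S_n) : Prop :=
  exists A : {set 'I_n}, #|A| = k.+1 /\ decreasing_on s A.

(* The block floor((j-1)n/k)+1, ..., floor(jn/k) shifted to 0-based values. *)
Definition tau_block k n j : seq nat :=
  iota ((j.-1 * n) %/ k) ((j * n) %/ k - (j.-1 * n) %/ k).

Definition tau_seq k n : seq nat :=
  flatten [seq tau_block k n j | j <- rev (iota 1 k)].

Lemma flatten_tau_block k n m :
  flatten [seq tau_block k n j | j <- iota 1 m] = iota 0 ((m * n) %/ k).
Proof.
elim: m => [|m IHm]; first by rewrite mul0n div0n.
rewrite -[m.+1]addn1 iotaD map_cat flatten_cat IHm /= cats0 /tau_block add1n addn1 /=.
rewrite -[X in _ ++ iota X _]add0n -iotaD subnKC //.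
by apply: leq_div2r; rewrite leq_mul2r leqnSn orbT.
Qed.

Lemma perm_tau_seq k n : 0 < k -> perm_eq (tau_seq k n) (iota 0 n).
Proof.
move=> k_gt0; have -> : iota 0 n = flatten [seq tau_block k n j | j <- iota 1 k].
  by rewrite flatten_tau_block mulKn.
by apply/perm_flatten/perm_map; rewrite perm_rev.
Qed.

(* The default [i] of [nth] is only reached when [k = 0], where it makes
   the function below the identity. *)
Definition tau_fun k n (i : 'I_n) : 'I_n :=
  insubd i (nth (i : nat) (tau_seq k n) i).

Lemma val_tau_fun k n (i : 'I_n) :
  tau_fun k i = nth (i : nat) (tau_seq k n) i :> nat.
Proof.
rewrite /tau_fun val_insubd; case: ifPn => //; case: k => [|k].
  by rewrite nth_nil ltn_ord.
have tauP := perm_tau_seq n (ltn0Sn k).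
have szi : i < size (tau_seq k.+1 n) by rewrite (perm_size tauP) size_iota.
have := mem_nth (i : nat) szi.
by rewrite (perm_mem tauP) mem_iota add0n => /andP[_ ->].
Qed.

Lemma tau_fun_inj k n : injective (@tau_fun k n).
Proof.
move=> i j /(congr1 (@nat_of_ord n)); rewrite !val_tau_fun; case: k => [|k].
  by rewrite !nth_nil => /val_inj.
have tauP := perm_tau_seq n (ltn0Sn k).
have szT (l : 'I_n) : l < size (tau_seq k.+1 n).
  by rewrite (perm_size tauP) size_iota.
rewrite (set_nth_default (i : nat) (j : nat)) // => /eqP.
by rewrite nth_uniq // ?(perm_uniq tauP) ?iota_uniq // => /eqP/val_inj.
Qed.

Definition tau k n : 'S_n := perm (@tau_fun_inj k n).

Lemma tauE k n : 0 < k -> [seq val (tau k n i) | i <- enum 'I_n] = tau_seq k n.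
Proof.
move=> k_gt0; have tauP := perm_tau_seq n k_gt0.
have sz : size (tau_seq k n) = n by rewrite (perm_size tauP) size_iota.
apply: (@eq_from_nth _ 0); first by rewrite size_map size_enum_ord sz.
move=> i; rewrite size_map size_enum_ord => lt_in.
rewrite (nth_map (Ordinal lt_in)) ?size_enum_ord // permE [LHS]val_tau_fun.
by rewrite nth_enum_ord //; apply: set_nth_default; rewrite sz.
Qed.

(* Main.v *)
Require Import Defs.
From mathcomp Require Import all_boot all_order all_algebra all_fingroup.
From mathcomp Require Import reals exp.
From mathcomp Require Import zify ring lra.

(** A permutation is studied as a set X of points with two strict orders: x
    precedes y in [inc] when y is above and to the right of x, in [dec] when y
    is below and to the right.  Two distinct points are comparable in exactly
    one of them.  Monotone subsequences of length k + 1 become homogeneous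
    sets: (k + 1)-chains of [inc] or of [dec].  The only planarity used is that
    two crossing comparabilities force the two others ([cross]).

    The permutation tau has no decreasing homogeneous set, and its block sizes
    give at most F(n) = \sum_(i < n) 'C(i %/ k, k) increasing ones
    ([tau_upper]).  So it suffices to show that every X with n elements has at
    least F(n) homogeneous sets, and more than F(n) if both types occur and
    n <> k ^ 2 + k + 1 ([lower_bound]).

    This is an induction on n.  Put q = (n - 1) %/ k, so that
    F(n) - F(n - 1) = 'C(q, k).  If some point lies on more than 'C(q, k)
    homogeneous sets, delete it.  A chain with q + 1 elements gives the bound
    in the same way, and equality would force every homogeneous set meeting
    that chain to lie inside it, which contradicts the strict induction
    hypothesis or the pigeonhole principle ([long_chain], [first_row]).  There
    remains the case where all monotone sets have at most q = k + s elements
    ([core]).  The hypothesis on n enters through an integer z of order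
    sqrt k with s <= z and F(n) < 2 ^ z: whenever a construction produces 2 ^ z
    homogeneous sets we are done ([threshold]).

    Decompose X into levels by the height [hgt], the length of the longest
    [inc]-chain ending at a point.  A level is a [dec]-chain, there are
    at most q levels, and n > k * q forces one of them to be longer than k.  A slot (two
    consecutive levels) is good if it contains a [dec]-chain with k + 1
    elements.  The key local fact is [card_single]: in a good slot, unless
    there are 2 ^ z homogeneous [dec]-sets, only z + 1 + 2 * (q - #|L|) elements
    of the upper level can have a single neighbour in the lower level L.  Hence descending walks branch
    at good slots.

    If there are at least 13 z good slots, walks branch so much that the
    starting points of walks that extend to homogeneous chains are few, and
    all homogeneous chains can be hit by k * s / 2 points ([many_good]).  If
    this holds for [inc] and for [dec], deleting k * s points leaves no
    homogeneous set, hence at most k ^ 2 points by the theorem of Erdos and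
    Szekeres, contradicting n > k ^ 2 + k * s.  Otherwise there are few good
    slots, so the levels are almost of size k and are joined by almost k
    disjoint full strands.  Each strand contributes 'C(q, k + 1) chains, and
    walks that leave a strand once or twice at good slots contribute enough
    more to exceed F(n) ([branch_count], [few_good]), unless there is a single
    long level, at the bottom or at the top, with exactly q elements.  In that
    last case edges between the two bottom levels and [dec]-chains inside them
    are counted exactly ([exact_first]). *)

Set Implicit Arguments.
Unset Strict Implicit.
Unset Printing Implicit Defensive.

(** * Biorders, heights and levels *)

(** Restricting [lia] to the arithmetic hypotheses avoids the cost of
    preprocessing the large contexts below. *)
Ltac keep_arith H :=
  lazymatch type of H with
  | is_true (leq _ _) => idtac
  | is_true (leq _ _ && leq _ _) => idtac
  | is_true (~~ leq _ _) => idtac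
  | @eq bool (leq _ _) _ => idtac
  | @eq ?A _ _ => unify A nat
  | ~ (@eq ?A _ _) => unify A nat
  end.
Ltac arith :=
  repeat match goal with H : _ |- _ => first [keep_arith H; fail 1 | clear H] end; lia.

Record biorder (T : finType) := Biorder {
  inc : rel T;
  dec : rel T;
  inc_irr : irreflexive inc;
  dec_irr : irreflexive dec;
  inc_trans : transitive inc;
  dec_trans : transitive dec;
  bi_total : forall x y, x != y -> [|| inc x y, inc y x, dec x y | dec y x];
  bi_excl : forall x y, inc x y -> ~~ dec x y && ~~ dec y x }.

Section Duality.
Variables (T : finType) (O : biorder T).

Lemma dual_total x y :
  x != y -> [|| dec O x y, dec O y x, inc O x y | inc O y x].
Proof. by move=> /(bi_total O) /or4P[] ->; rewrite ?orbT. Qed.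

Lemma dual_excl x y : dec O x y -> ~~ inc O x y && ~~ inc O y x.
Proof.
by move=> d; apply/andP; split; apply/negP => /(bi_excl) /andP[/negP a /negP b];
  [apply: a | apply: b].
Qed.

Definition dual : biorder T :=
  Biorder (dec_irr O) (inc_irr O) (@dec_trans _ O) (@inc_trans _ O)
    dual_total dual_excl.

Lemma flip_irr : irreflexive (fun x y => inc O y x).
Proof. by move=> x; apply: inc_irr. Qed.

Lemma flip_trans : transitive (fun x y => inc O y x).
Proof. by move=> y x z a b; apply: inc_trans b a. Qed.

Lemma flip_total x y :
  x != y -> [|| inc O y x, inc O x y, dec O x y | dec O y x].
Proof. by move=> /(bi_total O) /or4P[] ->; rewrite ?orbT. Qed.

Lemma flip_excl x y : inc O y x -> ~~ dec O x y && ~~ dec O y x.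
Proof. by move=> /bi_excl /andP[-> ->]. Qed.

(** Reflection in the antidiagonal: chains are read from top to bottom, whereas
    the left-to-right order [dec] is kept. *)
Definition flip : biorder T :=
  Biorder flip_irr (dec_irr O) flip_trans (@dec_trans _ O) flip_total flip_excl.

End Duality.

Definition mono (T : finType) (r : rel T) (S : {set T}) :=
  [forall x in S, forall y in S, (x != y) ==> (r x y || r y x)].

Section Mono.
Variables (T : finType).
Implicit Types (r : rel T) (S : {set T}).

Lemma monoP r S :
  reflect (forall x y, x \in S -> y \in S -> x != y -> r x y || r y x) (mono r S).
Proof.
apply: (iffP forall_inP) => [h x y xS yS xy | h x xS].
  by have /forall_inP/(_ y yS)/implyP := h x xS; apply.
by apply/forall_inP => y yS; apply/implyP; apply: h.
Qed.

Lemma monoW r S S' : S' \subset S -> mono r S -> mono r S'.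
Proof. by move=> /subsetP ss /monoP h; apply/monoP => x y /ss xS /ss; apply: h. Qed.

Lemma mono1 r x : mono r [set x].
Proof. by apply/monoP => u v /set1P-> /set1P->; rewrite eqxx. Qed.

Lemma monoU1 r S x : mono r S ->
  (forall y, y \in S -> y != x -> r x y || r y x) -> mono r (x |: S).
Proof.
move=> /monoP h hx; apply/monoP => u v /setU1P[->|uS] /setU1P[->|vS].
- by rewrite eqxx.
- by move=> xv; apply: hx => //; rewrite eq_sym.
- by move=> ux; rewrite orbC; apply: hx.
- exact: h.
Qed.

End Mono.

Section Basics.
Variables (T : finType) (O : biorder T).
Implicit Types (S X : {set T}) (x y u v : T).

Lemma inc_asym x y : inc O x y -> ~~ inc O y x.
Proof. by move=> a; apply/negP => b; have := inc_trans a b; rewrite inc_irr. Qed.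

Lemma dec_asym x y : dec O x y -> ~~ dec O y x.
Proof. by move=> a; apply/negP => b; have := dec_trans a b; rewrite dec_irr. Qed.

Lemma inc_neq x y : inc O x y -> x != y.
Proof. by move=> a; apply/negP => /eqP e; rewrite e inc_irr in a. Qed.

Lemma dec_neq x y : dec O x y -> x != y.
Proof. by move=> a; apply/negP => /eqP e; rewrite e dec_irr in a. Qed.

Lemma inc_ndec x y : inc O x y -> dec O x y = false.
Proof. by case/bi_excl/andP => /negbTE. Qed.

Lemma inc_ndec' x y : inc O x y -> dec O y x = false.
Proof. by case/bi_excl/andP => _ /negbTE. Qed.

(** Read [dec] as left-to-right and [inc] as upward.  Two edges from a pair
    (a, b) to a pair (c, d) that cross, a to d and b to c, force the straight
    edges: any other relation between a and c would make one of the given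
    pairs comparable in both orders. *)
Lemma cross a b c d : dec O a b -> dec O c d -> inc O a d -> inc O b c ->
  inc O a c /\ inc O b d.
Proof.
move=> ab cd ad bc; split.
- have : a != c by apply/eqP => e; rewrite e (negbTE (proj1 (andP (dual_excl cd)))) in ad.
  case/(bi_total O)/or4P => // [ca|ac|ca].
  + by have := inc_ndec (inc_trans ca ad); rewrite cd.
  + by have := inc_ndec ad; rewrite (dec_trans ac cd).
  + by have := inc_ndec' bc; rewrite (dec_trans ca ab).
- have : b != d.
    by apply/eqP => e; rewrite -e (negbTE (proj1 (andP (dual_excl ab)))) in ad.
  case/(bi_total O)/or4P => // [db|bd|db].
  + by have := inc_ndec' (inc_trans db bc); rewrite cd.
  + by have := inc_ndec ad; rewrite (dec_trans ab bd).
  + by have := inc_ndec' bc; rewrite (dec_trans cd db).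
Qed.

Lemma mono_inc_dec S : mono (inc O) S -> mono (dec O) S -> #|S| <= 1.
Proof.
move=> /monoP i /monoP d; rewrite leqNgt; apply/negP => /card_gt1P[x [y [xS yS xy]]].
by have /orP[h|h] := i x y xS yS xy; have := d x y xS yS xy;
  rewrite (inc_ndec h) (inc_ndec' h).
Qed.

Lemma mono_top S : mono (inc O) S -> S != set0 ->
  exists2 u, u \in S & forall w, w \in S -> w != u -> inc O w u.
Proof.
move=> /monoP m /set0Pn[x0 x0S].
pose f u := #|[set w in S | inc O w u]|.
case: (arg_maxnP f x0S) => u uS umax.
exists u => // w wS wu; have /orP[//|uw] := m w u wS uS wu.
suff : f u < f w by rewrite ltnNge; move/negP; case; apply: umax.
apply: proper_card; apply/properP; split.
  apply/subsetP => v; rewrite !inE => /andP[-> vu]; exact: inc_trans vu uw.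
by exists u; rewrite in_set ?inc_irr ?andbF // uw andbT.
Qed.

Definition hgt X v : nat :=
  (\max_(S : {set T} | [&& S \subset X, mono (inc O) S & [forall u in S, inc O u v]])
     #|S|).+1.

Definition lev X i : {set T} := [set v in X | hgt X v == i].

Lemma hgt_gt0 X v : 0 < hgt X v. Proof. by []. Qed.

Lemma hgt_ge X v S : S \subset X -> mono (inc O) S ->
  (forall u, u \in S -> inc O u v) -> #|S| < hgt X v.
Proof.
move=> SX mS h; rewrite /hgt ltnS.
apply: (@leq_bigmax_cond _ (fun S : {set T} => _) (fun S : {set T} => #|S|)).
by rewrite SX mS; apply/forall_inP.
Qed.

Lemma hgt_witness X v : exists S : {set T}, [/\ S \subset X, mono (inc O) S,
  forall u, u \in S -> inc O u v & hgt X v = #|S|.+1].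
Proof.
rewrite /hgt.
pose P (S : {set T}) :=
  [&& S \subset X, mono (inc O) S & [forall u in S, inc O u v]].
have P0 : P set0.
  apply/and3P; split; first exact: sub0set.
    by apply/monoP => x y; rewrite inE.
  by apply/forall_inP => u; rewrite inE.
have cP : 0 < #|P| by apply/card_gt0P; exists set0.
have [S /and3P[SX mS /forall_inP h] e] := eq_bigmax_cond (fun S : {set T} => #|S|) cP.
by exists S; split => //; rewrite -e.
Qed.

Lemma hgt_lt X u v : u \in X -> inc O u v -> hgt X u < hgt X v.
Proof.
move=> uX uv; have [S [SX mS hS ->]] := hgt_witness X u.
have uS : u \notin S by apply/negP => /hS; rewrite inc_irr.
have -> : #|S|.+1 = #|u |: S| by rewrite cardsU1 uS.
apply: hgt_ge.
- by rewrite subUset sub1set uX.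
- by apply: monoU1 => // y /hS yu _; rewrite yu orbT.
- by move=> w /setU1P[->//|/hS wu]; apply: inc_trans wu uv.
Qed.

(** Removing v from a longest chain ending at v, the new top has height one less. *)
Lemma hgt_pred X v m : hgt X v = m.+2 ->
  exists u, [/\ u \in X, inc O u v & hgt X u = m.+1].
Proof.
move=> hv; have [S [SX mS hS]] := hgt_witness X v.
rewrite hv => -[/esym cS].
have S0 : S != set0 by rewrite -card_gt0 cS.
have [u uS utop] := mono_top mS S0.
exists u; split; [exact: (subsetP SX) | exact: hS |].
apply/eqP; rewrite eqn_leq; apply/andP; split.
  by rewrite -ltnS -hv; apply: hgt_lt; [exact: (subsetP SX) | exact: hS].
have := cardsD1 u S; rewrite uS cS add1n => -[->].
apply: hgt_ge.
- exact: subset_trans (subsetDl _ _) SX.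
- exact: monoW (subsetDl _ _) mS.
- by move=> w; rewrite !inE => /andP[wu wS]; apply: utop.
Qed.

Lemma levP X i v : reflect (v \in X /\ hgt X v = i) (v \in lev X i).
Proof. by rewrite inE; apply: (iffP andP) => [[-> /eqP->]|[-> ->]]. Qed.

Lemma lev_sub X i : lev X i \subset X.
Proof. by apply/subsetP => v /levP[]. Qed.

Lemma lev_dec X i : mono (dec O) (lev X i).
Proof.
apply/monoP => x y /levP[xX hx] /levP[yX hy] /(bi_total O)/or4P[] h.
- by have := hgt_lt xX h; rewrite hx hy ltnn.
- by have := hgt_lt yX h; rewrite hx hy ltnn.
- by rewrite h.
- by rewrite h orbT.
Qed.

Definition lower X i v : {set T} := [set u in lev X i | inc O u v].

Lemma dn_gt0 X i v : v \in lev X i.+2 -> 0 < #|lower X i.+1 v|.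
Proof.
move=> /levP[vX /hgt_pred[u [uX uv hu]]]; apply/card_gt0P; exists u.
by rewrite inE uv andbT; apply/levP.
Qed.

Lemma walk_down X v : v \in X -> exists S : {set T},
  [/\ S \subset X, mono (inc O) S, v \in S,
      forall u, u \in S -> u != v -> inc O u v & #|S| = hgt X v].
Proof.
move=> vX; have [S [SX mS hS ->]] := hgt_witness X v.
have vS : v \notin S by apply/negP => /hS; rewrite inc_irr.
exists (v |: S); split.
- by rewrite subUset sub1set vX.
- by apply: monoU1 => // y /hS yu _; rewrite yu orbT.
- exact: setU11.
- by move=> u /setU1P[->|/hS//]; rewrite eqxx.
- by rewrite cardsU1 vS.
Qed.

Lemma hgt_le X v H : (forall S : {set T}, S \subset X -> mono (inc O) S -> #|S| <= H) ->
  v \in X -> hgt X v <= H.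
Proof. by move=> hH /walk_down[S [SX mS _ _ <-]]; apply: hH. Qed.

Lemma hgt_inj X S : S \subset X -> mono (inc O) S -> {in S &, injective (hgt X)}.
Proof.
move=> SX /monoP mS x y xS yS e; apply/eqP/negPn/negP => /(mS _ _ xS yS)/orP[] h.
- by have := hgt_lt ((subsetP SX) _ xS) h; rewrite e ltnn.
- by have := hgt_lt ((subsetP SX) _ yS) h; rewrite e ltnn.
Qed.

Lemma card_lev_sum X H : (forall v, v \in X -> hgt X v <= H) ->
  #|X| = \sum_(1 <= i < H.+1) #|lev X i|.
Proof.
move=> hH; rewrite -sum1_card.
rewrite (eq_bigr (fun v => \sum_(1 <= i < H.+1) (hgt X v == i))); last first.
  move=> v vX; rewrite (bigD1_seq (hgt X v)) ?iota_uniq ?mem_index_iota ?ltnS ?hH //=.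
  by rewrite eqxx big1 ?addn0 // => i; rewrite eq_sym => /negbTE->.
rewrite exchange_big /=; apply: eq_bigr => i _.
rewrite -sum1_card [RHS](eq_bigl (fun v => (v \in X) && (hgt X v == i))); last first.
  by move=> v; rewrite inE.
by rewrite -big_mkcondr.
Qed.

End Basics.

(** * Slots: two consecutive levels *)

Section FinsetExtra.
Variable T : finType.
Implicit Types (S A B : {set T}).

Lemma subset_card_between A B m : A \subset B -> #|A| <= m -> m <= #|B| ->
  exists C : {set T}, [/\ A \subset C, C \subset B & #|C| = m].
Proof.
elim: m => [|m IH] AB Am mB.
  by exists A; split => //; apply/eqP; rewrite -leqn0.
case: (ltngtP #|A| m.+1) Am => // [Am _|e _]; last by exists A; split.
have [C [AC CB cC]] := IH AB Am (ltnW mB).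
have /card_gt0P[x] : 0 < #|B :\: C| by rewrite cardsD (setIidPr CB) cC; lia.
rewrite inE => /andP[xC xB]; exists (x |: C); split.
- exact: subset_trans AC (subsetUr _ _).
- by rewrite subUset sub1set xB.
- by rewrite cardsU1 xC cC.
Qed.

Lemma subset_of_card B m : m <= #|B| -> exists2 C : {set T}, C \subset B & #|C| = m.
Proof.
move=> mB; have z : #|@set0 T| <= m by rewrite cards0.
by have [C [_ CB cC]] := subset_card_between (sub0set B) z mB; exists C.
Qed.

Lemma cardsU_disj A B : (forall x, x \in A -> x \in B -> False) ->
  #|A :|: B| = #|A| + #|B|.
Proof.
move=> dis; apply/eqP; rewrite (leq_card_setU A B).2 -setI_eq0; apply/eqP/setP => x.
by rewrite inE in_set0; apply/negP => /andP[xA xB]; apply: dis xA xB.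
Qed.

Lemma card_inj_bound S (f : T -> nat) w : {in S &, injective f} ->
  (forall x, x \in S -> 0 < f x <= w) -> #|S| <= w.
Proof.
move=> fi fb; rewrite cardE -(size_map f) -[X in _ <= X](size_iota 1).
apply: uniq_leq_size.
  by rewrite map_inj_in_uniq ?enum_uniq // => x y; rewrite !mem_enum; apply: fi.
by move=> _ /mapP[x + ->]; rewrite mem_enum mem_iota => /fb; lia.
Qed.

Lemma card_fibres S (p : T -> nat) b c : (forall x, x \in S -> p x <= b) ->
  (forall i, #|[set x in S | p x == i]| <= c) -> #|S| <= c * b.+1.
Proof.
move=> pb fib; rewrite -sum1_card (partition_big (fun x => inord (p x) : 'I_b.+1) predT) //=.
apply: (@leq_trans (\sum_(j < b.+1) c)); last by rewrite sum_nat_const card_ord mulnC.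
apply: leq_sum => j _; rewrite sum1dep_card; apply: leq_trans (fib j).
apply: subset_leq_card; apply/subsetP => x; rewrite !inE => /andP[xS /eqP <-].
by rewrite xS inordK ?ltnS ?pb ?eqxx.
Qed.

Lemma sum_card_disjoint (I : finType) (P : pred I) (f : I -> {set {set T}})
    (A : {set {set T}}) :
  (forall i, P i -> f i \subset A) ->
  (forall i j S, P i -> P j -> S \in f i -> S \in f j -> i = j) ->
  \sum_(i | P i) #|f i| <= #|A|.
Proof.
move=> fA fd; rewrite -sum1_card.
rewrite (eq_bigr (fun i => \sum_(S in A) (S \in f i))); last first.
  move=> i Pi; rewrite -sum1_card [RHS](big_setID (f i)) /= (setIidPr (fA i Pi)).
  rewrite [X in _ = _ + X]big1 ?addn0; last by move=> S; rewrite inE => /andP[/negbTE->].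
  by apply: eq_bigr => S ->.
rewrite exchange_big /=; apply: leq_sum => S SA.
have [/existsP[i /andP[Pi Si]]|/existsPn h] := boolP [exists i, P i && (S \in f i)].
  rewrite (bigD1 i) //= Si big1 // => j /andP[Pj ji].
  by apply/eqP; rewrite eqb0; apply/negP => Sj; rewrite (fd j i S) ?eqxx in ji.
by rewrite big1 // => i Pi; apply/eqP; rewrite eqb0; have := h i; rewrite Pi.
Qed.

End FinsetExtra.

(** Three elements of a chain with the same value of a function are excluded
    below by comparing the outer two across the middle one. *)
Lemma dec_three (T : finType) (O : biorder T) (S : {set T}) :
  mono (dec O) S -> 2 < #|S| ->
  exists a b c, [/\ a \in S, b \in S, c \in S, dec O a b & dec O b c].
Proof.
move=> mS cS; have [c cSS ctop] : exists2 c, c \in S & forall w, w \in S -> w != c -> dec O w c.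
  by apply: (@mono_top _ (dual O)) mS _; rewrite -card_gt0; lia.
have c1 := cardsD1 c S; rewrite cSS in c1.
have [b] : exists2 b, b \in S :\ c & forall w, w \in S :\ c -> w != b -> dec O w b.
  apply: (@mono_top _ (dual O)); first exact: monoW (subsetDl _ _) mS.
  by rewrite -card_gt0; lia.
rewrite !inE => /andP[bc bS] btop.
have c2 := cardsD1 b (S :\ c); rewrite !inE bc bS in c2.
have /card_gt0P[a] : 0 < #|S :\ c :\ b| by lia.
rewrite !inE => /and3P[ab ac aS]; exists a, b, c; split => //.
  by apply: btop; rewrite ?inE ?ac.
exact: ctop.
Qed.

Section Slot.
Variables (T : finType) (O : biorder T) (L U : {set T}).
Hypothesis decL : mono (dec O) L.
Hypothesis decU : mono (dec O) U.
Hypothesis slotLU : forall u v, u \in L -> v \in U -> (u != v) && ~~ inc O v u.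
Implicit Types (S : {set T}) (u v w d : T).

Lemma slot_rel u v : u \in L -> v \in U -> ~~ inc O u v -> dec O u v || dec O v u.
Proof.
move=> uL vU /negbTE nuv; have /andP[/(bi_total O) + /negbTE nvu] := slotLU uL vU.
by rewrite nuv nvu.
Qed.

Lemma decLP u u' : u \in L -> u' \in L -> u != u' -> dec O u u' || dec O u' u.
Proof. exact: (monoP _ _ decL). Qed.

Lemma decUP u u' : u \in U -> u' \in U -> u != u' -> dec O u u' || dec O u' u.
Proof. exact: (monoP _ _ decU). Qed.

(** Label the elements of the slot by their height in the other order: on each
    of L and U the labels are injective, and elements of L and of U with equal
    labels are [inc]-comparable.  Matching equal labels preserves the
    left-to-right order, and the unmatched part of U together with L has
    distinct labels in an interval of length w. *)
Lemma slot_matching (w : nat) :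
  (forall S, S \subset L :|: U -> mono (dec O) S -> #|S| <= w) ->
  exists (M : {set T}) (mu : T -> T), [/\ M \subset U,
    #|U| + #|L| <= #|M| + w,
    forall v, v \in M -> (mu v \in L) && inc O (mu v) v &
    forall v v', v \in M -> v' \in M -> dec O v v' -> dec O (mu v) (mu v')].
Proof.
move=> wP; pose X := L :|: U; pose b := hgt (dual O) X.
have bX x : x \in X -> 0 < b x <= w.
  by move=> xX; rewrite hgt_gt0 (@hgt_le _ (dual O)).
have blt x y : x \in X -> dec O x y -> b x < b y by move=> xX xy; exact: (@hgt_lt _ (dual O)).
have LX u : u \in L -> u \in X by move=> h; rewrite inE h.
have UX u : u \in U -> u \in X by move=> h; rewrite inE h orbT.
pose mu v := odflt v [pick u in L | b u == b v].
pose M := [set v in U | [exists u in L, b u == b v]].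
have muP v : v \in M -> mu v \in L /\ b (mu v) = b v.
  rewrite inE => /andP[vU /exists_inP[u uL /eqP e]]; rewrite /mu.
  by case: pickP => [x /andP[xL /eqP]//|/(_ u)]; rewrite uL e eqxx.
have bneq x y : x \in X -> y \in X -> dec O x y || dec O y x -> b x != b y.
  by move=> xX yX /orP[/(blt _ _ xX)|/(blt _ _ yX)] h; rewrite neq_ltn h ?orbT.
exists M, mu; split.
- by apply/subsetP => v; rewrite inE => /andP[].
- have MU : M \subset U by apply/subsetP => v; rewrite inE => /andP[].
  suff : #|L :|: (U :\: M)| <= w.
    rewrite cardsU_disj => [|x xL]; last first.
      by rewrite in_setD => /andP[_ xU]; have := slotLU xL xU; rewrite eqxx.
    rewrite cardsD (setIidPr MU).
    have := subset_leq_card MU; lia.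
  apply: (@card_inj_bound _ _ b) => [x y|x]; last first.
    by rewrite inE in_setD => /orP[/LX/bX//|/andP[_ /UX/bX]].
  have nM u v : u \in L -> v \in U :\: M -> b u != b v.
    move=> uL; rewrite in_setD inE negb_and => /andP[+ vU]; rewrite vU /=.
    by move=> /exists_inPn/(_ u uL).
  rewrite !in_setU => /orP[xL|xU] /orP[yL|yU] e; apply/eqP/negPn/negP => xy.
  + by have := bneq x y (LX _ xL) (LX _ yL) (decLP xL yL xy); rewrite e eqxx.
  + by have := nM _ _ xL yU; rewrite e eqxx.
  + by have := nM _ _ yL xU; rewrite e eqxx.
  + move: xU yU; rewrite !in_setD => /andP[_ xU] /andP[_ yU].
    by have := bneq x y (UX _ xU) (UX _ yU) (decUP xU yU xy); rewrite e eqxx.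
- move=> v vM; have [mL e] := muP v vM; rewrite mL /=; apply/negPn/negP => ni.
  have vU : v \in U by move: vM; rewrite inE => /andP[].
  by have := bneq _ _ (LX _ mL) (UX _ vU) (slot_rel mL vU ni); rewrite e eqxx.
- move=> v v' vM v'M vv'; have [mL e] := muP v vM; have [mL' e'] := muP v' v'M.
  have vU : v \in U by move: vM; rewrite inE => /andP[].
  have lt : b (mu v) < b (mu v') by rewrite e e'; apply: blt => //; apply: UX.
  have : mu v != mu v' by apply/negP => /eqP h; rewrite h ltnn in lt.
  by case/(decLP mL mL')/orP => // /(blt _ _ (LX _ mL')); lia.
Qed.

Definition single : {set T} := [set v in U | #|[set u in L | inc O u v]| == 1].

(** The default v is irrelevant on [single], where the choice is unique. *)
Definition nu v := odflt v [pick u in L | inc O u v].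

Lemma singleU : single \subset U.
Proof. by apply/subsetP => v; rewrite inE => /andP[]. Qed.

Lemma nuP v : v \in single ->
  [/\ v \in U, nu v \in L, inc O (nu v) v &
     forall u, u \in L -> inc O u v -> u = nu v].
Proof.
rewrite inE => /andP[vU /cards1P[x ex]].
have xP u : (u \in L) && inc O u v = (u == x) by rewrite -in_set1 -ex inE.
rewrite /nu; case: pickP => [u uP|/(_ x)]; last by rewrite xP eqxx.
have /andP[uL uv] := uP; split => // u' u'L u'v; move: uP.
by rewrite xP => /eqP->; apply/eqP; rewrite -xP u'L.
Qed.

Definition slot_anti S := (S \subset L :|: U) && mono (dec O) S.

Lemma slot_antiI S : S \subset L :|: U ->
  (forall u v, u \in S -> v \in S -> u \in L -> v \in U -> ~~ inc O u v) ->
  slot_anti S.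
Proof.
move=> SX h; rewrite /slot_anti SX; apply/monoP => x y xS yS xy.
have := subsetP SX x xS; have := subsetP SX y yS; rewrite !inE.
move=> /orP[yL|yU] /orP[xL|xU].
- exact: decLP.
- by rewrite orbC; apply: slot_rel => //; apply: h.
- by apply: slot_rel => //; apply: h.
- exact: decUP.
Qed.

Lemma slot_anti_ninc S u v : slot_anti S -> u \in S -> v \in S -> ~~ inc O u v.
Proof.
move=> /andP[_ /monoP m] uS vS; apply/negP => uv.
by have := m u v uS vS (inc_neq uv); rewrite (inc_ndec uv) (inc_ndec' uv).
Qed.

Section LowestMax.
Variable X0 : {set T}.
Hypothesis X0a : slot_anti X0.
Hypothesis X0max : forall S, slot_anti S -> #|S| <= #|X0|.
Hypothesis X0low : forall S, slot_anti S -> #|S| = #|X0| -> #|X0 :&: U| <= #|S :&: U|.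

Let K := X0 :&: U.
Let D := L :\: X0.
Let J := single :&: X0.
Let below v := [set w in K | dec O w v].
Let belowD u := [set d in D | dec O d u].
Let above v := [set w in K | dec O v w].
Let aboveD u := [set d in D | dec O u d].
Let p v := #|below v| - #|belowD (nu v)|.

Let X0sub x : x \in X0 -> (x \in L) || (x \in U).
Proof. by case/andP: X0a => /subsetP h _ /h; rewrite inE. Qed.

Let LU0 x : x \in L -> x \in U -> False.
Proof. by move=> xL xU; have := slotLU xL xU; rewrite eqxx. Qed.

(** Replacing Sx by Dx in X0 gives an antichain again, so maximality of X0 gives
    the first bound; in case of equality the new antichain would have fewer
    upper elements, which the choice of X0 excludes. *)
Lemma exchange (Sx Dx : {set T}) : Sx \subset K -> Dx \subset D ->
  (forall d w, d \in Dx -> w \in K -> inc O d w -> w \in Sx) ->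
  #|Dx| <= #|Sx| /\ (Sx != set0 -> #|Dx| < #|Sx|).
Proof.
move=> SK DD h; pose X1 := (X0 :\: Sx) :|: Dx.
have DL d : d \in Dx -> (d \in L) /\ (d \notin X0).
  by move/(subsetP DD); rewrite inE => /andP[].
have a1 : slot_anti X1.
  apply: slot_antiI.
    apply/subsetP => x; rewrite !inE => /orP[/andP[_ /X0sub //]|/DL[-> _] //].
  move=> u v; rewrite !inE => /orP[/andP[uS uX]|uD] /orP[/andP[vS vX]|vD] uL vU.
  - exact: slot_anti_ninc X0a uX vX.
  - by case: (LU0 (proj1 (DL v vD)) vU).
  - apply/negP => uv; move/negP: vS; apply; apply: h uv => //; by rewrite inE vX.
  - by case: (LU0 (proj1 (DL v vD)) vU).
have SX : Sx \subset X0 by apply: subset_trans SK (subsetIl _ _).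
have c1 : #|X1| = #|X0| - #|Sx| + #|Dx|.
  rewrite cardsU_disj ?cardsD ?(setIidPr SX) // => x.
  by rewrite inE => /andP[_ xX] /DL[_]; rewrite xX.
have le1 := X0max a1; have sx := subset_leq_card SX.
split; first by lia.
move=> S0; rewrite ltn_neqAle; apply/andP; split; last by lia.
apply/negP => /eqP e; have := X0low a1; rewrite c1 e; move=> /(_ ltac:(lia)).
suff : X1 :&: U \subset K :\: Sx.
  move/subset_leq_card; rewrite cardsD (setIidPr SK) -/K => h1 h2.
  have := subset_leq_card SK; move: S0; rewrite -card_gt0; lia.
apply/subsetP => x; rewrite !inE => /andP[/orP[/andP[-> ->] ->//|/DL[xL _]] xU].
by case: (LU0 xL xU).
Qed.

Let J_single v : v \in J -> v \in single. Proof. by rewrite inE => /andP[]. Qed.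

Let J_K v : v \in J -> v \in K.
Proof. by rewrite !inE => /andP[/andP[-> _] ->]. Qed.

Let nuD v : v \in J -> nu v \in D.
Proof.
move=> vJ; have [vU uL uv _] := nuP (J_single vJ); rewrite inE uL andbT.
apply/negP => uX; have vX : v \in X0 by move: vJ; rewrite inE => /andP[].
by have := slot_anti_ninc X0a uX vX; rewrite uv.
Qed.

Let DL d : d \in D -> d \in L. Proof. by rewrite inE => /andP[]. Qed.

(* If d is left of nu v and w above d were right of v, then the two edges would
   cross and d would be a second neighbour of v. *)
Let left_of v d w : v \in J -> d \in L -> dec O d (nu v) -> w \in U -> inc O d w ->
  dec O w v.
Proof.
move=> vJ dL du wU dw; have [vU uL uv un] := nuP (J_single vJ).
have : w != v.
  by apply/negP => /eqP e; rewrite e in dw; have := un d dL dw => e2; rewrite e2 dec_irr in du.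
case/(decUP wU vU)/orP => // vw; have [dv _] := cross du vw dw uv.
by have := un d dL dv => e2; rewrite e2 dec_irr in du.
Qed.

Let right_of v d w : v \in J -> d \in L -> dec O (nu v) d -> w \in U -> inc O d w ->
  dec O v w.
Proof.
move=> vJ dL du wU dw; have [vU uL uv un] := nuP (J_single vJ).
have : w != v.
  by apply/negP => /eqP e; rewrite e in dw; have := un d dL dw => e2; rewrite e2 dec_irr in du.
case/(decUP wU vU)/orP => // wv; have [_ dv] := cross du wv uv dw.
by have := un d dL dv => e2; rewrite e2 dec_irr in du.
Qed.

Let belowDK v : v \in J -> #|belowD (nu v)| <= #|below v|.
Proof.
move=> vJ; apply: (proj1 (@exchange (below v) (belowD (nu v)) _ _ _)).
- by apply/subsetP => x; rewrite inE => /andP[].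
- by apply/subsetP => x; rewrite inE => /andP[].
- move=> d w; rewrite !inE => /andP[/andP[_ dL] du] wK dw.
  by rewrite wK /=; case/andP: wK => _ wU; apply: left_of du wU dw.
Qed.

Let aboveDK v : v \in J -> #|aboveD (nu v)| <= #|above v|.
Proof.
move=> vJ; apply: (proj1 (@exchange (above v) (aboveD (nu v)) _ _ _)).
- by apply/subsetP => x; rewrite inE => /andP[].
- by apply/subsetP => x; rewrite inE => /andP[].
- move=> d w; rewrite !inE => /andP[/andP[_ dL] du] wK dw.
  by rewrite wK /=; case/andP: wK => _ wU; apply: right_of du wU dw.
Qed.

Let p_le v : v \in J -> p v <= #|X0| - #|L|.
Proof.
move=> vJ; have b1 := belowDK vJ; have b2 := aboveDK vJ.
have vK := J_K vJ; have uD := nuD vJ.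
have cK : #|below v| + #|above v| < #|K|.
  rewrite -cardsU_disj => [|x]; last first.
    by rewrite !inE => /andP[_ h1] /andP[_ /dec_asym]; rewrite h1.
  apply: proper_card.
  apply/properP; split.
    by apply/subsetP => x; rewrite !inE => /orP[] /andP[].
  by exists v => //; rewrite !inE dec_irr !andbF.
have cD : #|D| <= (#|belowD (nu v)| + #|aboveD (nu v)|).+1.
  rewrite (cardsD1 (nu v) D) uD add1n ltnS.
  apply: leq_trans (leq_card_setU _ _); apply: subset_leq_card.
  apply/subsetP => x; rewrite !inE => /andP[xu /andP[xX xL]]; rewrite xX xL /=.
  by apply: decLP => //; apply: DL.
have cX : #|X0| = #|K| + #|X0 :&: L|.
  rewrite -(cardsID U X0) -/K; congr (_ + _); apply: eq_card => x; rewrite !inE.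
  apply/andP/andP => [[xU xX]|[xX xL]]; split => //.
    by move: xU; have := X0sub xX; case: (x \in L) => //= ->.
  by apply/negP => xU; apply: LU0 xL xU.
have cL : #|L| = #|X0 :&: L| + #|D| by rewrite setIC cardsID.
move: b1 b2 cK cD cX cL; rewrite /p; clear.
move: #|below v| #|above v| #|belowD (nu v)| #|aboveD (nu v)| #|X0 :&: L| #|K| #|D| #|X0| #|L|.
by move=> *; lia.
Qed.

Let p_lt v v' : v \in J -> v' \in J -> dec O v v' ->
  (nu v = nu v' \/ exists2 x, x \in J & dec O v x && dec O x v') -> p v < p v'.
Proof.
move=> vJ v'J vv' cse; have b1 := belowDK vJ; have b2 := belowDK v'J.
have [vU uL uv un] := nuP (J_single vJ); have [v'U u'L u'v' un'] := nuP (J_single v'J).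
have vK := J_K vJ.
pose B := [set w in K | dec O v w && dec O w v'].
have cB : #|below v| + #|B| < #|below v'|.
  rewrite -cardsU_disj => [|x]; last first.
    by rewrite !inE => /andP[_ h1] /and3P[_ /dec_asym]; rewrite h1.
  apply: proper_card.
  apply/properP; split.
    apply/subsetP => x; rewrite !inE => /orP[/andP[-> h]|/and3P[-> _ -> //]].
    by rewrite (dec_trans h vv').
  exists v; last by rewrite !inE dec_irr !andbF.
  by move: vK; rewrite !inE => ->.
have [e|ne] := eqVneq (nu v) (nu v').
  rewrite /p -e; rewrite -e in b2; move: b1 b2 cB; clear.
  by move: #|below v| #|below v'| #|belowD (nu v)| #|B|; lia.
have uu' : dec O (nu v) (nu v').
  case/(decLP uL u'L)/orP: ne => // u'u.
  have [h _] := cross u'u vv' u'v' uv.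
  by have e := un _ u'L h; rewrite e dec_irr in u'u.
pose Dx := [set d in D | dec O (nu v) d && dec O d (nu v')].
have cDx : #|belowD (nu v')| <= #|belowD (nu v)| + #|Dx| + 1.
  have -> : 1 = #|[set nu v]| by rewrite cards1.
  apply: leq_trans (leq_trans (leq_card_setU _ _) (leq_add (leq_card_setU _ _) (leqnn _))).
  apply: subset_leq_card; apply/subsetP => x; rewrite !inE => /andP[/andP[xX xL] xu'].
  rewrite xX xL xu' /= andbT; have [->|xu] := eqVneq x (nu v); first by rewrite orbT.
  by rewrite orbF; apply: decLP.
have [e|[x xJ /andP[vx xv']]] := cse; first by rewrite e eqxx in ne.
have lt : #|Dx| < #|B|.
  have [| | |_ h] := @exchange B Dx.
  - by apply/subsetP => y; rewrite inE => /andP[].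
  - by apply/subsetP => y; rewrite inE => /andP[].
  - move=> d w; rewrite !inE => /andP[/andP[_ dL] /andP[ud du']] /andP[-> wU] dw.
    by rewrite wU /= (right_of vJ dL ud wU dw) (left_of v'J dL du' wU dw).
  - apply: h; apply/set0Pn; exists x; move: (J_K xJ); rewrite !inE => ->.
    by rewrite vx.
move: b1 b2 cB cDx lt; rewrite /p; clear.
move: #|below v| #|below v'| #|belowD (nu v)| #|belowD (nu v')| #|B| #|Dx|.
by move=> *; lia.
Qed.

(** To v in J attach the number p v of upper elements of X0 on its left minus the
    number of lower elements outside X0 to the left of its neighbour.  By
    [exchange] this lies in an interval of length #|X0| - #|L|, and it strictly
    increases across any element of J lying in between, so that each value is
    taken at most twice. *)
Lemma single_in_lowest : #|J| <= 2 * (#|X0| - #|L|).+1.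
Proof.
apply: (@card_fibres _ _ p); first exact: p_le.
move=> i; rewrite leqNgt; apply/negP => c3.
have [] := @dec_three _ O _ _ c3.
  apply: monoW decU; apply/subsetP => v; rewrite inE => /andP[/J_single + _].
  exact: subsetP singleU v.
move=> a [b [c [+ + + ab bc]]]; rewrite !in_set => /andP[aX /eqP pa] /andP[bX _] /andP[cX /eqP pc].
have [aJ bJ cJ] : [/\ a \in J, b \in J & c \in J] by rewrite !in_setI !in_set.
suff : p a < p c by rewrite pa pc ltnn.
apply: p_lt => //; first exact: dec_trans ab bc.
by right; exists b => //; rewrite ab bc.
Qed.

End LowestMax.

(** The weight below orders antichains first by size and then, among those of
    equal size, by having few elements in U. *)
Lemma lowest_max : exists X0 : {set T}, [/\ slot_anti X0,
  forall S, slot_anti S -> #|S| <= #|X0| &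
  forall S, slot_anti S -> #|S| = #|X0| -> #|X0 :&: U| <= #|S :&: U| ].
Proof.
pose f (S : {set T}) := #|S| * #|T|.+1 + (#|T| - #|S :&: U|).
have a0 : slot_anti set0.
  by rewrite /slot_anti sub0set; apply/monoP => x y; rewrite inE.
case: (@arg_maxnP _ set0 slot_anti f a0) => X0 X0a X0m; exists X0.
have bd (S : {set T}) : #|S :&: U| <= #|T| by apply: max_card.
split => // S Sa => [|e]; have := X0m S Sa; rewrite /= /f; have := bd S; have := bd X0.
  move=> h1 h2 h3; rewrite leqNgt; apply/negP => h4.
  have : #|X0|.+1 * #|T|.+1 <= #|S| * #|T|.+1 by rewrite leq_mul2r h4 orbT.
  lia.
by rewrite e; lia.
Qed.

(** The elements of [single] in a suitable maximum antichain X0 are few by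
    [single_in_lowest].  The neighbours of the other ones are distinct elements
    of X0, and exchanging independently z of them yields 2 ^ z antichains of
    size k + 1. *)
Lemma card_single k z q :
  (forall S, slot_anti S -> #|S| <= q) ->
  (exists2 S, slot_anti S & k < #|S|) -> z <= k.+1 ->
  #|[set S : {set T} | slot_anti S & #|S| == k.+1]| < 2 ^ z ->
  #|single| <= z + 2 * (q - #|L|) + 1.
Proof.
move=> qm [S0 S0a S0k] zk few.
have [X0 [X0a X0m X0l]] := lowest_max.
have jb := single_in_lowest X0a X0m X0l.
have X0q := qm _ X0a; have X0k : k < #|X0| by apply: leq_trans S0k (X0m _ S0a).
pose Z := single :\: X0.
suff Zz : #|Z| < z.
  have := cardsID X0 single; rewrite -/Z; lia.
rewrite ltnNge; apply/negP => zZ.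
have X0sub x : x \in X0 -> (x \in L) || (x \in U).
  by case/andP: X0a => /subsetP h _ /h; rewrite inE.
have LU0 x : x \in L -> x \in U -> False.
  by move=> xL xU; have := slotLU xL xU; rewrite eqxx.
have ZU v : v \in Z -> v \in U.
  by rewrite inE => /andP[_ /(subsetP singleU)].
have Zs v : v \in Z -> v \in single by rewrite inE => /andP[].
(* An element of Z conflicts with X0 only through its single neighbour, so
   exchanging any subset of Z against these neighbours keeps an antichain;
   this is where the 2 ^ z antichains come from. *)
have swap (B A : {set T}) : A \subset Z -> B \subset X0 ->
    (forall v, v \in A -> nu v \notin B) -> slot_anti (B :|: A).
  move=> AZ BX nB; apply: slot_antiI.
    apply/subsetP => x; rewrite !inE => /orP[/(subsetP BX)/X0sub//|].
    by move=> /(subsetP AZ)/ZU ->; rewrite orbT.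
  move=> u v; rewrite !inE => /orP[uB|uA] /orP[vB|vA] uL vU.
  - by apply: slot_anti_ninc X0a _ _; apply: (subsetP BX).
  - apply/negP => uv; have [_ _ _ un] := nuP (Zs _ (subsetP AZ _ vA)).
    by have := nB _ vA; rewrite -(un u uL uv) uB.
  - by case: (LU0 u uL (ZU _ (subsetP AZ _ uA))).
  - by case: (LU0 u uL (ZU _ (subsetP AZ _ uA))).
have nuX v : v \in Z -> nu v \in X0.
  move=> vZ; apply/negPn/negP => nX.
  have vX : v \notin X0 by move: vZ; rewrite inE => /andP[].
  have : slot_anti (X0 :|: [set v]).
    by apply: swap; rewrite ?sub1set // => w /set1P ->.
  by move/X0m; rewrite setUC cardsU1 vX add1n ltnn.
have nu_inj : {in Z &, injective nu}.
  move=> v v' vZ v'Z e; apply/eqP/negPn/negP => vv'.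
  have sw : slot_anti ((X0 :\ nu v) :|: [set v; v']).
    apply: swap; last by move=> x /set2P[]->; rewrite -?e !inE eqxx.
      by apply/subsetP => x /set2P[]->.
    exact: subsetDl.
  have := X0m _ sw; rewrite cardsU_disj => [|x]; last first.
    by rewrite !inE => /andP[_ xX] /orP[]/eqP h; move: vZ v'Z; rewrite !inE -h xX.
  rewrite cards2 vv'.
  by have := cardsD1 (nu v) X0; rewrite (nuX _ vZ) => c1; lia.
have [Z0 Z0Z cZ0] := subset_of_card zZ.
have cnu : #|nu @: Z0| = z.
  by rewrite card_in_imset // => x y xZ yZ; apply: nu_inj; apply: (subsetP Z0Z).
have nuX0 : nu @: Z0 \subset X0.
  by apply/subsetP => _ /imsetP[v vZ ->]; apply/nuX/(subsetP Z0Z).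
have [X1 [nX1 X1X cX1]] : exists C : {set T},
    [/\ nu @: Z0 \subset C, C \subset X0 & #|C| = k.+1].
  by apply: subset_card_between; rewrite ?cnu.
pose f (A : {set T}) := (X1 :\: nu @: A) :|: A.
have X1Z v : v \in X1 -> v \in Z0 -> False.
  by move=> /(subsetP X1X) vX /(subsetP Z0Z); rewrite inE vX.
move: few; rewrite ltnNge => /negP; apply.
rewrite -cZ0 -card_powerset -(@card_in_imset _ _ f); last first.
  move=> A B; rewrite !inE => AZ BZ e; apply/setP => x.
  have h (C : {set T}) : C \subset Z0 -> (x \in C) = (x \in f C) && (x \in Z0).
    move=> CZ; rewrite !inE; apply/idP/andP => [xC|[/orP[/andP[_ xX]|//] xZ]].
      by rewrite xC orbT (subsetP CZ).
    by case: (X1Z x).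
  by rewrite (h A) // (h B) // e.
apply: subset_leq_card; apply/subsetP => _ /imsetP[A + ->]; rewrite !inE => AZ.
have AZ' : A \subset Z by apply: subset_trans AZ Z0Z.
apply/andP; split.
  apply: swap => //; first by apply: subset_trans X1X; apply: subsetDl.
  by move=> v vA; rewrite !inE imset_f.
have nAX : nu @: A \subset X1 by apply: subset_trans nX1; apply: imsetS.
rewrite cardsU_disj => [|x]; last first.
  by rewrite inE => /andP[_ xX] /(subsetP AZ); apply: X1Z.
rewrite cardsD (setIidPr nAX) card_in_imset; last first.
  by move=> x y xZ yZ; apply: nu_inj; apply: (subsetP AZ').
have := subset_leq_card nAX; rewrite card_in_imset; last first.
  by move=> x y xZ yZ; apply: nu_inj; apply: (subsetP AZ').
rewrite cX1 => h; apply/eqP; arith.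
Qed.

End Slot.

(** * Strands and strips *)

Section Strands.
Variables (T : finType) (O : biorder T) (X : {set T}).
Implicit Types (S B : {set T}) (x y u v : T) (i j lo hi : nat).
Notation lev := (lev O X).
Notation hgt := (hgt O X).

Lemma lev_slot j u v : u \in lev j -> v \in lev j.+1 -> (u != v) && ~~ inc O v u.
Proof.
move=> /levP[uX hu] /levP[vX hv]; apply/andP; split.
  by apply/negP => /eqP e; rewrite e hv in hu; lia.
by apply/negP => /(hgt_lt vX); rewrite hu hv; lia.
Qed.

Lemma dnP j u v : reflect (u \in lev j /\ inc O u v) (u \in lower O X j v).
Proof. by rewrite [X in reflect _ X]in_set; apply: andP. Qed.

(** Going down from level hi, the order preserving matchings of consecutive
    slots extend the surviving strands; at slot j at most w j - #|lev j| of them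
    are lost.  A strand is named by its top element, so st j x is the element of
    strand x at level j. *)
Lemma strands (w : nat -> nat) lo hi : lo <= hi ->
  (forall j S, lo <= j < hi -> S \subset lev j :|: lev j.+1 -> mono (dec O) S ->
     #|S| <= w j) ->
  exists (B : {set T}) (st : nat -> T -> T), [/\ B \subset lev hi,
    forall x, x \in B -> st hi x = x,
    forall j x, lo <= j <= hi -> x \in B -> st j x \in lev j,
    forall j x, lo <= j < hi -> x \in B -> inc O (st j x) (st j.+1 x) &
    (forall j x y, lo <= j <= hi -> x \in B -> y \in B -> dec O x y ->
       dec O (st j x) (st j y)) /\
    #|lev hi| <= #|B| + \sum_(lo <= j < hi) (w j - #|lev j|)].
Proof.
move=> lohi; have [d ->] : exists d, hi = lo + d by exists (hi - lo); lia.
move: lo {lohi} => lo; elim: d lo => [|d IH] lo wP.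
  rewrite addn0; exists (lev lo), (fun _ x => x); split => //.
  - by move=> j x jb; have -> : j = lo by lia.
  - by move=> j x jb; lia.
  - by split => //; rewrite big_geq ?addn0.
rewrite -addSnnS in wP *.
have [|B [st [BL stT stL stI [stD cB]]]] := IH lo.+1.
  by move=> j S jb; apply: wP; lia.
have [|M [mu [MU cM muP muD]]] := @slot_matching _ O _ _ (lev_dec O X lo) (lev_dec O X lo.+1)
  (@lev_slot lo) (w lo).
  by move=> S; apply: wP; lia.
have d0 : lo.+1 <= lo.+1 + d by lia.
pose B' := [set x in B | st lo.+1 x \in M].
pose st' j x := if j == lo then mu (st lo.+1 x) else st j x.
have BB : B' \subset B by apply/subsetP => x; rewrite inE => /andP[].
have bM x : x \in B' -> st lo.+1 x \in M by rewrite inE => /andP[].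
have st'1 j x : lo < j -> st' j x = st j x by rewrite /st'; case: eqP => // ->; lia.
have st'0 x : st' lo x = mu (st lo.+1 x) by rewrite /st' eqxx.
exists B', st'; split.
- exact: subset_trans BB BL.
- by move=> x /(subsetP BB) xB; rewrite st'1 ?stT //; lia.
- move=> j x jb xB'; have [->|jl] := eqVneq j lo.
    by rewrite st'0; case/andP: (muP _ (bM _ xB')).
  by rewrite st'1; [apply: stL; [lia|exact: (subsetP BB)]|lia].
- move=> j x jb xB'; have [->|jl] := eqVneq j lo.
    by rewrite st'0 st'1 //; case/andP: (muP _ (bM _ xB')).
  by rewrite !st'1; [apply: stI; [lia|exact: (subsetP BB)]|lia|lia].
split.
- move=> j x y jb xB' yB' xy; have [->|jl] := eqVneq j lo.
    rewrite !st'0; apply: muD; [exact: bM|exact: bM|].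
    by apply: stD; rewrite ?(subsetP BB) //; lia.
  by rewrite !st'1 ?stD ?(subsetP BB) //; lia.
have st_inj : {in B &, injective (st lo.+1)}.
  move=> x y xB yB e; apply/eqP/negPn/negP => xy.
  have := monoP _ _ (lev_dec O X (lo.+1 + d)) x y (subsetP BL _ xB) (subsetP BL _ yB) xy.
  have d1 : lo < lo.+1 <= lo.+1 + d by lia.
  by case/orP => h; [have := stD _ _ _ d1 xB yB h|have := stD _ _ _ d1 yB xB h];
    rewrite e dec_irr.
have cBB : #|B| - #|B'| <= w lo - #|lev lo|.
  have -> : #|B| - #|B'| = #|B :\: B'| by rewrite cardsD (setIidPr BB).
  rewrite -(@card_in_imset _ _ (st lo.+1)); last first.
    by move=> x y; rewrite !in_setD => /andP[_ xB] /andP[_ yB]; apply: st_inj.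
  apply: (@leq_trans #|lev lo.+1 :\: M|); last first.
    by rewrite cardsD (setIidPr MU); lia.
  apply: subset_leq_card; apply/subsetP => _ /imsetP[x + ->].
  rewrite in_setD inE negb_and => /andP[/orP[/negP//|nM] xB].
  by rewrite in_setD nM /=; apply: stL => //; lia.
rewrite big_ltn; last by lia.
by lia.
Qed.

(** The weak left-to-right order along a level. *)
Definition dec_eq x y := (x == y) || dec O x y.

Lemma dec_eq_refl x : dec_eq x x. Proof. by rewrite /dec_eq eqxx. Qed.

Lemma dec_eq_trans y x z : dec_eq x y -> dec_eq y z -> dec_eq x z.
Proof.
move=> /orP[/eqP->//|xy] /orP[/eqP<-|yz]; rewrite /dec_eq ?xy ?orbT //.
by rewrite (dec_trans xy yz) orbT.
Qed.

Lemma dec_eq_dec_trans y x z : dec_eq x y -> dec O y z -> dec O x z.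
Proof. by move=> /orP[/eqP->//|xy]; apply: dec_trans. Qed.

Lemma dec_dec_eq_trans y x z : dec O x y -> dec_eq y z -> dec O x z.
Proof. by move=> xy /orP[/eqP<-//|yz]; apply: dec_trans xy yz. Qed.

Lemma lev_dec_eq_total j x y : x \in lev j -> y \in lev j -> dec_eq x y || dec O y x.
Proof.
move=> xL yL; rewrite /dec_eq; have [//|xy] := eqVneq x y.
exact: (monoP _ _ (lev_dec O X j)).
Qed.

(** A walk between two strands cannot be forced out of the strip: if its
    neighbour lies outside, crossing the edge of a strand makes the strand
    element itself a neighbour. *)
Lemma strip_step j a a' b b' x : a \in lev j -> a' \in lev j ->
  inc O a b -> inc O a' b' -> dec_eq a a' ->
  dec_eq b x -> dec_eq x b' -> 0 < #|lower O X j x| ->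
  exists2 u, u \in lower O X j x & dec_eq a u && dec_eq u a'.
Proof.
move=> aL a'L ab ab' aa' bx xb' /card_gt0P[u uN].
have /dnP[uL ux] := uN.
case/orP: (lev_dec_eq_total aL uL) => [au|ua].
  case/orP: (lev_dec_eq_total uL a'L) => [ua'|a'u].
    by exists u => //; rewrite au.
  exists a'; last by rewrite aa' dec_eq_refl.
  rewrite inE a'L /=; case/orP: xb' => [/eqP->//|xb'].
  by case: (cross a'u xb' ab' ux).
exists a; last by rewrite aa' dec_eq_refl.
rewrite inE aL /=; case/orP: bx => [/eqP<-//|bx].
by case: (cross ua bx ux ab).
Qed.

(** A point between two neighbours of x can be neither left nor right of x. *)
Lemma dn_convex j x u v y : u \in lower O X j x -> v \in lower O X j x -> y \in lev j ->
  dec O u y -> dec O y v -> hgt x = j.+1 -> x \in X -> y \in lower O X j x.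
Proof.
move=> /dnP[uL ux] /dnP[vL vx] yL uy yv hx xX; apply/dnP; split => //.
have xL : x \in lev j.+1 by apply/levP.
have /andP[/(bi_total O)/or4P[//|xy|yx|xy] nxy] := lev_slot yL xL.
- by rewrite xy in nxy.
- by have := inc_ndec ux; rewrite (dec_trans uy yx).
- by have := inc_ndec' vx; rewrite (dec_trans xy yv).
Qed.

(** With a second neighbour available, the walk can branch if the strip is
    allowed to widen to the next strands a0 and a1. *)
Lemma strip_branch j a0 a a' a1 b b' x : a0 \in lev j -> a \in lev j -> a' \in lev j ->
  a1 \in lev j -> dec O a0 a -> dec O a' a1 ->
  inc O a b -> inc O a' b' -> dec_eq a a' ->
  dec_eq b x -> dec_eq x b' -> x \in lev j.+1 -> 1 < #|lower O X j x| ->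
  exists u1 u2, [/\ u1 \in lower O X j x, u2 \in lower O X j x, u1 != u2,
    dec_eq a u1 && dec_eq u1 a' & dec_eq a0 u2 && dec_eq u2 a1].
Proof.
move=> a0L aL a'L a1L a0a a'a1 ab ab' aa' bx xb' xL c1.
have [u1 u1N /andP[au1 u1a']] := strip_step aL a'L ab ab' aa' bx xb' (ltnW c1).
have /levP[xX hx] := xL.
have /card_gt0P[u] : 0 < #|lower O X j x :\ u1| by rewrite -(ltn_add2l 1) addn0; move: c1; rewrite (cardsD1 u1) u1N.
rewrite in_setD1 => /andP[uu1 uN]; have /dnP[uL _] := uN.
case/orP: (lev_dec_eq_total a0L uL) => [a0u|ua0]; last first.
  have a0u1 := dec_dec_eq_trans a0a au1.
  exists u1, a0; split => //; first exact: dn_convex uN u1N a0L ua0 a0u1 hx xX.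
  - by rewrite eq_sym; apply: dec_neq a0u1.
  - by rewrite au1.
  - by rewrite dec_eq_refl /dec_eq (dec_dec_eq_trans a0u1 (dec_eq_trans u1a' _)) ?orbT // /dec_eq a'a1 orbT.
case/orP: (lev_dec_eq_total uL a1L) => [ua1|a1u]; last first.
  have u1a1 := dec_eq_dec_trans u1a' a'a1.
  exists u1, a1; split => //; first exact: dn_convex u1N uN a1L u1a1 a1u hx xX.
  - by apply: dec_neq u1a1.
  - by rewrite au1.
  - rewrite dec_eq_refl andbT /dec_eq (dec_dec_eq_trans a0a (dec_eq_trans au1 _)) ?orbT //.
    by rewrite /dec_eq u1a1 orbT.
by exists u1, u; split; rewrite ?au1 ?a0u // eq_sym.
Qed.

End Strands.

(** The element x0 only serves as the value of the enumeration outside the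
    range. *)
Lemma mono_enum (T : finType) (O : biorder T) (x0 : T) (S : {set T}) : mono (inc O) S ->
  exists e : nat -> T, [/\ forall i, i < #|S| -> e i \in S,
    forall i j, i < j < #|S| -> inc O (e i) (e j) &
    forall x, x \in S -> exists2 i, i < #|S| & e i = x].
Proof.
move eN : #|S| => N; elim: N S eN => [|N IH] S eN mS.
  exists (fun _ => x0); split => // [i j|x]; first by rewrite ltn0 andbF.
  by rewrite (cards0_eq eN) inE.
have S0 : S != set0 by rewrite -card_gt0 eN.
have [u uS utop] := mono_top mS S0.
have c1 := cardsD1 u S; rewrite uS eN add1n in c1; case: c1 => /esym c1.
have [e [eS einc esurj]] := IH _ c1 (monoW (subsetDl _ _) mS).
exists (fun i => if i < N then e i else u); split.
- by move=> i iN; case: ifP => // /eS; rewrite inE => /andP[].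
- move=> i j /andP[ij jN]; have iN : i < N by lia.
  rewrite iN; case: ifP => jN'; first by apply: einc; rewrite ij.
  by have := eS i iN; rewrite !inE => /andP[eu eiS]; apply: utop.
- move=> x xS; have [->|xu] := eqVneq x u; first by exists N; rewrite ?ltnn.
  have [|i iN ei] := esurj x; first by rewrite !inE xu.
  by exists i; [lia|rewrite iN].
Qed.

(** * Descending walks *)

Definition homs (T : finType) (r : rel T) k (X : {set T}) : {set {set T}} :=
  [set S : {set T} | [&& S \subset X, mono r S & #|S| == k.+1]].

Lemma homsP (T : finType) (r : rel T) k (X S : {set T}) :
  reflect [/\ S \subset X, mono r S & #|S| = k.+1] (S \in homs r k X).
Proof. by rewrite inE; apply: (iffP and3P) => [[-> -> /eqP->]|[-> -> ->]]. Qed.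

(** Used to bound a number of sets by the number of sets from which they can be
    recovered. *)
Lemma card_cover_le (T1 T2 : finType) (A : {set T1}) (B : {set T2}) (g : T2 -> T1) :
  (forall a, a \in A -> exists2 b, b \in B & g b = a) -> #|A| <= #|B|.
Proof.
move=> h; apply: leq_trans (leq_imset_card g B); apply: subset_leq_card.
by apply/subsetP => a /h[b bB <-]; apply: imset_f.
Qed.

Section Walks.
Variables (T : finType) (O : biorder T) (X : {set T}).
Implicit Types (S B C N : {set T}) (x y u v : T).
Notation lev := (lev O X).
Notation hgt := (hgt O X).
Notation dn := (lower O X).

(** A walk from x down to level lo, as the set of its points: a chain with top x
    meeting every level from lo to i. *)
Definition walks (lo i : nat) x : {set {set T}} :=
  [set S : {set T} | [&& S \subset X, mono (inc O) S, x \in S,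
     [forall y in S, (y == x) || inc O y x], [forall y in S, lo <= hgt y] &
     #|S| + lo == i.+1]].

Lemma walksP lo i x S : reflect
  [/\ S \subset X, mono (inc O) S, x \in S,
      (forall y, y \in S -> y != x -> inc O y x) &
      (forall y, y \in S -> lo <= hgt y) /\ #|S| + lo = i.+1]
  (S \in walks lo i x).
Proof.
rewrite inE; apply: (iffP and5P).
  move=> [-> -> -> /forall_inP h /andP[/forall_inP h' /eqP->]]; split => // y yS yx.
  by have := h y yS; rewrite (negbTE yx).
move=> [-> -> -> h [h' ->]]; split => //.
  by apply/forall_inP => y yS; have [//|yx] := eqVneq y x; apply: h.
by rewrite eqxx andbT; apply/forall_inP.
Qed.

Lemma walks_base lo x : x \in lev lo -> 0 < #|walks lo lo x|.
Proof.
move=> /levP[xX hx]; apply/card_gt0P; exists [set x]; apply/walksP; split.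
- by rewrite sub1set.
- exact: mono1.
- exact: set11.
- by move=> y /set1P->; rewrite eqxx.
- by split; [move=> y /set1P->; rewrite hx|rewrite cards1].
Qed.

Lemma walks_step lo i x N : x \in lev i.+1 -> lo <= i -> N \subset dn i x ->
  \sum_(u in N) #|walks lo i u| <= #|walks lo i.+1 x|.
Proof.
move=> /levP[xX hx] loi /subsetP Nd.
have Nx u : u \in N -> inc O u x /\ hgt u = i by move/Nd/dnP => [/levP[]].
have xS u S : u \in N -> S \in walks lo i u -> x \notin S.
  move=> /Nx[ux _] /walksP[_ _ _ top _]; apply/negP => /top.
  have /negbTE h := inc_asym ux; rewrite h eq_sym => /(_ (inc_neq ux)) //.
rewrite (eq_bigr (fun u => #|[set x |: S | S in walks lo i u]|)); last first.
  move=> u uN; rewrite card_in_imset // => S S' SW SW' e.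
  by rewrite -(setU1K (xS u S uN SW)) e (setU1K (xS u S' uN SW')).
apply: sum_card_disjoint => [u uN|u u' S uN u'N].
  apply/subsetP => _ /imsetP[S SW ->]; have xnS := xS u S uN SW.
  have [ux hu] := Nx u uN; move/walksP: SW => [SX mS uS top [hl cS]].
  have yx y : y \in S -> inc O y x.
    by move=> yS; have [->//|/(top y yS) yu] := eqVneq y u; apply: inc_trans yu ux.
  apply/walksP; split.
  - by rewrite subUset sub1set xX.
  - by apply: monoU1 => // y yS _; rewrite yx ?orbT.
  - exact: setU11.
  - by move=> y /setU1P[->|yS]; rewrite ?eqxx // yx.
  - split; last by rewrite cardsU1 xnS; arith.
    by move=> y /setU1P[->|/hl//]; arith.
move=> /imsetP[S1 W1 ->] /imsetP[S2 W2 e].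
have eS : S1 = S2 by rewrite -(setU1K (xS u S1 uN W1)) e (setU1K (xS u' S2 u'N W2)).
move: W1 W2; rewrite -{}eS => /walksP[_ _ uS top _] /walksP[_ _ uS' top' _].
apply/eqP/negPn/negP => uu'; have h := top' u uS uu'.
rewrite eq_sym in uu'; have := top u' uS' uu'.
by apply/negP/inc_asym.
Qed.

(** Q c j is a strip of width c at level j.  At a clean slot a walk can either
    keep the width or spend one unit of it to obtain a second neighbour; with
    z - c units left, Pascal's rule counts the choices of the clean slots at
    which a unit is spent. *)
Lemma walks_lb lo hi z (clean : pred nat) (Q : nat -> nat -> pred T) :
  (forall j v c, lo <= j < hi -> v \in lev j.+1 -> Q c j.+1 v ->
     exists2 u, u \in dn j v & Q c j u) ->
  (forall j v c, lo <= j < hi -> c < z -> clean j -> v \in lev j.+1 -> Q c j.+1 v ->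
     exists u1 u2, [/\ u1 \in dn j v, u2 \in dn j v, u1 != u2, Q c j u1 & Q c.+1 j u2]) ->
  forall d v c, lo + d <= hi -> v \in lev (lo + d) -> Q c (lo + d) v -> c <= z ->
  'C(\sum_(lo <= j < lo + d) clean j, z - c) <= #|walks lo (lo + d) v|.
Proof.
move=> H0 H1; elim=> [|d IH] v c dhi vL vQ cz.
  rewrite addn0 in vL *; rewrite big_geq //.
  by apply: leq_trans (walks_base vL); case: (z - c).
rewrite addnS in dhi vL vQ *; rewrite big_nat_recr ?leq_addr //=.
set m := \sum_(_ <= _ < _) _ in IH *.
have jb : lo <= lo + d < hi by arith.
have [u0 u0N u0Q] := H0 _ _ _ jb vL vQ.
have [u0L _] := dnP _ _ _ _ _ u0N.
have step1 : #|walks lo (lo + d) u0| <= #|walks lo (lo + d).+1 v|.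
  have := @walks_step lo (lo + d) v [set u0] vL (leq_addr _ _).
  by rewrite sub1set u0N big_set1; apply.
have [cl|ncl] := boolP (clean (lo + d)); last first.
  by rewrite addn0; apply: leq_trans (IH u0 c (ltnW dhi) u0L u0Q cz) step1.
have [clz|zc] := ltnP c z; last first.
  have e : z - c = 0 by arith.
  rewrite e bin0; apply: leq_trans step1.
  by have := IH u0 c (ltnW dhi) u0L u0Q cz; rewrite e bin0.
have [u1 [u2 [u1N u2N u12 u1Q u2Q]]] := H1 _ _ _ jb clz cl vL vQ.
have [u1L _] := dnP _ _ _ _ _ u1N; have [u2L _] := dnP _ _ _ _ _ u2N.
have := @walks_step lo (lo + d) v [set u1; u2] vL (leq_addr _ _).
have -> : [set u1; u2] \subset dn (lo + d) v by apply/subsetP => x /set2P[]->.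
rewrite big_setU1 ?inE //= big_set1 => /(_ isT); apply: leq_trans.
rewrite -(subnSK clz) addn1 binS; apply: leq_add; first rewrite subnSK //.
  exact: IH u1 c (ltnW dhi) u1L u1Q cz.
exact: IH u2 c.+1 (ltnW dhi) u2L u2Q clz.
Qed.

Lemma walks_bottom lo i x S : S \in walks lo i x -> hgt x = i -> lo <= i ->
  exists2 b, b \in S & hgt b = lo.
Proof.
move=> /walksP[SX mS xS top [hl cS]] hx loi.
have [/exists_inP[b bS /eqP]|/exists_inPn no] := boolP [exists b in S, hgt b == lo].
  by exists b.
suff : #|S| <= i - lo by arith.
apply: (@card_inj_bound _ _ (fun y => hgt y - lo)) => [y y' yS y'S e|y yS].
  apply: (hgt_inj SX mS) => //; have := hl y yS; have := hl y' y'S; arith.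
have := hl y yS; have := no y yS; have : hgt y <= i.
  have [->|/(top y yS)] := eqVneq y x; first by rewrite hx.
  by move/(hgt_lt (subsetP SX _ yS)); arith.
by move=> h1 /eqP; arith.
Qed.

(** A walk from x is completed below its bottom by a longest chain and above x by
    the part of C above x; the result has at least k + 1 elements because C has
    at most i elements up to x.  The walk is recovered as the part between the
    levels lo and i. *)
Lemma walks_extend k lo i x C : C \in homs (inc O) k X -> x \in C -> hgt x = i ->
  0 < lo <= i -> i <= lo + k -> #|walks lo i x| <= #|homs (inc O) k X|.
Proof.
move=> /homsP[CX mC cC] xC hx loi ilo.
apply: (@card_cover_le _ _ _ _ (fun Z : {set T} => [set y in Z | lo <= hgt y <= i])) => S SW.
have [b bS hb] := walks_bottom SW hx ltac:(arith).
move: SW => /walksP[SX mS xS top [hl cS]].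
have SXP := subsetP SX; have CXP := subsetP CX.
have hS y : y \in S -> lo <= hgt y <= i.
  move=> yS; rewrite hl //=; have [->|/(top y yS)] := eqVneq y x; first by rewrite hx.
  by move/(hgt_lt (SXP _ yS)); arith.
have bmin y : y \in S -> y != b -> inc O b y.
  move=> yS yb; have /orP[yb'|//] := monoP _ _ mS y b yS bS yb.
  by have := hgt_lt (SXP _ yS) yb'; have := hS y yS; arith.
have [D [DX mD bD Dtop cD]] := walk_down O (SXP _ bS); rewrite hb in cD.
have DXP := subsetP DX.
pose Ab := [set y in C | inc O x y].
pose Z := (D :\ b) :|: (S :|: Ab).
have xX := SXP _ xS.
have DS d y : d \in D :\ b -> y \in S -> inc O d y.
  rewrite !inE => /andP[db dD] yS; have := Dtop d dD db.
  by have [->//|/(bmin _ yS) by_ db'] := eqVneq y b; apply: inc_trans db' by_.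
have SA y a : y \in S -> a \in Ab -> inc O y a.
  rewrite inE => yS /andP[_ xa]; have [->//|/(top _ yS) yx] := eqVneq y x.
  exact: inc_trans yx xa.
have DA d a : d \in D :\ b -> a \in Ab -> inc O d a.
  by move=> dD aA; apply: inc_trans (DS d x dD xS) (SA x a xS aA).
have mZ : mono (inc O) Z.
  apply/monoP => y y'; rewrite /Z 4!in_setU => /or3P[yD|yS|yA] /or3P[y'D|y'S|y'A] yy'.
  - move: yD y'D; rewrite !in_setD1 => /andP[_ yD] /andP[_ y'D].
    exact: (monoP _ _ mD).
  - by rewrite DS.
  - by rewrite DA.
  - by rewrite (DS y' y) ?orbT.
  - exact: (monoP _ _ mS).
  - by rewrite SA.
  - by rewrite (DA y' y) ?orbT.
  - by rewrite (SA y' y) ?orbT.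
  - move: yA y'A; rewrite !inE => /andP[yC _] /andP[y'C _].
    exact: (monoP _ _ mC).
have ZX : Z \subset X.
  rewrite /Z !subUset SX (subset_trans (subsetDl _ _) DX) /=.
  by apply/subsetP => y; rewrite inE => /andP[/CXP].
have hD d : d \in D :\ b -> hgt d < lo.
  by move=> dD; rewrite -hb; apply: hgt_lt (DS d b dD bS); move: dD; rewrite inE => /andP[_ /DXP].
have hA a : a \in Ab -> i < hgt a.
  by move=> aA; rewrite -hx; apply: hgt_lt (SA x a xS aA).
have cA : k.+1 - i <= #|Ab|.
  have Abc : #|C :\: Ab| <= i.
    have nx : #|(C :\: Ab) :\ x| < hgt x.
      apply: (@hgt_ge _ O).
      - exact: subset_trans (subsetDl _ _) (subset_trans (subsetDl _ _) CX).
      - exact: monoW (subset_trans (subsetDl _ _) (subsetDl _ _)) mC.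
      - move=> y; rewrite !inE negb_and => /and3P[yx + yC]; rewrite yC /= => nxy.
        by have := monoP _ _ mC y x yC xC yx; rewrite (negbTE nxy) orbF.
    by have := cardsD1 x (C :\: Ab); rewrite !inE inc_irr xC /=; arith.
  have := cardsID Ab C; have : #|C :&: Ab| <= #|Ab| by apply/subset_leq_card/subsetIr.
  arith.
have cZ : k < #|Z|.
  rewrite /Z cardsU_disj => [|y /hD ?]; last first.
    by rewrite in_setU => /orP[/hS ?|/hA ?]; arith.
  rewrite cardsU_disj => [|y /hS ? /hA ?]; last by arith.
  by have := cardsD1 b D; rewrite bD; arith.
have SZ : S \subset Z by apply/subsetP => y yS; rewrite !inE yS orbT.
have cSk : #|S| <= k.+1 by arith.
have [E [SE EZ cE]] := subset_card_between SZ cSk cZ.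
exists E.
  by apply/homsP; split=> //; [apply: subset_trans EZ ZX|apply: monoW EZ mZ].
apply/setP => y; rewrite in_set; apply/andP/idP => [[/(subsetP EZ) yZ hy]|yS].
  by move: yZ; rewrite /Z 2!in_setU => /or3P[/hD ?|//|/hA ?]; arith.
by rewrite hS // (subsetP SE).
Qed.

End Walks.

(** * Bundles of strands *)

Lemma central_bin m : 2 ^ m <= 'C(2 * m, m).
Proof.
elim: m => // m IH; rewrite expnS mulnS add2n binS.
have -> : 'C((2 * m).+1, m) = 'C((2 * m).+1, m.+1).
  by rewrite -bin_sub; [congr 'C(_, _); lia|lia].
by rewrite binS; lia.
Qed.

Section Bundles.
Variables (T : finType) (O : biorder T) (X : {set T}) (k q z : nat).
Implicit Types (S B C N : {set T}) (x y u v : T).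
Notation lev := (lev O X).
Notation hgt := (hgt O X).
Notation dn := (lower O X).

Definition good j := [exists S : {set T},
  [&& S \subset lev j :|: lev j.+1, mono (dec O) S & k < #|S|]].

(** Bound for the antichains of a slot, and hence for the number of strands
    lost there. *)
Definition cap j := if good j then q else k.

Definition exc j := single O (lev j) (lev j.+1).

Lemma goodP j S : S \subset lev j :|: lev j.+1 -> mono (dec O) S -> k < #|S| -> good j.
Proof. by move=> SL mS cS; apply/existsP; exists S; rewrite SL mS. Qed.

Lemma nexc_dn j v : 0 < j -> v \in lev j.+1 -> v \notin exc j -> 1 < #|dn j v|.
Proof.
case: j => // j _ vL; rewrite inE vL /=; have := dn_gt0 vL; rewrite /lower.
by move: #|_| => m; case: m => [|[|]].
Qed.

Hypothesis dec_le : forall S, S \subset X -> mono (dec O) S -> #|S| <= q.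

Lemma slot_sub j : lev j :|: lev j.+1 \subset X.
Proof. by rewrite subUset !lev_sub. Qed.

Lemma cap_bound j S : S \subset lev j :|: lev j.+1 -> mono (dec O) S -> #|S| <= cap j.
Proof.
move=> SL mS; rewrite /cap; case: ifPn => [_|/negP ng].
  by apply: dec_le mS; apply: subset_trans SL (slot_sub j).
by rewrite leqNgt; apply/negP => kS; exact: ng (goodP SL mS kS).
Qed.

(** By [card_single], few elements above a good slot fail to branch. *)
Lemma exc_bound j : good j -> z <= k.+1 -> #|homs (dec O) k X| < 2 ^ z ->
  #|exc j| <= z + 2 * (q - #|lev j|) + 1.
Proof.
move=> /existsP[S /and3P[SL mS kS]] zk few.
have sl := @lev_slot _ O X j.
apply: (@card_single _ O _ _ (lev_dec O X j) (lev_dec O X j.+1) sl k).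
- by move=> S' /andP[/subset_trans/(_ (slot_sub j))]; apply: dec_le.
- by exists S; rewrite /slot_anti ?SL.
- exact: zk.
apply: leq_ltn_trans few; apply: subset_leq_card; apply/subsetP => S'.
rewrite inE => /andP[/andP[S'L mS'] /eqP cS']; apply/homsP; split => //.
exact: subset_trans S'L (slot_sub j).
Qed.

(** From these points every walk extends to a homogeneous chain. *)
Definition rich i := [set x in lev i | [exists C in homs (inc O) k X, x \in C]].

(** The surviving strands through rich points are cut into bundles of 2 z + 1
    consecutive strands, with a walk starting at the middle one.  A bundle is
    clean at a good slot if its strip contains no exceptional element there.
    Being clean at 2 z good slots would yield 2 ^ z homogeneous chains, so
    every bundle is dirty at all but 2 z of the good slots, and dirtiness is paid
    for by exceptional elements. *)
Lemma bundle_bound lo i : 0 < lo <= i -> i <= lo + k ->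
  #|homs (inc O) k X| < 2 ^ z -> 2 * z <= \sum_(lo <= j < i) good j ->
  ((#|rich i| - \sum_(lo <= j < i) (cap j - #|lev j|)) %/ (2 * z).+1)
     * (\sum_(lo <= j < i) good j - 2 * z).+1
  <= \sum_(lo <= j < i | good j) #|exc j|.
Proof.
move=> loi ilo few gz.
have lo0 : 0 < lo by arith.
have li : lo <= i by arith.
have [|B [st [BL stT stL stI [stD cB]]]] := @strands _ O X cap lo i li.
  by move=> j S _; apply: cap_bound.
set D := \sum_(_ <= _ < _) (_ - _) in cB *; set g := \sum_(_ <= _ < _) _ in gz *.
pose Y := rich i :&: B; set w := (2 * z).+1.
have cY : #|rich i| - D <= #|Y|.
  have rL : rich i \subset lev i by apply/subsetP => x; rewrite inE => /andP[].
  have := cardsID B (rich i); have := subset_leq_card (setSD B rL).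
  have -> : #|lev i :\: B| = #|lev i| - #|B| by rewrite cardsD (setIidPr BL).
  by rewrite -/Y; arith.
apply: leq_trans (_ : #|Y| %/ w * (g - 2 * z).+1 <= _); first by rewrite leq_mul2r leq_div2r ?orbT.
have [Y0|] := posnP #|Y|; first by rewrite Y0 div0n.
move/card_gt0P => [x0 _].
have YB : Y \subset B by apply: subsetIr.
have [e [eY einc _]] : exists e : nat -> T, [/\ forall t, t < #|Y| -> e t \in Y,
    forall t s, t < s < #|Y| -> dec O (e t) (e s) &
    forall x, x \in Y -> exists2 t, t < #|Y| & e t = x].
  apply: (@mono_enum _ (dual O) x0); apply: monoW (lev_dec O X i).
  exact: subset_trans YB BL.
have eB t : t < #|Y| -> e t \in B by move/eY/(subsetP YB).
set nb := #|Y| %/ w.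
have nbw b : b < nb -> b * w + 2 * z < #|Y|.
  move=> bn; have := leq_trunc_div #|Y| w; rewrite -/nb.
  have : b.+1 * w <= nb * w by rewrite leq_mul2r bn orbT.
  by rewrite mulSn /w; arith.
have stleD j t s : lo <= j <= i -> t <= s < #|Y| -> dec_eq O (st j (e t)) (st j (e s)).
  move=> jb /andP[ts sY]; have [->|ts'] := eqVneq t s; first exact: dec_eq_refl.
  have tls : t < s by rewrite ltn_neqAle ts'.
  rewrite /dec_eq stD ?orbT ?eB ?(ltn_trans tls) //.
  by apply: einc; rewrite tls.
have stdec j t s : lo <= j <= i -> t < s < #|Y| -> dec O (st j (e t)) (st j (e s)).
  move=> jb /andP[ts sY]; apply: stD; rewrite ?eB ?(ltn_trans ts) //.
  by apply: einc; rewrite ts.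
pose Q b c j v := [&& c <= z, dec_eq O (st j (e (b * w + z - c))) v &
                        dec_eq O v (st j (e (b * w + z + c)))].
pose dirty b j := [exists v in exc j, Q b z j.+1 v].
pose clean b j := good j && ~~ dirty b j.
(* Otherwise the middle element of the bundle, which lies on a homogeneous
   chain, starts 'C(2 * z, z) walks. *)
have few_clean b : b < nb -> \sum_(lo <= j < i) clean b j < 2 * z.
  move=> bn; rewrite ltnNge; apply/negP => many.
  have bw := nbw b bn.
  have bz : b * w + z < #|Y| by apply: leq_ltn_trans bw; rewrite leq_add2l leq_pmull.
  have idx c : c <= z -> b * w + z + c < #|Y| by move=> cz; apply: leq_ltn_trans bw; arith.
  have xY := eY _ bz; set x := e _ in xY.
  move: (xY); rewrite inE => /andP[]; rewrite inE => /andP[xL /exists_inP[C CH xC]] xB.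
  have [_ hx] := levP _ _ _ _ xL.
  have := walks_extend CH xC hx loi ilo.
  apply/negP; rewrite -ltnNge; apply: leq_trans few _.
  apply: leq_trans (_ : 'C(\sum_(lo <= j < i) clean b j, z) <= _).
    apply: leq_trans (_ : 'C(2 * z, z) <= _).
      exact: central_bin.
    move: many; move: (2 * z) (\sum_(_ <= _ < _) _); elim: z => [|m IH] a c ac; first by rewrite !bin0.
    exact: leq_bin2l.
  rewrite -{1}(subn0 z); have [d ed] : exists d, i = lo + d by exists (i - lo); arith.
  rewrite ed; apply: (@walks_lb _ O X lo i z (clean b) (Q b)).
  - move=> j v c jb vL /and3P[cz Q1 Q2].
    have jb' : lo <= j <= i by arith.
    have jb'' : lo <= j.+1 <= i by arith.
    have i2 := idx c cz; have i1 : b * w + z - c < #|Y| by arith.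
    have [||u uN uQ] := @strip_step _ O X j _ (st j (e (b * w + z + c))) _ _ v
       (stL j _ jb' (eB _ i1)) (stL j _ jb' (eB _ i2)) (stI j _ jb (eB _ i1))
       (stI j _ jb (eB _ i2)) _ Q1 Q2.
    + by apply: stleD => //; arith.
    + by case: j jb vL {Q1 Q2 jb' jb''} => [|j] jb vL; [arith|apply: dn_gt0].
    + by exists u => //; rewrite /Q cz.
  - move=> j v c jb cz /andP[_ /exists_inPn cl] vL /and3P[_ Q1 Q2].
    have jb' : lo <= j <= i by arith.
    have jb'' : lo <= j.+1 <= i by arith.
    have i2 := idx c (ltnW cz); have i1 : b * w + z - c < #|Y| by arith.
    have i3 := idx c.+1 cz; have i0 : b * w + z - c.+1 < #|Y| by arith.
    have iz := idx z (leqnn z).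
    have ne : v \notin exc j.
      apply/negP => vE; have := cl v vE; rewrite /Q leqnn /=; move/negP; apply.
      apply/andP; split; first by apply: dec_eq_trans Q1; apply: stleD => //; arith.
      by apply: dec_eq_trans Q2 _; apply: stleD => //; arith.
    have j0 : 0 < j by arith.
    have [|||u1 [u2 [u1N u2N u12 uQ1 uQ2]]] := @strip_branch _ O X j
       (st j (e (b * w + z - c.+1))) (st j (e (b * w + z - c)))
       (st j (e (b * w + z + c))) (st j (e (b * w + z + c.+1))) _ _ v
       (stL j _ jb' (eB _ i0)) (stL j _ jb' (eB _ i1))
       (stL j _ jb' (eB _ i2)) (stL j _ jb' (eB _ i3)) _ _ (stI j _ jb (eB _ i1))
       (stI j _ jb (eB _ i2)) _ Q1 Q2 vL (nexc_dn j0 vL ne).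
    + by apply: stdec => //; arith.
    + by apply: stdec => //; arith.
    + by apply: stleD => //; arith.
    + by exists u1, u2; split; rewrite // /Q ?cz ?(ltnW cz).
  - by rewrite -ed.
  - by rewrite -ed.
  - by rewrite -ed /Q subn0 addn0 stT // !dec_eq_refl.
  - by [].
(* The strips of different bundles are disjoint, so an exceptional element
   spoils one bundle only. *)
have dirty_le j : lo <= j < i -> \sum_(b < nb) dirty b j <= #|exc j|.
  move=> jb; have jb' : lo <= j.+1 <= i by arith.
  have -> : \sum_(b < nb) dirty b j = #|[set b : 'I_nb | dirty b j]|.
    by rewrite -sum1dep_card [RHS]big_mkcond; apply: eq_bigr => b _; case: (dirty _ _).
  have [->|/set0Pn[b0 _]] := eqVneq [set b : 'I_nb | dirty b j] set0; first by rewrite cards0.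
  apply: (@card_cover_le _ _ _ _ (fun v => odflt b0 [pick b : 'I_nb | Q b z j.+1 v])).
  move=> b; rewrite inE => /exists_inP[v vE vQ]; exists v => //.
  case: pickP => [b' vQ'|/(_ b)]; last by rewrite vQ.
  have uniq (b1 b2 : 'I_nb) : Q b1 z j.+1 v -> Q b2 z j.+1 v -> b1 < b2 -> False.
    move=> /and3P[_ _ h1] /and3P[_ h2 _] b12.
    have : dec O v v; last by rewrite dec_irr.
    apply: dec_eq_dec_trans h1 _; apply: dec_dec_eq_trans h2; apply: stdec => //.
    have := nbw b2 (ltn_ord b2); have := leq_mul b12 (leqnn w); rewrite mulSn.
    by rewrite /w; arith.
  case: (ltngtP b' b) => [lt|lt|/val_inj //].
    by case: (uniq _ _ vQ' vQ lt).
  by case: (uniq _ _ vQ vQ' lt).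
have dirty_ge b : b < nb -> (g - 2 * z).+1 <= \sum_(lo <= j < i | good j) dirty b j.
  move=> bn; have lt2 := few_clean b bn.
  suff eg : g = \sum_(lo <= j < i) clean b j + \sum_(lo <= j < i | good j) dirty b j.
    by move: gz; rewrite eg; arith.
  rewrite /g [X in _ = _ + X]big_mkcond -big_split; apply: eq_bigr => j _; rewrite /clean /=.
  by case: (good j) => //=; case: (dirty b j).
apply: (@leq_trans (\sum_(b < nb) \sum_(lo <= j < i | good j) dirty b j)).
  apply: (@leq_trans (\sum_(b < nb) (g - 2 * z).+1)); first by rewrite sum_nat_const card_ord.
  by apply: leq_sum => b _; apply: dirty_ge.
rewrite exchange_big /= big_nat_cond [X in _ <= X]big_nat_cond.
by apply: leq_sum => j /andP[jb _]; apply: dirty_le.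
Qed.

End Bundles.

(** * Many good slots *)

(** Telescoping over overlapping windows: the total increase of a monotone
    function over windows of length w counts its range at most w times. *)
Lemma sum_window_diff (f : nat -> nat) w n bd : (forall m, f m <= bd) ->
  (forall i, i < n -> f i <= f (w + i)) ->
  \sum_(0 <= i < n) (f (w + i) - f i) <= w * bd.
Proof.
move=> fb fm.
have -> : \sum_(0 <= i < n) (f (w + i) - f i) =
          \sum_(0 <= i < n) f (w + i) - \sum_(0 <= i < n) f i.
  rewrite big_nat_cond sumnB -?big_nat_cond // => i /andP[/andP[_ /fm]] //.
rewrite leq_subLR.
have e1 : \sum_(0 <= i < w + n) f i = \sum_(0 <= i < w) f i + \sum_(0 <= i < n) f (w + i).
  rewrite (@big_cat_nat _ _ _ w) ?leq_addr //=; congr (_ + _).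
  by rewrite -{1}[w]add0n big_addn addKn; apply: eq_bigr => i _; rewrite addnC.
have e2 : \sum_(0 <= i < n + w) f i = \sum_(0 <= i < n) f i + \sum_(0 <= i < w) f (n + i).
  rewrite (@big_cat_nat _ _ _ n) ?leq_addr //=; congr (_ + _).
  by rewrite -{1}[n]add0n big_addn addKn; apply: eq_bigr => i _; rewrite addnC.
have e3 : \sum_(0 <= i < w) f (n + i) <= w * bd.
  apply: leq_trans (_ : \sum_(0 <= i < w) bd <= _); first by apply: leq_sum.
  by rewrite sum_nat_const_nat subn0.
by rewrite addnC in e2; lia.
Qed.

Section ManyGood.
Variables (T : finType) (O : biorder T) (X : {set T}) (k s z : nat).
Implicit Types (S B C N : {set T}) (x y u v : T).
Notation q := (k + s).
Notation lev := (lev O X).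
Notation hgt := (hgt O X).
Notation dn := (lower O X).
Notation good := (good O X k).

Hypothesis inc_le : forall S, S \subset X -> mono (inc O) S -> #|S| <= q.
Hypothesis dec_le : forall S, S \subset X -> mono (dec O) S -> #|S| <= q.

Definition good_count i := \sum_(1 <= j < i) good j.
Definition shortage j := k - #|lev j|.
Definition nlong := \sum_(1 <= j < q.+1) (k < #|lev j|).

Lemma lev_le j : #|lev j| <= q.
Proof. by apply: dec_le; [apply: lev_sub | apply: lev_dec]. Qed.

(** The levels add up to the size of X, and a level exceeds k by at most s. *)
Lemma defect_sum : #|X| + \sum_(1 <= j < q.+1) shortage j <= k * q + s * nlong.
Proof.
rewrite (@card_lev_sum _ O X q); last by move=> v; apply: hgt_le.
rewrite -big_split /=.
apply: leq_trans (_ : \sum_(1 <= j < q.+1) (k + s * (k < #|lev j|)) <= _).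
  apply: leq_sum => j _; have := lev_le j; rewrite /shortage.
  by move: #|_| => a; case: ltnP => /=; lia.
by rewrite big_split /= -big_distrr /= sum_nat_const_nat subSS subn0 mulnC.
Qed.

Lemma long_good j : k < #|lev j| -> good j.
Proof. by apply: goodP; [apply: subsetUl|apply: lev_dec]. Qed.

Lemma long_good' j : k < #|lev j.+1| -> good j.
Proof. by apply: goodP; [apply: subsetUr|apply: lev_dec]. Qed.

(** A long level makes the slot above it good; only level q has no slot above. *)
Lemma nlong_le : nlong <= (good_count q).+1.
Proof.
rewrite /nlong /good_count; have [->|q0] := posnP q; first by rewrite big_geq.
rewrite big_nat_recr //= -[X in _ <= X]addn1; apply: leq_add; last by case: (_ < _).
by apply: leq_sum => j _; have [/long_good->|] := ltnP k _.
Qed.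

Lemma gcount_mono i j : i <= j -> good_count i <= good_count j.
Proof.
move=> ij; rewrite /good_count; have [i1|i1] := leqP i 1; first by rewrite big_geq.
by rewrite [X in _ <= X](@big_cat_nat _ _ _ i) ?leq_addr //= ltnW.
Qed.

Lemma gcountB i j : 0 < i <= j -> \sum_(i <= t < j) good t = good_count j - good_count i.
Proof.
by move=> ij; rewrite /good_count [in RHS](@big_cat_nat _ _ _ i) //=; lia.
Qed.

Lemma gcount_le i : good_count i <= i.-1.
Proof.
rewrite /good_count; apply: leq_trans (_ : \sum_(1 <= j < i) 1 <= _).
  by apply: leq_sum => j _; case: (good j).
by rewrite sum_nat_const_nat muln1; lia.
Qed.

(** This enumerates the good slots: the one of index m is preceded by m good
    slots. *)
Lemma gcount_hit m i : m < good_count i -> exists j, [/\ 0 < j < i, good j & good_count j = m].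
Proof.
elim: i => [|i IH]; first by rewrite /good_count big_geq.
have [i0|i0] := posnP i; first by rewrite i0 /good_count big_geq.
rewrite {1}/good_count big_nat_recr //= -/(good_count i) => mi.
have [/IH[j [jb gj <-]]|im] := ltnP m (good_count i); first by exists j; split=> //; lia.
by exists i; move: mi; case gi: (good i); split; lia.
Qed.

Hypothesis zk : 100 * z ^ 2 <= k.
Hypothesis sz : 0 < s <= z.
Hypothesis few_inc : #|homs (inc O) k X| < 2 ^ z.
Hypothesis few_dec : #|homs (dec O) k X| < 2 ^ z.

(** [bundle_bound] applied to a window with 4 z good slots.  Both the strands
    lost and the exceptional elements of the window are O(z ^ 2), which is small
    compared with k. *)
Lemma rich_small lo i : 0 < lo <= i -> i <= lo + k ->
  \sum_(lo <= j < i) good j = 4 * z ->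
  \sum_(lo <= j < i) shortage j <= 8 * z * s -> 2 * #|rich O X k i| <= k.
Proof.
move=> loi ilo g4 d8.
have zk1 : z <= k.+1 by nia.
have := @bundle_bound _ O X k q z dec_le lo i loi ilo few_inc.
rewrite g4 => /(_ ltac:(lia)).
set D := \sum_(_ <= _ < _) (_ - _); set E := \sum_(_ <= _ < _ | _) _; set rc := #|rich _ _ _ _|.
have hD : D <= 8 * z * s + 4 * z * s.
  apply: leq_trans (_ : \sum_(lo <= j < i) (shortage j + s * good j) <= _).
    by apply: leq_sum => j _; rewrite /cap /shortage; case: (good j); move: #|_|; lia.
  by rewrite big_split /= -big_distrr /= g4; lia.
have hE : E <= (z + 2 * s + 1) * (4 * z) + 2 * (8 * z * s).
  apply: leq_trans (_ : \sum_(lo <= j < i) ((z + 2 * s + 1) * good j + 2 * shortage j) <= _).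
    rewrite /E big_mkcond /=; apply: leq_sum => j _; case: ifP => // gj.
    have := exc_bound dec_le gj zk1 few_dec.
    by rewrite /shortage muln1; arith.
  by rewrite big_split /= -!big_distrr /= g4; lia.
move: hD hE; have := divn_eq (rc - D) (2 * z).+1.
have : (rc - D) %% (2 * z).+1 < (2 * z).+1 by rewrite ltn_mod.
move: (_ %% _) (_ %/ _) => a nb; move: D E rc => D E rc ha e hD hE h.
have e2 : 4 * z - 2 * z = 2 * z by lia.
rewrite {}e2 in h.
have hs : z * s <= z * z by rewrite leq_mul2l; lia.
have : (nb * (2 * z).+1) <= 4 * (z * z) + 4 * z + 24 * (z * z) by lia.
move: zk; rewrite -mulnn; have : z <= z * z by nia.
move: (nb * _) => b; move: e; lia.
Qed.

(** Windows of 4 z consecutive good slots are placed below each good slot.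
    The total shortage of the levels is O(s) per good slot, so at least s of the
    windows have a small shortage, and the top levels of these contain few rich
    points.  A homogeneous chain misses only s - 1 levels, so it meets one of
    those s levels in a rich point. *)
Lemma many_good : k * q < #|X| -> 13 * z <= good_count q ->
  exists Y : {set T}, 2 * #|Y| <= k * s /\
    forall C, C \in homs (inc O) k X -> exists2 y, y \in C & y \in Y.
Proof.
move=> bigX manyG; set G := good_count q in manyG *.
have q0 : 0 < q by lia.
pose g m : nat := odflt (Ordinal q0) [pick i : 'I_q | [&& 0 < i, good i & good_count i == m]].
have gP m : m < G -> [/\ 0 < g m < q, good (g m) & good_count (g m) = m].
  move=> mG; rewrite /g; case: pickP => [i /and3P[i0 gi /eqP->]|no] /=; first by rewrite i0 ltn_ord.
  have [j [/andP[j0 jq] gj cj]] := gcount_hit mG.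
  by have := no (Ordinal jq); rewrite /= j0 gj cj eqxx.
have gq m : g m < q by rewrite /g ltn_ord.
have glt a b : a < b < G -> g a < g b.
  move=> ab; have [_ _ ea] := gP a ltac:(lia); have [_ _ eb] := gP b ltac:(lia).
  by rewrite ltnNge; apply/negP => /gcount_mono; rewrite ea eb; lia.
pose Dt := \sum_(1 <= j < q.+1) shortage j.
have hDt : Dt <= s * G.+1.
  have := defect_sum; have : s * nlong <= s * G.+1 by rewrite leq_mul2l nlong_le orbT.
  rewrite -/Dt; lia.
pose D i := \sum_(1 <= j < i) shortage j.
have Dmono i j : i <= j -> D i <= D j.
  move=> ij; rewrite /D; have [i1|i1] := leqP i 1; first by rewrite big_geq.
  by rewrite [X in _ <= X](@big_cat_nat _ _ _ i) ?leq_addr //= ltnW.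
pose bad (m : nat) := k < 2 * #|rich O X k (g m)|.
(* Window i ends at the good slot of index 5 z + i and starts at the one of index
   z + i.  At least s slots lie below the start, so that the window spans fewer
   than k levels. *)
pose n := G - 5 * z.
have bad_far i : i < n -> bad (5 * z + i) -> 8 * z * s < D (g (5 * z + i)) - D (g (z + i)).
  move=> hi; rewrite /bad; apply: contraLR; rewrite -!leqNgt => h.
  have [gb1 g1 c1] := gP (5 * z + i) ltac:(lia).
  have [gb2 g2 c2] := gP (z + i) ltac:(lia).
  have lt : g (z + i) < g (5 * z + i) by apply: glt; lia.
  have loi : 0 < g (z + i) <= g (5 * z + i) by lia.
  apply: (rich_small loi).
  - by have := gcount_le (g (z + i)); rewrite c2; lia.
  - by rewrite gcountB // c1 c2; lia.
  apply: leq_trans h; rewrite /D [X in _ <= X - _](@big_cat_nat _ _ _ (g (z + i))) //=; lia.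
have nbad : \sum_(0 <= i < n) bad (5 * z + i) * (8 * z * s).+1 <= 4 * z * (s * G.+1).
  apply: leq_trans (_ : \sum_(0 <= i < n) (D (g (z + (4 * z + i))) - D (g (z + i))) <= _).
    rewrite big_nat_cond [X in _ <= X]big_nat_cond; apply: leq_sum => i /andP[hi _].
    have -> : z + (4 * z + i) = 5 * z + i by lia.
    by have := bad_far i ltac:(lia); case: (bad _) => //= /(_ isT); rewrite mul1n.
  apply: leq_trans (_ : 4 * z * Dt <= _); last by rewrite leq_mul2l hDt orbT.
  apply: (@sum_window_diff (fun i => D (g (z + i)))) => [m|i hi].
    by apply: Dmono; have := gq (z + m); lia.
  by apply: Dmono; apply: ltnW; apply: glt; lia.
have nbad2 : 2 * \sum_(0 <= i < n) bad (5 * z + i) <= G.+1.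
  rewrite -big_distrl /= in nbad; move: (\sum_(_ <= _ < _) _) nbad => b nbad.
  have zs : 0 < 4 * z * s by rewrite !muln_gt0; lia.
  by rewrite -(leq_pmul2l zs); lia.
pose Ms := [set i : 'I_n | ~~ bad (5 * z + i)].
have cMs : s <= #|Ms|.
  have : #|Ms| + \sum_(0 <= i < n) bad (5 * z + i) = n.
    rewrite -sum1dep_card big_mkcond big_mkord -big_split /=.
    rewrite (eq_bigr (fun=> 1)) ?sum1_card ?card_ord // => i _.
    by case: (bad _).
  rewrite /n; move: #|Ms| (\sum_(_ <= _ < _) _) nbad2; lia.
have [M0 MM cM] := subset_of_card cMs.
pose lv (i : 'I_n) := g (5 * z + i).
exists (\bigcup_(i in M0) rich O X k (lv i)); split.
  apply: leq_trans (_ : 2 * \sum_(i in M0) #|rich O X k (lv i)| <= _).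
    rewrite leq_mul2l /=; elim/big_rec2: _ => [|i y1 Y _ IH]; first by rewrite cards0.
    by apply: leq_trans (leq_card_setU _ _) _; rewrite leq_add2l.
  rewrite big_distrr /=; apply: leq_trans (_ : \sum_(i in M0) k <= _).
    by apply: leq_sum => i /(subsetP MM); rewrite inE /bad -leqNgt.
  by rewrite sum_nat_const cM mulnC.
move=> C CH; have [CX mC cC] := homsP _ _ _ _ CH.
have [/exists_inP[y yC yY]|/exists_inPn no] :=
    boolP [exists y in C, y \in \bigcup_(i in M0) rich O X k (lv i)]; first by exists y.
have miss y i : y \in C -> i \in M0 -> hgt y != lv i.
  move=> yC iM; apply/negP => /eqP e; have /negP := no y yC; apply.
  apply/bigcupP; exists i => //; rewrite inE; apply/andP; split.
    by apply/levP; split => //; apply: (subsetP CX).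
  by apply/exists_inP; exists C.
have := @uniq_leq_size _ ([seq hgt y | y <- enum C] ++ [seq lv i | i <- enum M0]) (iota 1 q).
rewrite size_cat !size_map -!cardE size_iota cC cM => h.
have : k.+1 + s <= q; last by lia.
apply: h.
  rewrite cat_uniq; apply/and3P; split.
  - rewrite map_inj_in_uniq ?enum_uniq // => x y; rewrite !mem_enum.
    exact: (hgt_inj CX mC).
  - apply/hasPn => _ /mapP[i + ->]; rewrite mem_enum => iM.
    by apply/mapP => -[y]; rewrite mem_enum => yC e; have := miss y i yC iM; rewrite e eqxx.
  - rewrite map_inj_in_uniq ?enum_uniq // => i j _ _ e; apply/val_inj.
    have := ltn_ord i; have := ltn_ord j; rewrite {2 4}/n => hj hi.
    by case: (ltngtP i j) => // lt; have := glt; [move=> /(_ (5 * z + i) (5 * z + j))|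
      move=> /(_ (5 * z + j) (5 * z + i))]; rewrite -!/(lv _) e ltnn => /(_ ltac:(lia)).
move=> a; rewrite mem_cat mem_iota => /orP[] /mapP[y + ->]; rewrite mem_enum => yP.
  have := hgt_gt0 O X y; have := hgt_le inc_le (subsetP CX _ yP); lia.
have [+ _ _] := gP (5 * z + y) ltac:(have := ltn_ord y; rewrite {2}/n; lia).
by rewrite -/(lv y); lia.
Qed.

End ManyGood.

(** * Families of chains read off from walks *)

(** F is first enlarged to exactly f elements, which leaves a free choice of
    m - f among the remaining elements of A. *)
Lemma card_draws_between (T : finType) (F A : {set T}) f m : F \subset A -> #|F| <= f ->
  f <= m -> f <= #|A| ->
  'C(#|A| - f, m - f) <= #|[set I : {set T} | [&& F \subset I, I \subset A & #|I| == m]]|.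
Proof.
move=> FA Ff fm fA; have [F' [FF' F'A cF']] := subset_card_between FA Ff fA.
have <- : #|A :\: F'| = #|A| - f by rewrite cardsD (setIidPr F'A) cF'.
rewrite -cards_draws -(@card_in_imset _ _ (fun J => F' :|: J)).
  apply: subset_leq_card; apply/subsetP => _ /imsetP[J + ->]; rewrite !inE => /andP[JA /eqP cJ].
  have /andP[JA' dis] : (J \subset A) && [disjoint J & F'] by rewrite -subsetD.
  rewrite (subset_trans FF' (subsetUl _ _)) subUset F'A JA' /=.
  move: dis; rewrite disjoint_sym -leq_card_setU => /eqP ->; rewrite cF' cJ; apply/eqP; lia.
move=> J J'; rewrite !inE => /andP[JA _] /andP[J'A _] e; apply/setP => x.
have h (K : {set T}) : K \subset A :\: F' -> (x \in K) = (x \in F' :|: K) && (x \notin F').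
  move=> KA; rewrite inE; apply/idP/andP => [xK|[/orP[->//|//]]].
  by have := subsetP KA x xK; rewrite inE => /andP[-> _]; rewrite xK orbT.
by rewrite (h J) // (h J') // e.
Qed.

Section Families.
Variables (T : finType) (O : biorder T) (X : {set T}) (k q : nat).
Implicit Types (S B C N : {set T}) (x y u v : T).
Notation lev := (lev O X).
Notation hgt := (hgt O X).
Notation dn := (lower O X).

(** The family a consists of the chains obtained by restricting the walk w a to
    a set K of levels that contains the forced levels F a and is contained in
    the allowed levels A a.  A chain determines K by its heights, so two families
    are disjoint as soon as the walks differ on some level forced for one of
    them.  The rank only serves to examine each pair of families once. *)
Lemma fam_count (I : finType) (P : pred I) (w : I -> nat -> T)
    (A F : I -> {set 'I_q.+1}) (f rk : I -> nat) :
  (forall a, P a -> [/\ F a \subset A a, #|F a| <= f a, f a <= k.+1 & f a <= #|A a|]) ->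
  (forall a i, P a -> i \in A a -> w a i \in lev i) ->
  (forall a i j, P a -> i \in A a -> j \in A a -> i < j -> inc O (w a i) (w a j)) ->
  (forall a b (K : {set 'I_q.+1}), rk a <= rk b -> P a -> P b -> a != b -> F a \subset K -> F b \subset K ->
     K \subset A a -> K \subset A b ->
     #|K| = k.+1 -> (forall i, i \in K -> w a i = w b i) -> False) ->
  \sum_(a | P a) 'C(#|A a| - f a, k.+1 - f a) <= #|homs (inc O) k X|.
Proof.
move=> FA wL wI sep.
pose dr a := [set K : {set 'I_q.+1} | [&& F a \subset K, K \subset A a & #|K| == k.+1]].
have recover a (K : {set 'I_q.+1}) (i : 'I_q.+1) : P a -> K \subset A a -> (i \in K) = [exists u in [set w a t | t : 'I_q.+1 in K], hgt u == i].
  move=> Pa KA; apply/idP/exists_inP => [iK|[_ /imsetP[t tK ->] /eqP e]].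
    exists (w a i); first by apply/imsetP; exists i.
    by have /levP[_ ->] := wL a i Pa (subsetP KA _ iK).
  by have /levP[_ h] := wL a t Pa (subsetP KA _ tK); rewrite h in e; rewrite -(val_inj e).
have inj a (K K' : {set 'I_q.+1}) b : P a -> P b -> K \subset A a -> K' \subset A b ->
    [set w a t | t : 'I_q.+1 in K] = [set w b t | t : 'I_q.+1 in K'] -> K = K'.
  by move=> Pa Pb KA KB e; apply/setP => i; rewrite (recover a K) // (recover b K') // e.
apply: leq_trans (_ : \sum_(a | P a) #|[set [set w a t | t : 'I_q.+1 in (K : {set 'I_q.+1})] | K in dr a]| <= _).
  apply: leq_sum => a Pa; rewrite card_in_imset.
    by have [? ? ? ?] := FA a Pa; apply: card_draws_between.
  by move=> K K'; rewrite !inE => /and3P[_ KA _] /and3P[_ K'A _]; apply: inj.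
apply: sum_card_disjoint => [a Pa|a b S Pa Pb].
  apply/subsetP => _ /imsetP[K + ->]; rewrite inE => /and3P[_ KA /eqP cK].
  have wm i j : i \in K -> j \in K -> i < j -> inc O (w a i) (w a j).
    by move=> iK jK; apply: wI => //; apply: (subsetP KA).
  apply/homsP; split.
  - apply/subsetP => _ /imsetP[t tK ->].
    by have /levP[] := wL a t Pa (subsetP KA _ tK).
  - apply/monoP => _ _ /imsetP[i iK ->] /imsetP[j jK ->] ij.
    case: (ltngtP i j) => [lt|lt|/val_inj e]; last by rewrite e eqxx in ij.
      by rewrite wm.
    by rewrite (wm j i) ?orbT.
  - rewrite card_in_imset // => i j iK jK e; apply/val_inj.
    have /levP[_ h1] := wL a i Pa (subsetP KA _ iK).
    by have /levP[_ h2] := wL a j Pa (subsetP KA _ jK); rewrite /= -h1 -h2 e.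
move=> /imsetP[K + ->] /imsetP[K' + e]; rewrite !inE => /and3P[FK KA /eqP cK] /and3P[FK' K'A /eqP cK'].
apply/eqP/negPn/negP => ab; have eK := inj _ _ _ _ Pa Pb KA K'A e.
rewrite -eK in FK' K'A e.
have agree (i : 'I_q.+1) : i \in K -> w a i = w b i.
  move=> iK.
  have : w a i \in [set w b t | t : 'I_q.+1 in K] by rewrite -e; apply/imsetP; exists i.
  case/imsetP => t tK et; have /levP[_ h1] := wL a i Pa (subsetP KA _ iK).
  have /levP[_ h2] := wL b t Pb (subsetP K'A _ tK).
  by rewrite et; congr (w b _); rewrite -h1 et h2.
case/orP: (leq_total (rk a) (rk b)) => rab; first exact: (sep a b K).
by apply: (sep b a K) => //; [rewrite eq_sym|move=> i /agree].
Qed.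

Lemma walk_inc lo hi (w : nat -> T) : (forall j, lo <= j < hi -> inc O (w j) (w j.+1)) ->
  forall i j, lo <= i -> i < j <= hi -> inc O (w i) (w j).
Proof.
move=> h i j loi; elim: j => // j IH ij.
have [->|ne] := eqVneq i j; first by apply: h; lia.
apply: inc_trans (h j _); last by lia.
by apply: IH; lia.
Qed.

Lemma walk_exists (P : nat -> pred T) lo hi v : lo <= hi -> v \in lev hi -> P hi v ->
  (forall j u, lo <= j < hi -> u \in lev j.+1 -> P j.+1 u -> exists2 u', u' \in dn j u & P j u') ->
  exists w : nat -> T, [/\ w hi = v, forall j, lo <= j <= hi -> w j \in lev j,
    forall j, lo <= j <= hi -> P j (w j) &
    forall j, lo <= j < hi -> inc O (w j) (w j.+1)].
Proof.
move=> lohi; have [d ->] : exists d, hi = lo + d by exists (hi - lo); lia.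
elim: d v {lohi} => [|d IH] v vL vP step.
  rewrite addn0 in vL vP *; exists (fun=> v); split=> // j jb; try lia.
    by have -> : j = lo by lia.
  by have -> : j = lo by lia.
rewrite addnS in vL vP step *.
have [|u /dnP[uL uv] uP] := step (lo + d) v _ vL vP; first by lia.
have [|w [wu wL wP wI]] := IH u uL uP; first by move=> j u' jb; apply: step; lia.
exists (fun j => if j == (lo + d).+1 then v else w j); split.
- by rewrite eqxx.
- by move=> j jb; case: eqP => [->//|ne]; apply: wL; lia.
- by move=> j jb; case: eqP => [->//|ne]; apply: wP; lia.
- move=> j jb; case: eqP => [e|_]; first lia.
  rewrite eqSS; case: eqP => [->|ne]; first by rewrite wu.
  by apply: wI; lia.
Qed.

Lemma walk_down_exists i v : v \in lev i -> 0 < i -> exists w : nat -> T,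
  [/\ w i = v, forall j, 1 <= j <= i -> w j \in lev j &
      forall j, 1 <= j < i -> inc O (w j) (w j.+1)].
Proof.
move=> vL i0; have [|w [? ? _ ?]] := @walk_exists (fun=> predT) 1 i v i0 vL isT.
  case=> [|j] u jb uL _; first lia.
  by have /card_gt0P[u' ?] := dn_gt0 uL; exists u'.
by exists w.
Qed.

(** Levels are numbered from 1; an index in [ordinal q.+1] is then a level number. *)
Definition levels : {set 'I_q.+1} := [set i | 0 < val i].

Lemma card_levels : #|levels| = q.
Proof.
have -> : levels = [set~ ord0].
  by apply/setP => i; rewrite !inE lt0n.
by have := cardsC1 (@ord0 q); rewrite card_ord.
Qed.

Definition at_levels (s : seq nat) : {set 'I_q.+1} := [set i | val i \in s].

Lemma at_levels_sub s : 0 \notin s -> at_levels s \subset levels.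
Proof.
move=> s0; apply/subsetP => i; rewrite !inE lt0n => iS.
by apply/negP => /eqP e; rewrite e (negbTE s0) in iS.
Qed.

Lemma card_at_levels s : #|at_levels s| <= size s.
Proof.
rewrite cardE -(size_map val); apply: uniq_leq_size.
  by rewrite map_inj_uniq ?enum_uniq //; apply: val_inj.
by move=> _ /mapP[i + ->]; rewrite mem_enum inE.
Qed.

Lemma at_levels_in s (K : {set 'I_q.+1}) j : at_levels s \subset K -> j \in s -> j <= q ->
  (inord j : 'I_q.+1) \in K.
Proof. by move=> /subsetP h js jq; apply: h; rewrite inE /= inordK. Qed.

End Families.

(** * Walks leaving a strand once or twice *)

Lemma card_into (I T : finType) (A : {set I}) (E : {set T}) (h : I -> T) :
  {in A &, injective h} -> (forall a, a \in A -> h a \in E) -> #|A| <= #|E|.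
Proof.
move=> hi hE; rewrite -(card_in_imset hi); apply: subset_leq_card.
by apply/subsetP => _ /imsetP[a aA ->]; apply: hE.
Qed.

Lemma sum_pair_le (I J : finType) (P : pred (I * J)) (Q : pred J) (a : J -> nat) c :
  (forall j, Q j -> a j <= #|[set i | P (i, j)]|) ->
  \sum_(j | Q j) a j * c <= \sum_(p | P p) c.
Proof.
move=> h; apply: leq_trans (_ : \sum_(j : J) \sum_(i | P (i, j)) c <= _).
  rewrite [X in _ <= X](bigID Q) /=; apply: leq_trans (leq_addr _ _).
  by apply: leq_sum => j Qj; rewrite sum_nat_const leq_mul2r -cardsE h ?orbT.
rewrite (exchange_big_dep predT) //= pair_big_dep /=.
by rewrite (eq_bigl P) // => -[].
Qed.

Ltac at_level := rewrite ?inE ?eqxx ?orbT //; arith.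

Section Branches.
Variables (T : finType) (O : biorder T) (X : {set T}) (k q : nat).
Implicit Types (S B C N : {set T}) (x y u v : T).
Notation lev := (lev O X).
Notation hgt := (hgt O X).
Notation dn := (lower O X).
Notation good := (good O X k).
Notation exc := (exc O X).
Hypothesis dec_le : forall S, S \subset X -> mono (dec O) S -> #|S| <= q.
Hypothesis kq : k < q.
Hypothesis k3 : 3 <= k.

(** Three kinds of families are counted.  A strand gives 'C(q, k.+1) chains.  A
    walk that follows strand x down to level g + 1 and then moves to another
    element of level g is identified by x and g once both levels are forced.
    Finally, such a walk can be changed a second time at the lowest good slot
    g0, forcing four levels.  To know that the second change is possible for
    most strands, only every third strand is used, with the walk confined
    between its two neighbours: then different walks reach different elements of
    level g0 + 1, and few of these are exceptional. *)
Lemma branch_count g0 : 0 < g0 -> (forall g, 0 < g -> good g -> g0 <= g) ->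
  exists R, #|lev q| <= R + \sum_(1 <= j < q) (cap O X k q j - #|lev j|) /\
  R * 'C(q, k.+1) + \sum_(1 <= g < q | good g) (R - #|exc g|) * 'C(q - 2, k.-1)
   + \sum_(1 <= g < q | good g && (g != g0))
       (R %/ 3 - #|exc g| - #|exc g0|) * 'C(q - 4, k - 3)
  <= #|homs (inc O) k X|.
Proof.
move=> g00 g0low; have q1 : 1 <= q by arith.
have [|B [st [BL stT stL stI [stD cB]]]] := @strands _ O X (cap O X k q) 1 q q1.
  by move=> j S _; exact: cap_bound.
exists #|B|; split=> //; set R := #|B|.
have [R0|] := posnP R.
  by rewrite R0 mul0n !big1 // => i _; rewrite div0n !sub0n mul0n.
rewrite {1}/R => /card_gt0P[x0 x0B].
have [e [eB einc _]] : exists e : nat -> T, [/\ forall t, t < #|B| -> e t \in B,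
    forall t s, t < s < #|B| -> dec O (e t) (e s) &
    forall x, x \in B -> exists2 t, t < #|B| & e t = x].
  by apply: (@mono_enum _ (dual O) x0); apply: monoW (lev_dec O X q).
rewrite -/R in eB einc.
have st_inj j : 1 <= j <= q -> {in B &, injective (st j)}.
  move=> jb x y xB yB exy; apply/eqP/negPn/negP => xy.
  have := monoP _ _ (lev_dec O X q) x y (subsetP BL _ xB) (subsetP BL _ yB) xy.
  by case/orP => h; [have := stD _ _ _ jb xB yB h|have := stD _ _ _ jb yB xB h];
    rewrite exy dec_irr.
have stdec j t s : 1 <= j <= q -> t < s < R -> dec O (st j (e t)) (st j (e s)).
  by move=> jb ts; apply: stD => //; [apply: eB; arith|apply: eB; arith|apply: einc].
have e_inj t s : t < R -> s < R -> e t = e s -> t = s.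
  move=> tR sR ets; case: (ltngtP t s) => // lt.
    by have := einc t s; rewrite lt sR ets dec_irr => /(_ isT).
  by have := einc s t; rewrite lt tR ets dec_irr => /(_ isT).
(* Strand 3 a + 1 is left only inside the strip between its two neighbours; these
   strips are disjoint. *)
pose strip a j v := dec_eq O (st j (e (3 * a))) v && dec_eq O v (st j (e (3 * a + 2))).
have strip_disj a a' j v : 1 <= j <= q -> 3 * a + 2 < R -> 3 * a' + 2 < R ->
    strip a j v -> strip a' j v -> a = a'.
  move=> jb; wlog lt : a a' / a < a'.
    move=> wl h1 h2 h3 h4; case: (ltngtP a a') => // lt; first exact: wl.
    by apply/esym/wl.
  move=> h1 h2 /andP[_ h3] /andP[h4 _]; have : dec O v v; last by rewrite dec_irr.
  apply: dec_eq_dec_trans h3 _; apply: dec_dec_eq_trans h4; apply: stdec => //.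
  by apply/andP; split; arith.
pose Br x g (w : nat -> T) := [/\ forall j, g < j <= q -> w j = st j x, w g <> st g x,
  forall j, 1 <= j <= q -> w j \in lev j &
  forall j, 1 <= j < q -> inc O (w j) (w j.+1)].
pose P1 (p : T * 'I_q) := [&& p.1 \in B, 0 < p.2, good p.2 & st p.2.+1 p.1 \notin exc p.2].
have glue x (g : nat) u : x \in B -> 0 < g < q -> u \in dn g (st g.+1 x) -> u <> st g x ->
    forall w', w' g = u -> (forall j, 1 <= j <= g -> w' j \in lev j) ->
    (forall j, 1 <= j < g -> inc O (w' j) (w' j.+1)) ->
    Br x g (fun j => if j <= g then w' j else st j x).
  move=> xB gb uN une w' wu wL wI; split.
  - by move=> j jb; rewrite leqNgt; have -> : g < j by arith.
  - by rewrite leqnn wu.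
  - by move=> j jb; case: leqP => jg; [apply: wL; arith|apply: stL => //; arith].
  - move=> j jb; case: (ltngtP j g) => jg.
    + by apply: wI; arith.
    + by apply: stI => //; arith.
    + by rewrite jg wu; case/dnP: uN.
have br1 (p : T * 'I_q) : exists w, P1 p -> Br p.1 p.2 w /\
    forall a, 3 * a + 2 < R -> p.1 = e (3 * a + 1) -> forall j, 1 <= j <= p.2 -> strip a j (w j).
  case: p => x g /=; case: (boolP (P1 (x, g))) => [|_]; last by exists (fun=> x0).
  move=> /and4P[/= xB gp gg nx]; have gq := ltn_ord g.
  have gb : 0 < g < q by arith.
  have vL : st g.+1 x \in lev g.+1 by apply: stL => //; arith.
  have dn2 := nexc_dn gp vL nx.
  have gb1 : 1 <= g <= q by arith.
  have sxL := stL g x gb1 xB.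
  have gb2 : 0 < g < q by arith.
  have sxI := stI g x gb2 xB.
  case: (pickP (fun a : 'I_R => (3 * a + 2 < R) && (x == e (3 * a + 1)))) => [a /andP[aR /eqP xe]|no].
    have i0 : 3 * a < R by arith.
    have i1 : 3 * a + 1 < R by arith.
    have [||u1 [u2 [u1N u2N u12 /andP[h1 h2] h3]]] := @strip_branch _ O X g
        (st g (e (3 * a))) (st g x) (st g x) (st g (e (3 * a + 2))) _ _ (st g.+1 x)
        (stL g _ gb1 (eB _ i0)) sxL sxL (stL g _ gb1 (eB _ aR)) _ _ sxI sxI
        (dec_eq_refl _ _) (dec_eq_refl _ _) (dec_eq_refl _ _) vL dn2.
    + by rewrite xe; apply: stdec => //; arith.
    + by rewrite xe; apply: stdec => //; arith.
    have u1e : u1 = st g x.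
      case/orP: h1 => [/eqP-> //|h1]; case/orP: h2 => [/eqP-> //|h2].
      by have := dec_trans h1 h2; rewrite dec_irr.
    have u2ne : u2 <> st g x by rewrite -u1e => e2; rewrite e2 eqxx in u12.
    have [u2L _] := dnP _ _ _ _ _ u2N.
    have [|w [wu wL wP wI]] := @walk_exists _ O X (strip a) 1 g u2 gp u2L h3.
      move=> j u jb uL /andP[Q1 Q2]; have jb1 : 1 <= j <= q by arith.
      have jb2 : 1 <= j < q by arith.
      have [||u' u'N u'Q] := @strip_step _ O X j _ (st j (e (3 * a + 2))) _ _ u
         (stL j _ jb1 (eB _ i0)) (stL j _ jb1 (eB _ aR)) (stI j _ jb2 (eB _ i0))
         (stI j _ jb2 (eB _ aR)) _ Q1 Q2.
      - by rewrite /dec_eq stdec ?orbT //; arith.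
      - by case: j jb uL {Q1 Q2 jb1 jb2} => [|j] jb uL; [arith|apply: dn_gt0].
      by exists u'.
    exists (fun j => if j <= g then w j else st j x) => _; split; first exact: (glue x g u2).
    move=> a' a'R xe' j jb; have -> : j <= g by arith.
    have ea : 3 * a + 1 = 3 * a' + 1 by apply: e_inj; [arith|arith|rewrite -xe].
    have <- : nat_of_ord a = a' by move: ea; clear; lia.
    exact: wP.
  have /card_gt0P[u] : 0 < #|dn g (st g.+1 x) :\ st g x|.
    by have := cardsD1 (st g x) (dn g (st g.+1 x)); case: (_ \in _) => /=; arith.
  rewrite in_setD1 => /andP[/eqP une uN]; have [uL _] := dnP _ _ _ _ _ uN.
  have [w [wu wL wI]] := walk_down_exists uL gp.
  exists (fun j => if j <= g then w j else st j x) => _; split; first exact: (glue x g u).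
  move=> a aR xe; have aR' : a < R by arith.
  by have := no (Ordinal aR'); rewrite /= aR xe eqxx.
have {br1}[w1 w1P] := fin_all_exists br1.
pose xa (a : 'I_(R %/ 3)) := e (3 * a + 1).
have aR (a : 'I_(R %/ 3)) : 3 * a + 2 < R.
  by have := ltn_ord a; have := leq_trunc_div R 3; arith.
pose P2 (p : 'I_(R %/ 3) * 'I_q) :=
  [&& P1 (xa p.1, p.2), val p.2 != g0 & w1 (xa p.1, p.2) g0.+1 \notin exc g0].
have br2 (p : 'I_(R %/ 3) * 'I_q) : exists w, P2 p -> [/\ Br (xa p.1) p.2 w,
    forall j, g0 < j -> w j = w1 (xa p.1, p.2) j & w g0 <> w1 (xa p.1, p.2) g0].
  case: p => a g; case: (boolP (P2 (a, g))) => [|_]; last by exists (fun=> x0).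
  move=> /and3P[/= p1 gg0 nx]; have [[h1 h2 h3 h4] _] := w1P _ p1.
  have /and4P[/= xB gp gg _] := p1; have gq := ltn_ord g.
  have g0g : g0 < g by rewrite ltn_neqAle eq_sym gg0 g0low.
  set w := w1 _ in h1 h2 h3 h4 nx *.
  have vL : w g0.+1 \in lev g0.+1 by apply: h3; arith.
  have dn2 := nexc_dn g00 vL nx.
  have /card_gt0P[u] : 0 < #|dn g0 (w g0.+1) :\ w g0|.
    by have := cardsD1 (w g0) (dn g0 (w g0.+1)); case: (_ \in _) => /=; arith.
  rewrite in_setD1 => /andP[/eqP une uN]; have [uL ui] := dnP _ _ _ _ _ uN.
  have [w' [wu wL wI]] := walk_down_exists uL g00.
  exists (fun j => if j <= g0 then w' j else w j) => _; split.
  - split.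
    + move=> j jb; have gj : g0 < j by arith.
      by rewrite leqNgt gj; exact: h1.
    + by rewrite leqNgt g0g.
    + by move=> j jb; case: leqP => jg; [apply: wL; arith|apply: h3; arith].
    + move=> j jb; case: (ltngtP j g0) => jg.
      * by apply: wI; arith.
      * by apply: h4; arith.
      * by rewrite jg wu.
  - by move=> j jb; rewrite leqNgt jb.
  - by rewrite leqnn wu.
have {br2}[w2 w2P] := fin_all_exists br2.
have brsep x g w x' g' w' : Br x g w -> Br x' g' w' -> x \in B -> x' \in B ->
    0 < g < q -> 0 < g' < q -> w g = w' g -> w g.+1 = w' g.+1 -> w g' = w' g' ->
    w g'.+1 = w' g'.+1 -> x = x' /\ g = g'.
  move=> b b' xB x'B gb gb' e1 e2 e3 e4.
  have [u1 u2 _ _] := b; have [v1 v2 _ _] := b'.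
  case: (ltngtP g g') => gg.
  - move: e4; rewrite u1 ?v1; [|arith|arith] => /st_inj exx.
    case: v2; rewrite -e3 u1; [congr (st _ _); apply: exx => //; arith|arith].
  - move: e2; rewrite u1 ?v1; [|arith|arith] => /st_inj exx.
    case: u2; rewrite e1 v1; [congr (st _ _); apply/esym/exx => //; arith|arith].
  - split => //; move: e2; rewrite u1 ?v1; [|arith|arith].
    by apply: st_inj => //; arith.
have strsep x g w x' : Br x g w -> x \in B -> x' \in B -> 0 < g < q ->
    w g = st g x' -> w g.+1 = st g.+1 x' -> False.
  move=> [u1 u2 _ _] xB x'B gb e1; rewrite u1; last by arith.
  move/st_inj => exx; apply: u2; rewrite e1; congr (st _ _); apply/esym/exx => //; arith.
pose I := ((T + T * 'I_q) + 'I_(R %/ 3) * 'I_q)%type.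
pose P (a : I) := match a with inl (inl x) => x \in B | inl (inr p) => P1 p | inr p => P2 p end.
pose w (a : I) := match a with inl (inl x) => st^~ x | inl (inr p) => w1 p | inr p => w2 p end.
pose F (a : I) : {set 'I_q.+1} := match a with inl (inl x) => set0
  | inl (inr p) => at_levels q [:: val p.2; p.2.+1]
  | inr p => at_levels q [:: val p.2; p.2.+1; g0; g0.+1] end.
pose f (a : I) := match a with inl (inl x) => 0 | inl (inr p) => 2 | inr p => 4 end.
have P1g p : P1 p -> [/\ p.1 \in B, 0 < p.2 < q & good p.2].
  by case/and4P=> -> -> ->; rewrite ltn_ord.
have P2g p : P2 p -> [/\ xa p.1 \in B, 0 < p.2 < q, good p.2, g0 < p.2 & P1 (xa p.1, p.2)].
  move=> /and3P[p1 g1 _]; have [h1 h2 h3] := P1g _ p1; split => //.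
  by rewrite ltn_neqAle eq_sym g1 g0low //; case/andP: h2.
have wLI a : P a -> (forall j, 1 <= j <= q -> w a j \in lev j) /\
    (forall j, 1 <= j < q -> inc O (w a j) (w a j.+1)).
  case: a => [[x|p]|p] Pa /=.
  - by split => j jb; [apply: stL|apply: stI].
  - by have [[_ _ ? ?] _] := w1P p Pa.
  - by have [[_ _ ? ?] _] := w2P p Pa.
have : \sum_(a | P a) 'C(#|levels q| - f a, k.+1 - f a) <= #|homs (inc O) k X|.
  apply: (@fam_count T O X k q I P w (fun=> levels q) F f f) =>
    [a Pa|a i Pa|a i j Pa|a b K fab Pa Pb ab Fa Fb Ka _ cK agree].
  - have c4 : 4 <= #|levels q| by rewrite card_levels; arith.
    case: a Pa => [[x|p]|p] Pa /=; split => //; try (by arith).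
    + exact: sub0set.
    + by rewrite cards0.
    + by apply: at_levels_sub; rewrite !inE; have [_ + _] := P1g _ Pa; case: (val p.2).
    + exact: (card_at_levels q [:: val p.2; p.2.+1]).
    + exact: leq_trans c4.
    + apply: at_levels_sub; rewrite !inE; have [_ + _ _ _] := P2g _ Pa; case: (val p.2) => //.
      by case: (g0) g00.
    + exact: (card_at_levels q [:: val p.2; p.2.+1; g0; g0.+1]).
  - rewrite inE => i0; have [h _] := wLI a Pa; apply: h.
    by have := ltn_ord i; move: i0 => /=; arith.
  - rewrite !inE => i0 j0 ij; have [_ h] := wLI a Pa; apply: (walk_inc h) => //.
    by rewrite ij -ltnS ltn_ord.
  have agr (s : seq nat) j : at_levels q s \subset K -> j \in s -> j <= q -> w a j = w b j.
    move=> sK js jq; have := agree _ (at_levels_in sK js jq).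
    by rewrite inordK.
  case: a b fab Pa Pb ab Fa Fb agree agr =>
    [[x|p]|p] [[x'|p']|p'] // _ Pa Pb ab Fa Fb agree agr.
  - have /card_gt0P[i iK] : 0 < #|K| by rewrite cK.
    have i0 := subsetP Ka _ iK; rewrite inE in i0.
    have := agree i iK; rewrite /= => /st_inj h; case/eqP: ab; rewrite h //.
    by have := ltn_ord i; move: i0 => /=; arith.
  - have [xB gb _] := P1g _ Pb; have [b1 _] := w1P _ Pb.
    by apply: (strsep _ _ _ _ b1 xB Pa gb); apply/esym/(agr _ _ Fb); at_level.
  - have [xB gb _ _ _] := P2g _ Pb; have [b1 _ _] := w2P _ Pb.
    by apply: (strsep _ _ _ _ b1 xB Pa gb); apply/esym/(agr _ _ Fb); at_level.
  - have [xB gb _] := P1g _ Pa; have [b1 _] := w1P _ Pa.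
    have [xB' gb' _] := P1g _ Pb; have [b1' _] := w1P _ Pb.
    have [||||e1 e2] := brsep _ _ _ _ _ _ b1 b1' xB xB' gb gb'.
    + by apply: (agr _ _ Fa); at_level.
    + by apply: (agr _ _ Fa); at_level.
    + by apply: (agr _ _ Fb); at_level.
    + by apply: (agr _ _ Fb); at_level.
    by case/eqP: ab; case: (p) (p') e1 e2 => [? g] [? g'] /= -> /val_inj ->.
  - have [xB gb _] := P1g _ Pa; have [b1 _] := w1P _ Pa.
    have [xB' gb' _ gg pp] := P2g _ Pb; have [b1' h1 h2] := w2P _ Pb.
    have [||||e1 e2] := brsep _ _ _ _ _ _ b1 b1' xB xB' gb gb'.
    + by apply: (agr _ _ Fa); at_level.
    + by apply: (agr _ _ Fa); at_level.
    + by apply: (agr _ _ Fb); at_level.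
    + by apply: (agr _ _ Fb); at_level.
    have ep : p = (xa p'.1, p'.2) by case: (p) e1 e2 => [? g] /= -> /val_inj ->.
    by apply: h2; rewrite -ep; apply/esym/(agr _ _ Fb); at_level.
  - have [xB gb _ _ _] := P2g _ Pa; have [b1 _ _] := w2P _ Pa.
    have [xB' gb' _ _ _] := P2g _ Pb; have [b1' _ _] := w2P _ Pb.
    have [||||e1 e2] := brsep _ _ _ _ _ _ b1 b1' xB xB' gb gb'.
    + by apply: (agr _ _ Fa); at_level.
    + by apply: (agr _ _ Fa); at_level.
    + by apply: (agr _ _ Fb); at_level.
    + by apply: (agr _ _ Fb); at_level.
    have r1 := aR p.1; have r2 := aR p'.1.
    have ea : 3 * p.1 + 1 = 3 * p'.1 + 1 by apply: e_inj; [arith|arith|].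
    case/eqP: ab; case: (p) (p') ea e2 => [a g] [a' g'] /= ea /val_inj ->.
    by have -> : a = a' by apply/val_inj => /=; arith.
apply: leq_trans; rewrite card_levels !big_sumType /= !subn0.
rewrite sum_nat_const -/R; apply: leq_add; first apply: leq_add => //.
  rewrite big_geq_mkord; have -> : k.-1 = k.+1 - 2 by arith.
  apply: sum_pair_le => g /andP[gg g1].
  have inB : [set x in B | st g.+1 x \in exc g] \subset B by apply/subsetP => x; rewrite inE => /andP[].
  have le1 : #|[set x in B | st g.+1 x \in exc g]| <= #|exc g|.
    apply: (@card_into _ _ _ _ (st g.+1)) => [x y xS yS|x]; last by rewrite inE => /andP[].
    have := ltn_ord g => gq; apply: st_inj; rewrite ?(subsetP inB) //; arith.
  have -> : [set x | P1 (x, g)] = B :\: [set x in B | st g.+1 x \in exc g].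
    by apply/setP => x; rewrite in_setD 2!in_set /P1 /= gg g1; case: (x \in B); rewrite ?andbF ?andbT.
  by rewrite cardsD (setIidPr inB) -/R; arith.
rewrite big_geq_mkord; have -> : k - 3 = k.+1 - 4 by arith.
apply: sum_pair_le => g /andP[/andP[gg gg0] g1].
have gq := ltn_ord g; have g0g : g0 < g by rewrite ltn_neqAle eq_sym gg0 g0low.
pose E1 := [set a | st g.+1 (xa a) \in exc g].
pose E2 := [set a | P1 (xa a, g) & w1 (xa a, g) g0.+1 \in exc g0].
have xaB a : xa a \in B by apply: eB; have := aR a; arith.
have c1 : #|E1| <= #|exc g|.
  apply: (@card_into _ _ _ _ (fun a => st g.+1 (xa a))) => [a b _ _ eab|a]; last by rewrite inE.
  have r1 := aR a; have r2 := aR b.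
  have ea : 3 * a + 1 = 3 * b + 1.
    apply: e_inj; [arith|arith|].
    by apply: (st_inj g.+1 _ _ _ (xaB a) (xaB b) eab); arith.
  by apply/val_inj => /=; arith.
have c2 : #|E2| <= #|exc g0|.
  apply: (@card_into _ _ _ _ (fun a => w1 (xa a, g) g0.+1)) => [a b|a]; last by rewrite inE => /andP[].
  rewrite !inE => /andP[p1 _] /andP[p2 _] eab; have [_ s1] := w1P _ p1; have [_ s2] := w1P _ p2.
  have gb : 1 <= g0.+1 <= g by arith.
  have {}s1 := s1 a (aR a) erefl _ gb; have {}s2 := s2 b (aR b) erefl _ gb.
  rewrite eab in s1; apply/val_inj; apply: (strip_disj _ _ _ _ _ (aR a) (aR b) s1 s2); arith.
have : R %/ 3 <= #|[set a | P2 (a, g)]| + #|E1| + #|E2|.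
  rewrite -[X in X <= _]card_ord -cardsT.
  apply: leq_trans (leq_trans (leq_card_setU _ _) (leq_add (leq_card_setU _ _) (leqnn _))).
  apply: subset_leq_card; apply/subsetP => a _; rewrite 2!in_setU.
  have -> : (a \in E1) = (st g.+1 (xa a) \in exc g) by rewrite /E1 in_set.
  rewrite [a \in E2]in_set [a \in [set _ | _]]in_set /P2 /P1 /= xaB g1 gg gg0 /=.
  by case: (_ \in exc g); case: (_ \in exc g0).
arith.
Qed.

End Branches.

(** * Binomial estimates *)

Lemma sum_nat_two (f : nat -> nat) a b i j : a <= i < b -> a <= j < b -> i != j ->
  f i + f j <= \sum_(a <= t < b) f t.
Proof.
move=> ib jb ij; rewrite (bigD1_seq i) ?mem_index_iota ?iota_uniq //= leq_add2l.
rewrite big_mkcond (bigD1_seq j) ?mem_index_iota ?iota_uniq //= eq_sym ij; exact: leq_addr.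
Qed.

Lemma sum_nat_one (f : nat -> nat) a b i : a <= i < b -> f i <= \sum_(a <= t < b) f t.
Proof.
by move=> ib; rewrite (bigD1_seq i) ?mem_index_iota ?iota_uniq //= leq_addr.
Qed.

Lemma sum_nat_D1 (P : pred nat) (F : nat -> nat) a b i : a <= i < b -> P i ->
  \sum_(a <= t < b | P t) F t = F i + \sum_(a <= t < b | P t && (t != i)) F t.
Proof.
move=> ib Pi; rewrite big_mkcond (bigD1_seq i) ?mem_index_iota ?iota_uniq //= Pi.
congr (_ + _); rewrite big_mkcond [RHS]big_mkcond; apply: eq_bigr => j _.
by case: (P j); case: eqP.
Qed.

(** Everything is compared in units of U = 'C(k + s - 1, k).  With G good slots the
    missing strands and the target together cost about G * (k + s) * U, the walks
    branching once return G * k * U up to O(z ^ 2) * G * U, and the walks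
    branching twice return another (G - 1) * k * U / 6, which is decisive since k
    is large compared with z ^ 2. *)
Lemma gain_many k s r z G R D kap0 K U A B C0 C1 S1 S2 :
  r + D <= s * G -> k <= R + D + s * G -> 2 <= G -> G < 13 * z -> 0 < s <= z ->
  4000 * z ^ 2 <= k -> K <= G * (z + 2 * s + 1) + 2 * D -> kap0 <= z + 2 * s + 1 + 2 * D ->
  G * R <= S1 + K -> G.-1 * (R %/ 3) <= S2 + K + G.-1 * kap0 ->
  s * C0 = (k + s) * U -> C1 <= 2 * U -> k * U <= k * A + s * U -> A <= U ->
  U <= 2 * B -> 0 < U -> k * C1 + r * C0 < R * C1 + S1 * A + S2 * B.
Proof.
move=> rD kR G2 Gz sz zk hK hk0 hS1 hS2 eC0 hC1 hA AU UB U0.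
rewrite -mulnn in zk.
have sG : s * G <= z * G by rewrite leq_mul2r; lia.
have zG : z * G <= 13 * (z * z).
  have : z * G <= z * (13 * z) by rewrite leq_mul2l; lia.
  by lia.
have t1 : k * C1 <= R * C1 + 2 * (D + s * G) * U.
  have : k * C1 <= (R + (D + s * G)) * C1 by rewrite leq_mul2r; lia.
  have : (D + s * G) * C1 <= (D + s * G) * (2 * U) by rewrite leq_mul2l hC1 orbT.
  by rewrite mulnDl; lia.
have t2 : r * C0 <= G * (k + s) * U.
  have : s * (r * C0) <= s * (G * (k + s) * U).
    have -> : s * (r * C0) = r * (s * C0) by lia.
    rewrite eC0; have : r * ((k + s) * U) <= (s * G) * ((k + s) * U) by rewrite leq_mul2r; lia.
    lia.
  by rewrite leq_pmul2l; lia.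
have t3 : G * k * U <= S1 * A + (K + G * (D + s * G) + G * s) * U.
  have a1 : G * (k * U) <= G * (k * A + s * U) by rewrite leq_mul2l hA orbT.
  have a2 : k * A <= (R + (D + s * G)) * A by rewrite leq_mul2r; lia.
  have a3 : G * (k * A) <= G * ((R + (D + s * G)) * A) by rewrite leq_mul2l a2 orbT.
  have a4 : G * R * A <= (S1 + K) * A by rewrite leq_mul2r hS1 orbT.
  have a5 : (D + s * G) * A <= (D + s * G) * U by rewrite leq_mul2l AU orbT.
  have a6 : G * ((D + s * G) * A) <= G * ((D + s * G) * U) by rewrite leq_mul2l a5 orbT.
  have a7 : K * A <= K * U by rewrite leq_mul2l AU orbT.
  have e1 : G * ((R + (D + s * G)) * A) = G * R * A + G * ((D + s * G) * A) by lia.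
  have e2 : (S1 + K) * A = S1 * A + K * A by lia.
  have e3 : G * (k * A + s * U) = G * (k * A) + G * s * U by lia.
  lia.
have t4 : S2 * U <= 2 * (S2 * B) by rewrite mulnCA leq_mul2l UB orbT.
have coef : 2 * (2 * (D + s * G) + G * (k + s) + K + G * (D + s * G) + G * s) < 2 * (G * k) + S2.
  have b1 : G * (D + s * G) <= G * (26 * (z * z)) by rewrite leq_mul2l; lia.
  have b2 : G * s <= G * z by rewrite leq_mul2l; lia.
  have b3 : G * (z + 2 * s + 1) <= G * (4 * z) by rewrite leq_mul2l; lia.
  have b4 : z <= z * z by apply: leq_pmulr; lia.
  have b5 : G * z <= G * (z * z) by rewrite leq_mul2l b4 orbT.
  have b6 : kap0 <= 30 * (z * z) by lia.
  have hR : 3000 * (z * z) <= R by lia.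
  have b7 : 1000 * (z * z) <= R %/ 3 by rewrite leq_divRL //; lia.
  have b8 : G.-1 * (R %/ 3) >= G.-1 * (1000 * (z * z)) by rewrite leq_mul2l b7 orbT.
  have b9 : G.-1 * kap0 <= G.-1 * (30 * (z * z)) by rewrite leq_mul2l b6 orbT.
  have b10 : G * (z * z) <= 2 * (G.-1 * (z * z)) by rewrite [X in _ <= X]mulnA leq_mul2r; lia.
  have b11 : 0 < G * (z * z) by rewrite !muln_gt0; lia.
  have e1 : G.-1 * (1000 * (z * z)) = 1000 * (G.-1 * (z * z)) by lia.
  have e2 : G.-1 * (30 * (z * z)) = 30 * (G.-1 * (z * z)) by lia.
  have e3 : G * (26 * (z * z)) = 26 * (G * (z * z)) by lia.
  have e4 : G * (k + s) = G * k + G * s by lia.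
  have e5 : G * (4 * z) = 4 * (G * z) by lia.
  lia.
have : 2 * (2 * (D + s * G) + G * (k + s) + K + G * (D + s * G) + G * s) * U < (2 * (G * k) + S2) * U.
  by rewrite ltn_pmul2r.
have e1 : (2 * (G * k) + S2) * U = 2 * (G * k * U) + S2 * U by lia.
have e2 : 2 * (2 * (D + s * G) + G * (k + s) + K + G * (D + s * G) + G * s) * U =
  2 * (2 * (D + s * G) * U) + 2 * (G * (k + s) * U) + 2 * ((K + G * (D + s * G) + G * s) * U) by lia.
lia.
Qed.

(** With one good slot and r < s the target is smaller by a factor (s - 1) / s,
    and the walks branching once suffice. *)
Lemma gain_one k s r z R D kap U A C0 C1 S1 :
  r + D <= s -> k <= R + D + s -> r < s <= z ->
  4000 * z ^ 2 <= k -> kap <= z + 2 * s + 1 + 2 * D -> R <= S1 + kap ->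
  s * C0 = (k + s) * U -> C1 <= 2 * U -> k * U <= k * A + s * U -> A <= U ->
  0 < U -> k * C1 + r * C0 < R * C1 + S1 * A.
Proof.
move=> rD kR rs zk hk hS1 eC0 hC1 hA AU U0; rewrite -mulnn in zk.
have s0 : 0 < s by lia.
have t1 : k * C1 <= R * C1 + 2 * (D + s) * U.
  have : k * C1 <= (R + (D + s)) * C1 by rewrite leq_mul2r; lia.
  have : (D + s) * C1 <= (D + s) * (2 * U) by rewrite leq_mul2l hC1 orbT.
  by rewrite mulnDl; lia.
have t2 : s * (r * C0) <= s.-1 * (k + s) * U.
  have -> : s * (r * C0) = r * (s * C0) by lia.
  by rewrite eC0 mulnA leq_mul2r leq_mul2r; lia.
have t3 : k * U <= S1 * A + (kap + D + s + s) * U.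
  have a2 : k * A <= (S1 + (kap + D + s)) * A by rewrite leq_mul2r; lia.
  have a5 : (kap + D + s) * A <= (kap + D + s) * U by rewrite leq_mul2l AU orbT.
  have e1 : (S1 + (kap + D + s)) * A = S1 * A + (kap + D + s) * A by lia.
  have e2 : (kap + D + s + s) * U = (kap + D + s) * U + s * U by lia.
  lia.
have coef : s * (2 * (D + s) + kap + D + s + s) + s.-1 * (k + s) < s * k.
  have b4 : z <= z * z by apply: leq_pmulr; lia.
  have b1 : s * (2 * (D + s) + kap + D + s + s) <= z * (14 * z) by apply: leq_mul; lia.
  have b2 : s.-1 * s <= z * z by apply: leq_mul; lia.
  have e1 : s * k = s.-1 * k + k by rewrite -{1}(prednK s0) mulSn addnC.
  have e2 : s.-1 * (k + s) = s.-1 * k + s.-1 * s by lia.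
  have z0 : 0 < z * z by rewrite muln_gt0; lia.
  lia.
rewrite -(ltn_pmul2l s0).
have c2 : (s * (2 * (D + s) + kap + D + s + s) + s.-1 * (k + s)) * U < s * k * U by rewrite ltn_pmul2r.
have e1 : s * (k * C1 + r * C0) = s * (k * C1) + s * (r * C0) by lia.
have t1' : s * (k * C1) <= s * (R * C1 + 2 * (D + s) * U) by rewrite leq_mul2l t1 orbT.
have t3' : s * (k * U) <= s * (S1 * A + (kap + D + s + s) * U) by rewrite leq_mul2l t3 orbT.
have e2 : s * (R * C1 + 2 * (D + s) * U) = s * (R * C1) + s * (2 * (D + s)) * U by lia.
have e3 : s * (S1 * A + (kap + D + s + s) * U) = s * (S1 * A) + s * (kap + D + s + s) * U by lia.
have e4 : (s * (2 * (D + s) + kap + D + s + s) + s.-1 * (k + s)) * U =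
   s * (2 * (D + s)) * U + s * (kap + D + s + s) * U + s.-1 * (k + s) * U by lia.
have e5 : s * (R * C1 + S1 * A) = s * (R * C1) + s * (S1 * A) by lia.
lia.
Qed.

Section Binomials.
Variables (k s z : nat).
Hypothesis sz : 0 < s <= z.
Hypothesis zk : 4000 * z ^ 2 <= k.
Notation q := (k + s).

Lemma sk100 : 100 * s <= k.
Proof. by move: zk; rewrite -mulnn; nia. Qed.

Lemma bin_U0 : 0 < 'C(q.-1, k).
Proof. by rewrite bin_gt0; lia. Qed.

Lemma bin_C0 : s * 'C(q, k) = q * 'C(q.-1, k).
Proof. by rewrite mul_bin_down addKn. Qed.

Lemma bin_C1 : k.+1 * 'C(q, k.+1) = q * 'C(q.-1, k).
Proof. by rewrite mul_bin_diag. Qed.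

Lemma bin_C1_le : 'C(q, k.+1) <= 2 * 'C(q.-1, k).
Proof.
have h := sk100; rewrite -(@leq_pmul2l k.+1) // bin_C1 mulnA leq_mul2r.
by apply/orP; right; lia.
Qed.

Lemma bin_A : (q.-1) * 'C(q - 2, k.-1) = k * 'C(q.-1, k).
Proof.
have h := sk100; have k0 : 0 < k by lia.
by have := mul_bin_diag q.-1 k.-1; rewrite prednK // => <-; congr (_ * 'C(_, _)); lia.
Qed.

Lemma bin_A_le : 'C(q - 2, k.-1) <= 'C(q.-1, k).
Proof.
have h := sk100; have k0 : 0 < k by lia.
rewrite -(@leq_pmul2l q.-1); last lia.
by rewrite bin_A leq_mul2r; lia.
Qed.

Lemma bin_A_ge : k * 'C(q.-1, k) <= k * 'C(q - 2, k.-1) + s * 'C(q.-1, k).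
Proof.
have := bin_A_le; rewrite -bin_A; set a := 'C(q - 2, k.-1); set b := 'C(q.-1, k) => ab.
have e : q.-1 * a = k * a + s.-1 * a by rewrite -mulnDl; congr (_ * _); lia.
by rewrite e leq_add2l; apply: leq_mul => //; lia.
Qed.

Lemma bin_B_ge : 'C(q.-1, k) <= 2 * 'C(q - 4, k - 3).
Proof.
have h := sk100; have k0 : 100 <= k by lia.
have step n m : 0 < m -> 4 * n.+1 <= 5 * m -> 4 * 'C(n.+1, m) <= 5 * 'C(n, m.-1).
  move=> m0 nm; have := mul_bin_diag n.+1 m.-1; rewrite prednK //= => e.
  by rewrite -(leq_pmul2l m0) [X in X <= _]mulnCA -e mulnA [X in _ <= X]mulnCA
    [X in _ <= X]mulnA leq_mul2r nm orbT.
have s1 := step (q - 2) k ltac:(lia) ltac:(lia).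
have s2 := step (q - 3) k.-1 ltac:(lia) ltac:(lia).
have s3 := step (q - 4) k.-2 ltac:(lia) ltac:(lia).
move: s1 s2 s3.
have -> : (q - 2).+1 = q.-1 by lia.
have -> : (q - 3).+1 = q - 2 by lia.
have -> : (q - 4).+1 = q - 3 by lia.
have -> : k.-2.-1 = k - 3 by lia.
lia.
Qed.

End Binomials.

(** * Few good slots *)

Section FewGood.
Variables (T : finType) (O : biorder T) (X : {set T}) (k s z r : nat).
Implicit Types (S B C N : {set T}) (x y u v : T).
Notation q := (k + s).
Notation lev := (lev O X).
Notation good := (good O X k).
Notation gcount := (good_count O X k).
Notation defect := (shortage O X k).
Notation exc := (exc O X).

Hypothesis inc_le : forall S, S \subset X -> mono (inc O) S -> #|S| <= q.
Hypothesis dec_le : forall S, S \subset X -> mono (dec O) S -> #|S| <= q.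
Hypothesis zk : 4000 * z ^ 2 <= k.
Hypothesis sz : 0 < s <= z.
Hypothesis few_dec : #|homs (dec O) k X| < 2 ^ z.
Hypothesis cX : #|X| = k * q + r.
Hypothesis r1 : 0 < r.

Let zkS : z <= k.+1.
Proof. by move: zk; rewrite -mulnn; nia. Qed.

Let zzk : 4000 * z <= k.
Proof. by move: zk; rewrite -mulnn; nia. Qed.

(** Some level p is not long.  Long levels below p are charged to the slot
    above them, those above p to the slot below them. *)
Lemma nlong_le_gcount : gcount q < 13 * z -> nlong O X k s <= gcount q.
Proof.
move=> Gz; have nl := nlong_le O X k s.
have [p /andP[p0 pq] pl] : exists2 p, 0 < p <= q & #|lev p| <= k.
  have [/hasP[p]|/hasPn no] := boolP (has (fun p => #|lev p| <= k) (iota 1 q)).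
    by rewrite mem_iota add1n ltnS => pb pl; exists p.
  suff : q <= nlong O X k s by lia.
  have -> : q = \sum_(1 <= j < q.+1) 1 by rewrite sum_nat_const_nat; lia.
  rewrite /nlong big_nat_cond [X in _ <= X]big_nat_cond; apply: leq_sum => j /andP[jb _].
  by have := no j; rewrite mem_iota add1n jb => /(_ isT); rewrite -ltnNge => ->.
rewrite /nlong /good_count (@big_cat_nat _ _ _ p) ?ltnS //=; last by apply: ltnW.
rewrite [X in _ + X]big_ltn // ltnNge pl add0n.
rewrite [X in _ <= X](@big_cat_nat _ _ _ p) //=; apply: leq_add.
  by apply: leq_sum => j _; have [/(long_good)->|] := ltnP k _.
rewrite big_add1 /=; apply: leq_sum => j _.
by have [/(long_good')->|] := ltnP k _.
Qed.

(** By [defect_sum] the remainder r is at most s times the number of good slots.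
    If the increasing chains do not exceed the target, then there is one good
    slot and r = s, which leaves no room for a short level; the unique long level
    belongs to only one slot, so it is the first or the last one. *)
Lemma few_good : gcount q < 13 * z ->
  k * 'C(q, k.+1) + r * 'C(q, k) < #|homs (inc O) k X| \/
  (r = s /\ (exists l, [/\ (l == 1) || (l == q), #|lev l| = q,
      forall j, 0 < j <= q -> j != l -> #|lev j| = k &
      forall j, 0 < j < q -> good j -> (j == l) || (j.+1 == l)])).
Proof.
move=> Gz; have nl := nlong_le_gcount Gz; set G := gcount q in Gz nl *.
have dsum := defect_sum inc_le dec_le; rewrite cX in dsum.
set D := \sum_(_ <= _ < _) _ in dsum.
have rD : r + D <= s * G.
  have : s * nlong O X k s <= s * G by rewrite leq_mul2l nl orbT.
  by move: dsum; lia.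
have G1 : 0 < G by rewrite lt0n; apply/negP => /eqP e; rewrite e muln0 in rD; lia.
have [g0 [/andP[g00 g0q] gg0 cg0]] := gcount_hit G1.
have g0low g : 0 < g -> good g -> g0 <= g.
  move=> gp gg; rewrite leqNgt; apply/negP => lt.
  have := gcount_mono O X k lt; rewrite cg0 leqn0 /good_count big_nat_recr //= gg.
  by rewrite addn1.
have k3 : 3 <= k by lia.
have kq : k < q by lia.
have [R [hR main]] := branch_count dec_le kq k3 g00 g0low.
have D'D : \sum_(1 <= j < q) defect j + defect q = D.
  by rewrite /D big_nat_recr //=; lia.
have hcap : \sum_(1 <= j < q) (cap O X k q j - #|lev j|) <= \sum_(1 <= j < q) defect j + s * G.
  rewrite /G /good_count big_distrr -big_split /=; apply: leq_sum => j _.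
  by rewrite /cap /shortage; case: (good j); lia.
have dq : k <= #|lev q| + defect q by rewrite /shortage; lia.
have kR : k <= R + D + s * G by arith.
have hexc j : good j -> #|exc j| <= z + 2 * s + 1 + 2 * defect j.
  by move=> gj; have := exc_bound dec_le gj zkS few_dec; rewrite /shortage; lia.
have U0 : 0 < 'C(q.-1, k) by apply: (@bin_U0 k s z).
have eC0 := bin_C0 k s.
have C1 := bin_C1_le sz zk.
have AU := bin_A_le sz zk.
have hA := bin_A_ge sz zk.
have hB := bin_B_ge sz zk.
have defD j : 0 < j <= q -> defect j <= D.
  move=> jb; apply: (@sum_nat_one defect 1 q.+1); lia.
have Geq : G = \sum_(1 <= g < q | good g) 1.
  by rewrite /G /good_count [RHS]big_mkcond /=; apply: eq_bigr => j _; case: (good j).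
have [G2|G2] := ltnP 1 G.
  left; apply: leq_trans main; rewrite -!big_distrl /=.
  pose K := \sum_(1 <= g < q | good g) #|exc g|.
  apply: (@gain_many k s r z G R D #|exc g0| K 'C(q.-1, k)) => //.
  - apply: leq_trans (_ : \sum_(1 <= g < q | good g) (z + 2 * s + 1 + 2 * defect g) <= _).
      by rewrite /K; apply: leq_sum => j /hexc.
    rewrite big_split /= -[X in _ + X <= _]big_distrr /=; apply: leq_add.
      by rewrite Geq big_distrl /=; apply: leq_sum => j _; rewrite mul1n.
    rewrite leq_mul2l /= -D'D; apply: leq_trans (leq_addr _ _).
    by rewrite [X in _ <= X](bigID good) leq_addr.
  - apply: leq_trans (hexc _ gg0) _; rewrite leq_add2l leq_mul2l /=; apply: defD; lia.
  - by rewrite /K -big_split /= Geq big_distrl /=; apply: leq_sum => j _; rewrite mul1n; lia.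
  - have -> : G.-1 = \sum_(1 <= g < q | good g && (g != g0)) 1.
      by rewrite Geq (@sum_nat_D1 good _ 1 q g0) ?g00 ?add1n.
    rewrite !big_distrl /=.
    apply: leq_trans (_ : \sum_(1 <= g < q | good g && (g != g0))
      ((R %/ 3 - #|exc g| - #|exc g0|) + #|exc g| + 1 * #|exc g0|) <= _).
      by apply: leq_sum => j _; lia.
    rewrite !big_split /=.
    by rewrite leq_add2r leq_add2l /K [X in _ <= X](bigID (fun g => g != g0)) leq_addr.
have {G1 G2 Gz} eG : G = 1 by lia.
rewrite eG muln1 in rD kR.
have gone j : 0 < j < q -> good j -> j = g0.
  move=> jb gj; apply/eqP/negPn/negP => ne.
  have := @sum_nat_two good 1 q j g0 jb; rewrite g00 g0q gj gg0 => /(_ isT ne).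
  by rewrite -/(gcount q) -/G eG.
have [rs|rs] := ltnP r s.
  left; apply: leq_trans main; apply: leq_trans (leq_addr _ _).
  rewrite (@sum_nat_D1 good _ 1 q g0) ?g00 //.
  apply: leq_trans (_ : R * 'C(q, k.+1) + (R - #|exc g0|) * 'C(q - 2, k.-1) <= _); last first.
    by rewrite leq_add2l leq_addr.
  apply: (@gain_one k s r z R D #|exc g0| 'C(q.-1, k)) => //.
  - by case/andP: sz => _ ->; rewrite rs.
  - apply: leq_trans (hexc _ gg0) _; rewrite leq_add2l leq_mul2l /=; apply: defD; lia.
  - by lia.
right; have {rD rs kR} [ers D0] : r = s /\ D = 0 by lia.
split => //; have d0 j : 0 < j <= q -> k <= #|lev j|.
  by move=> /defD; rewrite D0 /shortage; lia.
have sumX : \sum_(1 <= j < q.+1) #|lev j| = k * q + s.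
  by rewrite -(@card_lev_sum _ O X q) ?cX ?ers // => v; apply: hgt_le.
have [l lb ll] : exists2 l, 0 < l <= q & k < #|lev l|.
  have [/hasP[p]|/hasPn no] := boolP (has (fun p => k < #|lev p|) (iota 1 q)).
    by rewrite mem_iota add1n ltnS => pb pl; exists p.
  have : \sum_(1 <= j < q.+1) #|lev j| <= \sum_(1 <= j < q.+1) k.
    rewrite big_nat_cond [X in _ <= X]big_nat_cond; apply: leq_sum => j /andP[jb _].
    by have := no j; rewrite mem_iota add1n jb => /(_ isT); rewrite -leqNgt.
  by rewrite sumX sum_nat_const_nat; lia.
have others j : 0 < j <= q -> j != l -> #|lev j| = k.
  move=> jb jl; apply/eqP; rewrite eqn_leq d0 // andbT leqNgt; apply/negP => jlong.
  have := @sum_nat_two (fun j => k < #|lev j|) 1 q.+1 j l; rewrite jb lb jlong ll.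
  by move=> /(_ isT isT jl); rewrite -/(nlong O X k s); lia.
have sumX' : #|lev l| + k * q.-1 = k * q + s.
  rewrite -sumX (bigD1_seq l) ?mem_index_iota ?iota_uniq //=; congr (_ + _).
  have : \sum_(1 <= j < q.+1) k = k * q by rewrite sum_nat_const_nat mulnC; lia.
  rewrite (bigD1_seq l) ?mem_index_iota ?iota_uniq //=.
  rewrite big_nat_cond [in X in _ -> _ = X]big_nat_cond.
  rewrite [in X in _ -> _ = X](eq_bigr (fun=> k)); last by move=> j /andP[jb jl]; apply: others.
  by have e : k * q = k + k * q.-1 by [rewrite -mulnS; congr (_ * _); lia]; lia.
have q1 : k * q = k + k * q.-1 by rewrite -mulnS; congr (_ * _); lia.
exists l; split => //; last 1 first.
- move=> j jb gj; rewrite (gone j jb gj); have [lq|ql] := ltnP l q.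
    by rewrite (gone l) ?eqxx ?long_good //; lia.
  have el : l = q by lia.
  rewrite -(gone q.-1) ?orbT //; last by apply: long_good'; rewrite prednK ?el in ll *; lia.
    by rewrite prednK ?el ?eqxx ?orbT //; lia.
  lia.
- apply/negPn/negP; rewrite negb_or => /andP[l1 lq].
  have b1 : 0 < l < q by lia.
  have b2 : 0 < l.-1 < q by lia.
  have e1 := gone l b1 (long_good ll).
  have := gone l.-1 b2; rewrite -e1 => /(_ _) h.
  have : l.-1 = l by apply: h; apply: long_good'; rewrite prednK //; lia.
  lia.
- by lia.
Qed.

End FewGood.

(** * One long level: increasing chains *)

Section Wall.
Variables (T : finType) (O : biorder T) (X : {set T}) (k q : nat).
Implicit Types (S B C N : {set T}) (x y u v : T).
Notation lev := (lev O X).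
Notation dn := (lower O X).

Variables (B : {set T}) (st : nat -> T -> T).
Hypothesis k3 : 3 <= k.
Hypothesis kq : k < q.
Hypothesis stL : forall j x, 2 <= j <= q -> x \in B -> st j x \in lev j.
Hypothesis stI : forall j x, 2 <= j < q -> x \in B -> inc O (st j x) (st j.+1 x).
Hypothesis st_inj : forall j, 2 <= j <= q -> {in B &, injective (st j)}.

(** The levels from 2 on are joined by full strands.  Chains are counted in
    three families: those avoiding level 1, those using an edge between levels 1
    and 2 and otherwise following a strand, and those that leave their strand
    between levels 3 and 2. *)
Lemma wall_count :
  #|B| * 'C(q.-1, k.+1) + (\sum_(x in B) #|dn 1 (st 2 x)|) * 'C(q.-1, k) +
  #|[set x in B | 1 < #|dn 2 (st 3 x)|]| * 'C(q - 2, k.-1) <= #|homs (inc O) k X|.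
Proof.
have [B0|] := posnP #|B|.
  rewrite (cards0_eq B0) cards0 big_set0 mul0n mul0n !add0n.
  by rewrite (_ : [set x in _ | _] = set0) ?cards0 //; apply/setP => x; rewrite !inE.
move=> /card_gt0P[x0 x0B].
pose third x := (x \in B) && (1 < #|dn 2 (st 3 x)|).
have br x : exists w : nat -> T, third x ->
    [/\ forall j, 2 < j -> w j = st j x, w 2 <> st 2 x,
        forall j, 1 <= j <= q -> w j \in lev j &
        forall j, 1 <= j < q -> inc O (w j) (w j.+1)].
  case: (boolP (third x)) => [/andP[xB d2]|_]; last by exists (fun=> x0).
  have /card_gt0P[u] : 0 < #|dn 2 (st 3 x) :\ st 2 x|.
    by have := cardsD1 (st 2 x) (dn 2 (st 3 x)); case: (_ \in _) => /=; arith.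
  rewrite in_setD1 => /andP[/eqP une uN]; have [uL ui] := dnP _ _ _ _ _ uN.
  have [w [wu wL wI]] := walk_down_exists uL isT.
  exists (fun j => if j <= 2 then w j else st j x) => _; split.
  - by move=> j jb; rewrite leqNgt jb.
  - by rewrite leqnn wu.
  - by move=> j jb; case: leqP => jg; [apply: wL; arith|apply: stL => //; arith].
  - move=> j jb; case: (ltngtP j 2) => jg.
    + by apply: wI; arith.
    + by apply: stI => //; arith.
    + by rewrite jg wu.
have {br}[w3 w3P] := fin_all_exists br.
pose I := ((T + T * T) + T)%type.
pose P (a : I) := match a with inl (inl x) => x \in B
  | inl (inr p) => (p.2 \in B) && (p.1 \in dn 1 (st 2 p.2)) | inr x => third x end.
pose w (a : I) := match a with inl (inl x) => st^~ x
  | inl (inr p) => fun j => if j == 1 then p.1 else st j p.2 | inr x => w3 x end.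
pose F (a : I) : {set 'I_q.+1} := match a with inl (inl x) => set0
  | inl (inr p) => at_levels q [:: 1] | inr p => at_levels q [:: 2; 3] end.
pose A (a : I) : {set 'I_q.+1} := match a with inl (inl x) => [set i in levels q | val i != 1]
  | _ => levels q end.
pose f (a : I) := match a with inl (inl x) => 0 | inl (inr p) => 1 | inr p => 2 end.
have cA x : #|A (inl (inl x))| = q.-1.
  have q1 : 1 < q.+1 by arith.
  have -> : A (inl (inl x)) = levels q :\ Ordinal q1.
    by apply/setP => i; rewrite !inE -val_eqE /= andbC.
  have e := cardsD1 (Ordinal q1) (levels q); rewrite card_levels inE /= add1n in e.
  by rewrite [in RHS]e.
have edge a x j : 1 <= j <= q -> x \in B -> a \in dn 1 (st 2 x) ->
    (if j == 1 then a else st j x) \in lev j.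
  move=> jb xB /dnP[aL _]; case: eqP => [->//|ne]; apply: stL => //; arith.
have edgeI a x j : 1 <= j < q -> x \in B -> a \in dn 1 (st 2 x) ->
    inc O (if j == 1 then a else st j x) (st j.+1 x).
  move=> jb xB /dnP[_ ai]; case: eqP => [->//|ne]; apply: stI => //; arith.
have : \sum_(a | P a) 'C(#|A a| - f a, k.+1 - f a) <= #|homs (inc O) k X|.
  apply: (@fam_count T O X k q I P w A F f f) =>
    [a Pa|a i Pa|a i j Pa|a b K fab Pa Pb ab Fa Fb Ka Kb cK agree].
  - have c2 : 2 <= #|levels q| by rewrite card_levels; arith.
    case: a Pa => [[x|p]|p] Pa; rewrite /F /f; split; try done; try (by arith).
    + exact: sub0set.
    + by rewrite cards0.
    + exact: at_levels_sub.
    + exact: (card_at_levels q [:: 1]).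
    + exact: ltnW c2.
    + exact: at_levels_sub.
    + exact: (card_at_levels q [:: 2; 3]).
  - have := ltn_ord i; rewrite ltnS => iq.
    case: a Pa => [[x|p]|p] Pa iA; rewrite /A !inE in iA; rewrite /w.
    + by case/andP: iA => i0 i1; apply: stL => //; move: i0 i1 => /=; lia.
    + by case/andP: Pa => xB aN; apply: edge => //; rewrite iq andbT.
    + by have [_ _ h _] := w3P p Pa; apply: h; rewrite iq andbT.
  - have := ltn_ord i; have := ltn_ord j; rewrite !ltnS => jq iq.
    case: a Pa => [[x|p]|p] Pa iA jA ij; rewrite /A !inE in iA jA; rewrite /w.
    + case/andP: iA => i0 i1; apply: (@walk_inc _ O 2 q (st^~ x)); [|by move: i0 i1 => /=; lia|by rewrite ij].
      by move=> t tb; apply: stI.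
    + case/andP: Pa => xB aN.
      apply: (@walk_inc _ O 1 q (fun j => if j == 1 then p.1 else st j p.2)); [|by []|by rewrite ij].
      move=> t tb; have -> : (t.+1 == 1) = false by case: t tb.
      exact: edgeI.
    + have [_ _ _ h] := w3P p Pa; apply: (walk_inc h) => //.
      by rewrite ij.
  have agr (s : seq nat) j : at_levels q s \subset K -> j \in s -> j <= q -> w a j = w b j.
    move=> sK js jq; have := agree _ (at_levels_in sK js jq).
    by rewrite inordK.
  have K2 : exists2 i : 'I_q.+1, i \in K & 2 <= i <= q.
    have q1 : 1 < q.+1 by arith.
    have /card_gt0P[i] : 0 < #|K :\ Ordinal q1|.
      have e := cardsD1 (Ordinal q1) K; rewrite cK in e.
      move: e; case: (Ordinal q1 \in K); rewrite ?add1n ?add0n => e; last by rewrite -e.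
      by case: e => <-; apply: leq_trans k3.
    rewrite in_setD1 -val_eqE /= => /andP[i1 iK]; exists i => //.
    have : i \in levels q.
      move: Ka; case: (a) => [[x|p]|p] /subsetP/(_ i iK) //.
      by rewrite inE => /andP[].
    by rewrite inE /= => i0; have := ltn_ord i; move: i1 i0; clear; lia.
  have no1 x (s : seq nat) : at_levels q s \subset K -> 1 \in s -> K \subset A (inl (inl x)) -> False.
    move=> sK s1 /subsetP KA; have := KA _ (at_levels_in sK s1 (leq_trans (ltnW (ltnW k3)) (ltnW kq))).
    by rewrite !inE /= inordK ?andbF //; arith.
  have q3 : 3 <= q by arith.
  have b2 : 2 <= 2 <= q by arith.
  have b3 : 2 <= 3 <= q by arith.
  have [i iK ib] := K2; have ag_i := agree i iK.
  have i1 : (val i == 1) = false by apply/negbTE; move: ib => /=; case: (nat_of_ord i) => [|[]].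
  move: fab Pa Pb ab Fa Fb Ka Kb agree agr ag_i.
  case: a b => [[x|p]|x] [[x'|p']|x'] // _ Pa Pb ab Fa Fb Ka Kb agree agr ag_i.
  - by case/eqP: ab; rewrite (st_inj ib Pa Pb ag_i).
  - exact: (no1 x _ Fb).
  - have [h1 h2 _ _] := w3P _ Pb; have /andP[xB' _] := Pb.
    have := agr _ 3 Fb isT q3; rewrite /w h1 // => /(st_inj b3 Pa xB') e.
    by have := agr _ 2 Fb isT (ltnW q3); rewrite /w e => e2; apply: h2.
  - case/eqP: ab; case/andP: Pa => xB aN; case/andP: Pb => xB' aN'.
    have e1 := agr _ 1 Fa isT (ltnW (ltnW q3)).
    move: ag_i e1; rewrite /w /= in i1 *; rewrite i1 => /(st_inj ib xB xB') e2 e1.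
    by case: p p' e1 e2 {Fa Fb Ka Kb agree agr xB aN xB' aN'} => ? ? [? ?] /= -> ->.
  - have [h1 h2 _ _] := w3P _ Pb; have /andP[xB' _] := Pb; case/andP: Pa => xB aN.
    have := agr _ 3 Fb isT q3; rewrite /w /= h1 // => /(st_inj b3 xB xB') e.
    by have := agr _ 2 Fb isT (ltnW q3); rewrite /w /= e => e2; apply: h2.
  - have [h1 _ _ _] := w3P _ Pa; have /andP[xB _] := Pa.
    have [h1' _ _ _] := w3P _ Pb; have /andP[xB' _] := Pb.
    have := agr _ 3 Fa isT q3; rewrite /w h1 // h1' // => /(st_inj b3 xB xB') e.
    by case/eqP: ab; rewrite e.
apply: leq_trans; rewrite !big_sumType /=; apply: leq_add; first apply: leq_add.
- rewrite (eq_bigr (fun=> 'C(q.-1, k.+1))); last by move=> x _; rewrite -(cA x) ?subn0 ?cA.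
  by rewrite sum_nat_const.
- rewrite card_levels big_distrl /= subn1 subSS subn0.
  rewrite (eq_bigl (fun p : T * T => (p.2 \in B) && (p.1 \in dn 1 (st 2 p.2)))) //.
  have -> : \sum_(p : T * T | (p.2 \in B) && (p.1 \in dn 1 (st 2 p.2))) 'C(q.-1, k)
     = \sum_(x in B) \sum_(a in dn 1 (st 2 x)) 'C(q.-1, k).
    rewrite pair_big_dep /= (reindex (fun p : T * T => (p.2, p.1))) //=.
    by exists (fun p : T * T => (p.2, p.1)) => -[].
  by apply: leq_sum => x _; rewrite sum_nat_const.
- rewrite card_levels; have -> : k.+1 - 2 = k.-1 by arith.
  by rewrite -sum_nat_const; apply: eq_leq; apply: eq_bigl => x; rewrite in_set.
Qed.

End Wall.

(** * One long level: decreasing chains *)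

Section Leaders.
Variable cut : pred nat.

(** First index of the run of consecutive indices containing i, where cut i
    separates i from i + 1. *)
Fixpoint leader i := if i is i'.+1 then if cut i' then i else leader i' else 0.

Lemma leader_le i : leader i <= i.
Proof. by elim: i => //= i IH; case: (cut i) => //; apply: leqW. Qed.

Lemma leader_mono i j : i <= j -> leader i <= leader j.
Proof.
elim: j => [|j IH]; first by rewrite leqn0 => /eqP->.
rewrite leq_eqVlt => /orP[/eqP->//|]; rewrite ltnS => ij /=.
by case: (cut j); [apply: leq_trans (leader_le i) _; apply: leqW | apply: IH].
Qed.

Lemma leader_cut i j : i <= j -> leader i != leader j -> exists2 t, i <= t < j & cut t.
Proof.
elim: j => [|j IH]; first by rewrite leqn0 => /eqP->; rewrite eqxx.
rewrite leq_eqVlt => /orP[/eqP->|]; first by rewrite eqxx.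
rewrite ltnS => ij /=; case: ifP => [cj _|cj ne]; first by exists j; rewrite ?ij /=.
have [t tb ct] := IH ij ne.
by exists t => //; lia.
Qed.

End Leaders.

Section Blocks.
Variables (T : finType) (O : biorder T) (A1 : {set T}) (k : nat) (sq : nat -> T).
Implicit Types (a u v : T) (K : {set 'I_k}).
Hypothesis mA : mono (dec O) A1.
Hypothesis sdec : forall i j, i < j < k -> dec O (sq i) (sq j).
Hypothesis slotA : forall u i, u \in A1 -> i < k -> (u != sq i) && ~~ inc O (sq i) u.

Definition nbr i : {set T} := [set u in A1 | inc O u (sq i)].
(** Consecutive elements of level 2 belong to the same block when they share a
    neighbour. *)
Definition lead := leader (fun i => [disjoint nbr i & nbr i.+1]).
Definition block l : {set 'I_k} := [set i : 'I_k | lead i == l].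
Definition nbrs K : {set T} := \bigcup_(i in K) nbr i.

Lemma nbrP i a : reflect (a \in A1 /\ inc O a (sq i)) (a \in nbr i).
Proof. by rewrite [X in reflect _ X]in_set; apply: andP. Qed.

Lemma slot_cmp a i : a \in A1 -> i < k -> ~~ inc O a (sq i) -> dec O a (sq i) || dec O (sq i) a.
Proof.
move=> aA ik /negbTE na; have /andP[/(bi_total O)+ /negbTE nb] := slotA aA ik.
by rewrite na nb.
Qed.

(** If a were left of sq i it would be left of sq j as well. *)
Lemma side_left a i j : i < j < k -> a \in nbr j -> a \notin nbr i -> dec O (sq i) a.
Proof.
move=> ij /nbrP[aA aj] ni; have na : ~~ inc O a (sq i) by move: ni; rewrite inE aA.
have /orP[|//] := slot_cmp aA (ltn_trans (proj1 (andP ij)) (proj2 (andP ij))) na.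
by move=> ai; have := inc_ndec aj; rewrite (dec_trans ai (sdec ij)).
Qed.

Lemma side_right a i j : i < j < k -> a \in nbr i -> a \notin nbr j -> dec O a (sq j).
Proof.
move=> ij /nbrP[aA ai] nj; have na : ~~ inc O a (sq j) by move: nj; rewrite inE aA.
have /orP[//|] := slot_cmp aA (proj2 (andP ij)) na.
by move=> ja; have := inc_ndec' ai; rewrite (dec_trans (sdec ij) ja).
Qed.

Lemma nbr_convex a i t j : i <= t <= j -> j < k -> a \in nbr i -> a \in nbr j -> a \in nbr t.
Proof.
move=> itj jk ai aj; have [<-//|it] := eqVneq i t; have [->//|tj] := eqVneq t j.
apply/negPn/negP => nt; have itk : i < t < k by lia.
have tjk : t < j < k by lia.
have h1 := side_right itk ai nt; have h2 := side_left tjk aj nt.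
by have := dec_trans h1 h2; rewrite dec_irr.
Qed.

Lemma lead_mono i j : i <= j -> lead i <= lead j.
Proof. exact: leader_mono. Qed.

(** By convexity a common neighbour would be shared by all elements in between,
    in particular across a cut. *)
Lemma nbr_disj a i j : i < j < k -> lead i != lead j -> a \in nbr i -> a \notin nbr j.
Proof.
move=> ij lij ai; apply/negP => aj.
have [|t tb] := @leader_cut _ i j _ lij; first by lia.
rewrite disjoints_subset => /subsetP/(_ a); rewrite in_setC => h.
have : a \in nbr t by apply: (@nbr_convex a i t j) => //; lia.
by move/h/negP; apply; apply: (@nbr_convex a i t.+1 j) => //; lia.
Qed.

(** Adding the elements of level 2 one by one, each element that is not a leader
    shares a neighbour with its predecessor and so covers one new element less
    than its degree. *)
Lemma cover_count :
  #|nbrs setT| + k <= \sum_(i < k) #|nbr i| + \sum_(i < k) (lead i == i).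
Proof.
have -> : nbrs setT = \bigcup_(i < k) nbr i by apply: eq_bigl => i; rewrite inE.
suff aux (b : nat -> nat) : (forall m, 1 <= #|(\bigcup_(i < m) nbr i) :&: nbr m| + b m) ->
    forall m, #|\bigcup_(i < m) nbr i| + m <= \sum_(i < m) #|nbr i| + \sum_(i < m) b i.
  apply: (aux (fun i => lead i == i)) => m.
  case: m => [|m]; first by rewrite addn1.
  rewrite /lead /=; case: ifPn => [_|]; first by rewrite eqxx addn1.
  rewrite -setI_eq0 => /set0Pn[a]; rewrite in_setI => /andP[am am1].
  rewrite addn_gt0; apply/orP; left; apply/card_gt0P; exists a; rewrite in_setI am1 andbT.
  by rewrite big_ord_recr /= in_setU am orbT.
move=> hb; pose W m := \bigcup_(i < m) nbr i.
have WS m : W m.+1 = W m :|: nbr m by rewrite /W big_ord_recr.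
suff : forall m, #|W m| + m <= \sum_(i < m) #|nbr i| + \sum_(i < m) b i by [].
elim=> [|m]; first by rewrite /W !big_ord0 cards0.
have := hb m; have := cardsUI (W m) (nbr m).
rewrite WS !big_ord_recr /= -/(W m); clear; move: (W m) => V.
move: #|V :|: nbr m| #|V :&: nbr m| #|V| #|nbr m| => c1 c2 c3 c4.
by move: (\sum_(i < m) _) (\sum_(i < m) _) (b m) => c5 c6 c7 *; lia.
Qed.

Lemma sq_inj i j : i < k -> j < k -> sq i = sq j -> i = j.
Proof.
move=> ik jk e; case: (ltngtP i j) => // lt.
  by have := @sdec i j; rewrite lt jk e dec_irr => /(_ isT).
by have := @sdec j i; rewrite lt ik e dec_irr => /(_ isT).
Qed.

Definition swap K : {set T} := (A1 :\: nbrs K) :|: [set sq i | i : 'I_k in K].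

Lemma sqA i : i < k -> sq i \notin A1.
Proof. by move=> ik; apply/negP => /slotA/(_ ik); rewrite eqxx. Qed.

Lemma nbrs_sub K : nbrs K \subset A1.
Proof. by apply/bigcupsP => i _; apply/subsetP => a /nbrP[]. Qed.

Lemma card_swap K : #|swap K| = #|A1| - #|nbrs K| + #|K|.
Proof.
rewrite cardsU_disj => [|x]; last first.
  by rewrite in_setD => /andP[_ xA] /imsetP[i _ e]; have := sqA (ltn_ord i); rewrite -e xA.
rewrite cardsD (setIidPr (nbrs_sub K)).
by rewrite card_in_imset // => i j _ _ /sq_inj e; apply/val_inj/e.
Qed.

(** Elements of A1 without neighbour in K are comparable with K in the
    left-to-right order. *)
Lemma swap_mono K : mono (dec O) (swap K).
Proof.
have sS (i j : 'I_k) : sq i != sq j -> dec O (sq i) (sq j) || dec O (sq j) (sq i).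
  move=> ne; case: (ltngtP i j) => lt.
  - by rewrite sdec ?lt ?ltn_ord.
  - by rewrite orbC sdec ?lt ?ltn_ord.
  - by rewrite lt eqxx in ne.
have aS a (i : 'I_k) : a \in A1 :\: nbrs K -> i \in K -> dec O a (sq i) || dec O (sq i) a.
  rewrite in_setD => /andP[aN aA] iK; apply: slot_cmp => //; apply/negP => ai.
  by case/negP: aN; apply/bigcupP; exists i => //; apply/nbrP.
apply/monoP => x y; rewrite !in_setU => /orP[xA|/imsetP[i iK ->]] /orP[yA|/imsetP[j jK ->]].
- by move: xA yA; rewrite !in_setD => /andP[_ xA] /andP[_ yA]; apply: (monoP _ _ mA).
- by move=> _; apply: aS.
- by move=> _; rewrite orbC; apply: aS.
- exact: sS.
Qed.

Section Anti.
Variables (X : {set T}) (q : nat).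
Hypothesis AX : A1 \subset X.
Hypothesis sX : forall i, i < k -> sq i \in X.
Hypothesis cA : #|A1| = q.
Hypothesis dec_le : forall S : {set T}, S \subset X -> mono (dec O) S -> #|S| <= q.

Lemma swap_sub K : swap K \subset X.
Proof.
apply/subsetP => x; rewrite in_setU => /orP[|/imsetP[i _ ->]]; last exact: sX.
by rewrite in_setD => /andP[_]; apply: (subsetP AX).
Qed.

(** Otherwise [swap] would be an antichain with more than q elements. *)
Lemma block_expands K : #|K| <= #|nbrs K|.
Proof.
have := dec_le (swap_sub K) (swap_mono K); rewrite card_swap.
by have := subset_leq_card (nbrs_sub K); rewrite cA; lia.
Qed.

Definition tight : {set 'I_k} :=
  [set l : 'I_k | (lead l == l) && (#|nbrs (block l)| == #|block l|)].

(** For a tight block, [swap] is again an antichain with q elements.  Its subsets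
    containing the leader of the block are counted; the leader identifies the
    block. *)
Lemma dec_count : 'C(q, k.+1) + #|tight| * 'C(q.-1, k) <= #|homs (dec O) k X|.
Proof.
pose f (o : unit + 'I_k) : {set {set T}} := match o with
  | inl _ => [set S : {set T} | [&& set0 \subset S, S \subset A1 & #|S| == k.+1]]
  | inr l => [set S : {set T} | [&& [set sq l] \subset S, S \subset swap (block l) & #|S| == k.+1]]
  end.
pose P (o : unit + 'I_k) := if o is inr l then l \in tight else true.
have lb (l : 'I_k) : l \in tight -> l \in block l by rewrite !inE => /andP[].
have := @sum_card_disjoint _ _ P f (homs (dec O) k X).
rewrite big_sumType (big_pred1 tt) /= => [main|[]//].
apply: leq_trans (_ : #|f (inl tt)| + \sum_(l | P (inr l)) #|f (inr l)| <= _).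
  apply: leq_add.
    have := @card_draws_between _ set0 A1 0 k.+1 (sub0set _); rewrite cards0 cA !subn0.
    exact.
  rewrite -sum_nat_const; apply: leq_sum => l lt.
  have cS : #|swap (block l)| = q.
    rewrite card_swap cA; move: (lt); rewrite inE => /andP[_ /eqP <-].
    by rewrite subnK // -cA; apply: subset_leq_card; apply: nbrs_sub.
  have sl : sq l \in swap (block l).
    by rewrite in_setU; apply/orP; right; apply/imsetP; exists l => //; apply: lb.
  have := @card_draws_between _ [set sq l] (swap (block l)) 1 k.+1.
  rewrite sub1set sl cards1 cS !subn1 /=; apply => //.
  by rewrite -cS; apply/card_gt0P; exists (sq l).
apply: main.
- case=> [[] _|l lt]; apply/subsetP => S; rewrite /f !inE => /and3P[_ SA cS]; apply/and3P; split => //.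
  + exact: subset_trans SA AX.
  + exact: monoW SA mA.
  + exact: subset_trans SA (swap_sub _).
  + exact: monoW SA (swap_mono _).
- have sA (l l' : 'I_k) S : l' \in tight -> S \in f (inr l) -> sq l' \in S -> lead l' = l.
    move=> l't; rewrite inE => /and3P[_ /subsetP SA _] /SA.
    rewrite in_setU in_setD => /orP[/andP[_ lA]|/imsetP[i iB e]].
      by have := sqA (ltn_ord l'); rewrite lA.
    have -> : l' = i by apply/val_inj/(sq_inj (ltn_ord _) (ltn_ord _) e).
    by move: iB; rewrite inE => /eqP.
  have sS (l : 'I_k) S : S \in f (inr l) -> sq l \in S by rewrite inE sub1set => /and3P[].
  have sN (l : 'I_k) S : S \in f (inl tt) -> sq l \in S -> False.
    by rewrite inE => /and3P[_ /subsetP SA _] /SA; apply/negP/sqA.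
  case=> [[]|l] [[]|l'] S //= lt l't SF SF'.
  + by case: (sN l' S SF (sS _ _ SF')).
  + by case: (sN l S SF' (sS _ _ SF)).
  + congr inr; have := sA _ _ _ l't SF (sS _ _ SF'); move: l't; rewrite inE => /andP[/eqP -> _] e.
    exact/val_inj/esym.
Qed.

End Anti.

(** N can replace the elements with indices in K in the antichain sq, making it
    longer than k. *)
Definition surplus K (N : {set T}) := [/\ N \subset A1, #|K| < #|N| &
  forall i : 'I_k, i \notin K -> (forall a, a \in N -> dec O (sq i) a) \/ (forall a, a \in N -> dec O a (sq i))].

Lemma block_surplus l : #|block l| < #|nbrs (block l)| -> surplus (block l) (nbrs (block l)).
Proof.
move=> lt; split=> // [|i]; first exact: nbrs_sub.
rewrite inE => il; case: (ltngtP (lead i) l) => [lt'|gt|e]; last by rewrite e eqxx in il.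
  left=> a /bigcupP[j]; rewrite in_set => /eqP jl aj.
  have ij : i < j < k by rewrite ltn_ord andbT ltnNge; apply/negP => /lead_mono; lia.
  apply: (side_left ij aj); apply/negP => ai.
  have lij : lead i != lead j by rewrite jl.
  by have := nbr_disj ij lij ai; rewrite aj.
right=> a /bigcupP[j]; rewrite inE => /eqP jl aj.
have ij : j < i < k by rewrite ltn_ord andbT ltnNge; apply/negP => /lead_mono; lia.
have lij : lead j != lead i by rewrite jl eq_sym.
exact: side_right ij aj (nbr_disj ij lij aj).
Qed.

Lemma isolated_surplus a : a \in A1 -> a \notin nbrs setT -> surplus set0 [set a].
Proof.
move=> aA nN; split=> [||i _]; [by rewrite sub1set|by rewrite cards0 cards1|].
have na : ~~ inc O a (sq i).
  by apply: contra nN => ai; apply/bigcupP; exists i; rewrite ?inE ?aA.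
have /orP[h|h] := slot_cmp aA (ltn_ord i) na; [right|left] => b /set1P->//.
Qed.

End Blocks.

(** * One long level: conclusion *)

Section ExactFirst.
Variables (T : finType) (O : biorder T) (X : {set T}) (k s z : nat).
Implicit Types (S N : {set T}) (x y u v a : T).
Notation q := (k + s).
Notation lev := (lev O X).
Notation dn := (lower O X).
Notation good := (good O X k).

Hypothesis dec_le : forall S, S \subset X -> mono (dec O) S -> #|S| <= q.
Hypothesis zk : 4000 * z ^ 2 <= k.
Hypothesis sz : 0 < s <= z.
Hypothesis few_dec : #|homs (dec O) k X| < 2 ^ z.
Hypothesis lev1 : #|lev 1| = q.
Hypothesis levk : forall j, 1 < j <= q -> #|lev j| = k.
Hypothesis ngood : forall j, 1 < j < q -> ~~ good j.

Let zkS : z <= k.+1.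
Proof. by move: zk; rewrite -mulnn; nia. Qed.

Let zzk : 4000 * z <= k.
Proof. by move: zk; rewrite -mulnn; nia. Qed.

Lemma full_strands : exists (e : nat -> T) (st : nat -> T -> T),
  [/\ forall i, i < k -> e i \in lev q,
      forall x, x \in lev q -> exists2 i, i < k & e i = x,
      forall j x, 2 <= j <= q -> x \in lev q -> st j x \in lev j,
      forall j x, 2 <= j < q -> x \in lev q -> inc O (st j x) (st j.+1 x) &
      forall i i' j, 2 <= j <= q -> i < i' < k -> dec O (st j (e i)) (st j (e i'))].
Proof.
have q2 : 2 <= q by lia.
have [|B [st [BL _ stL stI [stD cB]]]] := @strands _ O X (fun=> k) 2 q q2.
  move=> j S jb SL mS; rewrite leqNgt; apply/negP => kS.
  by have := ngood jb; rewrite (goodP SL mS kS).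
have lq : #|lev q| = k by apply: levk; lia.
have eB : B = lev q.
  apply/eqP; rewrite eqEcard BL lq; move: cB; rewrite lq big_nat_cond big1 ?addn0 //.
  by move=> j /andP[jb _]; rewrite levk ?subnn //; lia.
subst B.
have /card_gt0P[x0 _] : 0 < #|lev q| by rewrite lq; lia.
have [e [eL einc esurj]] := @mono_enum _ (dual O) x0 (lev q) (lev_dec O X q).
rewrite lq in eL einc esurj.
exists e, st; split => // i i' j jb ii'; apply: stD => //; [apply: eL; lia|apply: eL; lia|].
exact: einc.
Qed.

(** Let E be the number of edges between levels 1 and 2.  Counting leaders and
    isolated elements gives E >= q + k minus the number of blocks minus the number
    of isolated elements, while every tight block yields 'C(q - 1, k)
    decreasing sets.  This settles the case where at most one block is not tight
    or one element is isolated.  Otherwise there are surplus pairs (K, N) that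
    together avoid every index.  Moving N to level 2 turns the slot above into a
    good one, so that by [card_single] most elements of level 3 have two
    neighbours in level 2, and the third family of [wall_count] gives a large
    gain. *)
Lemma exact_first :
  k * 'C(q, k.+1) + s * 'C(q, k) <= #|homs (inc O) k X| + #|homs (dec O) k X| /\
  (1 < s -> k * 'C(q, k.+1) + s * 'C(q, k) < #|homs (inc O) k X| + #|homs (dec O) k X|).
Proof.
have [e [st [eL esurj stL stI stdec]]] := full_strands.
have k3 : 3 <= k by lia.
have kq : k < q by lia.
have st_inj j : 2 <= j <= q -> {in lev q &, injective (st j)}.
  move=> jb x y /esurj[i ik <-] /esurj[i' ik' <-] E; case: (ltngtP i i') => [lt|lt|->//].
    by have := stdec i i' j jb; rewrite lt ik' E dec_irr => /(_ isT).
  by have := stdec i' i j jb; rewrite lt ik E dec_irr => /(_ isT).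
have e_inj i i' : i < k -> i' < k -> e i = e i' -> i = i'.
  move=> ik ik' E; have q2 : 2 <= 2 <= q by lia.
  case: (ltngtP i i') => // lt.
    by have := stdec i i' 2 q2; rewrite lt ik' E dec_irr => /(_ isT).
  by have := stdec i' i 2 q2; rewrite lt ik E dec_irr => /(_ isT).
have b2 : 2 <= 2 <= q by lia.
have b2' : 2 <= 2 < q by lia.
have b3 : 2 <= 3 <= q by lia.
pose sq i := st 2 (e i).
have sqL i : i < k -> sq i \in lev 2 by move=> ik; apply: stL => //; apply: eL.
have sdec i j : i < j < k -> dec O (sq i) (sq j) by apply: stdec.
have slotA u i : u \in lev 1 -> i < k -> (u != sq i) && ~~ inc O (sq i) u.
  by move=> uL ik; apply: lev_slot uL (sqL i ik).
have mA := lev_dec O X 1.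
have AX := lev_sub O X 1.
have sX i : i < k -> sq i \in X by move=> ik; apply: (subsetP (lev_sub O X 2)); apply: sqL.
have lq : #|lev q| = k by apply: levk; lia.
have eimg : lev q = [set e i | i : 'I_k in 'I_k].
  apply/setP => x; apply/idP/imsetP => [/esurj[i ik <-]|[i _ ->]]; last exact: eL.
  by exists (Ordinal ik).
set W3 := [set x in lev q | 1 < #|dn 2 (st 3 x)|].
pose E := \sum_(i < k) #|nbr O (lev 1) sq i|.
have := wall_count k3 kq stL stI st_inj; rewrite -/W3 lq.
have -> : \sum_(x in lev q) #|dn 1 (st 2 x)| = E.
  rewrite {1}eimg big_imset /=; last by move=> i j _ _ /e_inj h; apply/val_inj/h.
  by apply: eq_bigl => i; rewrite inE.
move=> wc.
have cov := cover_count O (lev 1) k sq; rewrite -/E in cov.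
have dc := dec_count mA sdec slotA AX sX lev1.
have bexp := block_expands mA sdec slotA AX sX lev1 dec_le.
pose U := 'C(q.-1, k); pose c1 := 'C(q.-1, k.+1).
have eC : 'C(q, k.+1) = c1 + U.
  have {1}-> : q = q.-1.+1 by lia.
  by rewrite binS addnC.
have eF : k * 'C(q, k.+1) + s * 'C(q, k) = k * (c1 + U) + q * U by rewrite -bin_C0 eC.
rewrite eF; rewrite eC in dc; rewrite -/U -/c1 in wc dc.
pose tg := tight O (lev 1) k sq.
pose Pl := [set l : 'I_k | (lead O (lev 1) sq l == l) &&
   (#|block O (lev 1) k sq l| < #|nbrs O (lev 1) sq (block O (lev 1) k sq l)|)].
have cS : \sum_(i < k) (lead O (lev 1) sq i == i) <= #|tg| + #|Pl|.
  apply: leq_trans (leq_card_setU _ _) => //; rewrite -sum1_card [X in _ <= X]big_mkcond /=.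
  apply: leq_sum => l _; rewrite in_setU /tg /Pl !in_set -andb_orr.
  case: (_ == _) => //=; have := bexp (block O (lev 1) k sq l).
  by rewrite leq_eqVlt eq_sym => ->.
pose NT := nbrs O (lev 1) sq [set: 'I_k].
have NTs : NT \subset lev 1 by apply: nbrs_sub.
have cI : #|lev 1 :\: NT| + #|NT| = q by rewrite -lev1 -(cardsID NT (lev 1)) (setIidPr NTs) addnC.
pose tU := #|tg| * U.
have key : (q + k) * U <= (E + #|tg| + #|Pl| + #|lev 1 :\: NT|) * U.
  by rewrite leq_mul2r; apply/orP; right; move: cov cS cI; rewrite -/NT; arith.
have [few|many] := leqP (#|lev 1 :\: NT| + #|Pl|) 1.
  have key2 : (q + k) * U <= E * U + #|tg| * U + U.
    apply: leq_trans key _; have -> : E * U + #|tg| * U + U = (E + #|tg| + 1) * U by rewrite !mulnDl mul1n.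
    by rewrite leq_mul2r; apply/orP; right; arith.
  have base : k * (c1 + U) + q * U + c1 <= #|homs (inc O) k X| + #|homs (dec O) k X|.
    have e1 : k * (c1 + U) = k * c1 + k * U by rewrite mulnDr.
    have e2 : (q + k) * U = q * U + k * U by rewrite mulnDl.
    by move: key2 wc dc; rewrite e1 e2 -/tg; clear; move: (_ * 'C(_, _)); lia.
  split=> [|s1]; first by apply: leq_trans base; rewrite leq_addr.
  apply: leq_trans base; rewrite -addn1 leq_add2l bin_gt0; lia.
pose Bad := [set i : 'I_k | #|dn 2 (st 3 (e i))| <= 1].
have sur (K : {set 'I_k}) N : surplus O (lev 1) sq K N -> #|Bad :\: K| <= z + 2 * s + 3.
  move=> [NA KN side]; pose L := N :|: [set sq i | i : 'I_k in ~: K].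
  have sqK (i : 'I_k) : i \notin K -> sq i \in L.
    by move=> iK; rewrite in_setU; apply/orP; right; apply/imsetP; exists i; rewrite ?in_setC.
  have cL : k < #|L|.
    rewrite cardsU_disj => [|x /(subsetP NA) xA /imsetP[i _ ex]]; last first.
      by have := slotA x i xA (ltn_ord i); rewrite ex eqxx.
    rewrite card_in_imset; last by move=> i j _ _ /(sq_inj sdec) h; apply/val_inj/h.
    have := cardsC K; rewrite card_ord; move: KN; rewrite !cardE; move: (size _) (size _) (size _) => d1 d2 d3; clear; lia.
  have mL : mono (dec O) L.
    apply/monoP => x y; rewrite !in_setU => /orP[xN|/imsetP[i iK ->]] /orP[yN|/imsetP[j jK ->]] ne.
    - by apply: (monoP _ _ mA); rewrite ?(subsetP NA).
    - by move: jK; rewrite in_setC => /side[] h; rewrite h ?orbT.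
    - by move: iK; rewrite in_setC => /side[] h; rewrite h ?orbT.
    - apply: (monoP _ _ (lev_dec O X 2)) ne; exact: sqL.
  have LX : L \subset X.
    apply/subsetP => x; rewrite in_setU => /orP[/(subsetP NA)/(subsetP AX)//|/imsetP[i _ ->]].
    exact: sX.
  have hL u : u \in L -> (u \in X) && (hgt O X u < 3).
    move=> uL; rewrite (subsetP LX) //=; move: uL; rewrite in_setU => /orP[/(subsetP NA)/levP[_ ->]//|].
    by move=> /imsetP[i _ ->]; have /levP[_ ->] := sqL i (ltn_ord i).
  have slot3 u v : u \in L -> v \in lev 3 -> (u != v) && ~~ inc O v u.
    move=> /hL/andP[uX hu] /levP[vX hv]; apply/andP; split.
      by apply/negP => /eqP uv; rewrite uv hv in hu.
    by apply/negP => /(hgt_lt vX); rewrite hv; arith.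
  have UX : L :|: lev 3 \subset X by rewrite subUset LX lev_sub.
  have cs : #|single O L (lev 3)| <= z + 2 * s + 1.
    apply: (leq_trans _ (_ : z + 2 * (q - #|L|) + 1 <= _)); last by arith.
    apply: (@card_single _ O L (lev 3) mL (lev_dec O X 3) slot3 k z q) => //.
    - by move=> S /andP[SL mS]; apply: dec_le mS; apply: subset_trans SL UX.
    - by exists L => //; rewrite /slot_anti mL andbT subsetUl.
    - apply: leq_ltn_trans few_dec; apply: subset_leq_card; apply/subsetP => S.
      rewrite inE => /andP[/andP[SL mS] /eqP cS']; apply/homsP; split => //.
      exact: subset_trans SL UX.
  (* An element of level 3 with one neighbour in level 2 has no neighbour in N as
     soon as some element of level 2 outside K separates it from N.  Only the two
     strands next to N, those in Mx and Mn, are not separated. *)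
  pose Lf := [set i : 'I_k | (i \notin K) && [forall a in N, dec O (sq i) a]].
  pose Rt := [set i : 'I_k | (i \notin K) && [forall a in N, dec O a (sq i)]].
  pose Mx := [set i in Lf | [forall c in Lf, c <= i]].
  pose Mn := [set i in Rt | [forall c in Rt, i <= c]].
  pose Sg := [set i : 'I_k | st 3 (e i) \in single O L (lev 3)].
  have cSg : #|Sg| <= z + 2 * s + 1.
    apply: leq_trans cs; apply: (@card_into _ _ _ _ (fun i : 'I_k => st 3 (e i))).
      move=> i j _ _ E3; apply/val_inj/(e_inj _ _ (ltn_ord i) (ltn_ord j)).
      by apply: (st_inj 3) E3; rewrite // ?eL.
    by move=> i; rewrite in_set.
  have cMx : #|Mx| <= 1.
    apply/card_le1_eqP => i j; rewrite !in_set => /andP[iL /forall_inP hi] /andP[jL /forall_inP hj].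
    apply/val_inj/eqP; rewrite eqn_leq; apply/andP; split; [apply: hi|apply: hj]; by rewrite in_set.
  have cMn : #|Mn| <= 1.
    apply/card_le1_eqP => i j; rewrite !in_set => /andP[iL /forall_inP hi] /andP[jL /forall_inP hj].
    apply/val_inj/eqP; rewrite eqn_leq; apply/andP; split; [apply: hj|apply: hi]; by rewrite in_set.
  suff : Bad :\: K \subset Sg :|: (Mx :|: Mn).
    move/subset_leq_card; have := leq_card_setU Sg (Mx :|: Mn); have := leq_card_setU Mx Mn.
    by case=> ? _ [? _]; arith.
  apply/subsetP => i; rewrite in_setD in_set => /andP[iK bad].
  have vL : st 3 (e i) \in lev 3 by apply: stL => //; apply: eL.
  have iv : inc O (sq i) (st 3 (e i)) by apply: stI => //; apply: eL.
  have idn : sq i \in dn 2 (st 3 (e i)) by apply/dnP; split=> //; apply: sqL.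
  have only j : j < k -> inc O (sq j) (st 3 (e i)) -> j = i.
    move=> jk ji; apply: (sq_inj sdec) => //; apply: (card_le1_eqP bad) => //.
    by apply/dnP; split => //; apply: sqL.
  have cmp c : c < k -> c != i -> dec O (sq c) (st 3 (e i)) || dec O (st 3 (e i)) (sq c).
    move=> ck ci; have /andP[/(bi_total O)] := lev_slot (sqL c ck) vL.
    by case/or4P => [/(only c ck) ec|->//|->//|->]; [rewrite ec eqxx in ci|rewrite orbT].
  have fin : (forall a, a \in N -> ~~ inc O a (st 3 (e i))) -> i \in Sg.
    move=> nN; rewrite in_set in_set vL /=; apply/cards1P; exists (sq i).
    apply/setP => u; rewrite in_set in_set1; apply/andP/eqP => [[]|->]; last by split => //; apply: sqK.
    rewrite in_setU => /orP[/nN/negbTE->//|/imsetP[j _ ->]] /only ->//.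
  have lf_rt : (i \in Lf) || (i \in Rt).
    by rewrite !in_set iK /=; case: (side i iK) => h; apply/orP; [left|right]; apply/forall_inP.
  rewrite !in_setU; case/orP: lf_rt => iS.
    have [/forall_inP h|/forall_inPn[c cLf]] := boolP [forall c in Lf, c <= i].
      by apply/orP; right; apply/orP; left; rewrite in_set iS; apply/forall_inP.
    rewrite -ltnNge => ic; apply/orP; left; apply: fin => a aN.
    have ca : dec O (sq c) a by move: cLf; rewrite in_set => /andP[_ /forall_inP]; apply.
    have ne : (c : nat) != i by rewrite neq_ltn ic orbT.
    have st3 : dec O (st 3 (e i)) (st 3 (e c)) by apply: stdec => //; rewrite ic ltn_ord.
    have cc : inc O (sq c) (st 3 (e c)) by apply: stI => //; apply: eL.
    case/orP: (cmp c (ltn_ord c) ne) => h.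
      by have := inc_ndec cc; rewrite (dec_trans h st3).
    apply/negP => ai; by have := inc_ndec' ai; rewrite (dec_trans h ca).
  have [/forall_inP h|/forall_inPn[c cLf]] := boolP [forall c in Rt, i <= c].
    by apply/orP; right; apply/orP; right; rewrite in_set iS; apply/forall_inP.
  rewrite -ltnNge => ci; apply/orP; left; apply: fin => a aN.
  have ca : dec O a (sq c) by move: cLf; rewrite in_set => /andP[_ /forall_inP]; apply.
  have ne : (c : nat) != i by rewrite neq_ltn ci.
  have st3 : dec O (st 3 (e c)) (st 3 (e i)) by apply: stdec => //; rewrite ci ltn_ord.
  have cc : inc O (sq c) (st 3 (e c)) by apply: stI => //; apply: eL.
  case/orP: (cmp c (ltn_ord c) ne) => h; last first.
    by have := inc_ndec' cc; rewrite (dec_trans st3 h).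
  apply/negP => ai; by have := inc_ndec ai; rewrite (dec_trans ca h).
have cBad : #|Bad| <= 2 * (z + 2 * s + 3).
  have [I0|/card_gt0P[a]] := posnP #|lev 1 :\: NT|; last first.
    rewrite in_setD => /andP[aN aL].
    have := sur _ _ (isolated_surplus slotA aL aN).
    by rewrite setD0; lia.
  have [l [l' [lP l'P ll']]] : exists l l', [/\ l \in Pl, l' \in Pl & l != l'].
    by apply/card_gt1P; move: many; rewrite I0.
  have s1 : #|Bad :\: block O (lev 1) k sq l| <= z + 2 * s + 3.
    by apply: sur (block_surplus mA sdec slotA _); move: lP; rewrite in_set => /andP[].
  have s2 : #|Bad :\: block O (lev 1) k sq l'| <= z + 2 * s + 3.
    by apply: sur (block_surplus mA sdec slotA _); move: l'P; rewrite in_set => /andP[].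
  suff : Bad \subset (Bad :\: block O (lev 1) k sq l) :|: (Bad :\: block O (lev 1) k sq l').
    move/subset_leq_card => h; have [h' _] := leq_card_setU (Bad :\: block O (lev 1) k sq l) (Bad :\: block O (lev 1) k sq l').
    by move: h h' s1 s2; arith.
  apply/subsetP => i iB; rewrite in_setU 2!in_setD iB 2!in_set !andbT.
  by have [->|] := eqVneq (lead O (lev 1) sq i) l.
have cW3 : k <= #|W3| + 2 * (z + 2 * s + 3).
  apply: leq_trans (_ : #|W3| + #|Bad| <= _); last by rewrite leq_add2l.
  rewrite -{1}lq -(cardsID W3 (lev q)); apply: leq_add; first exact: subset_leq_card (subsetIr _ _).
  rewrite -(@card_imset _ _ (fun i : 'I_k => e i)); last by move=> i j /e_inj h; apply/val_inj/h.
  apply: subset_leq_card; apply/subsetP => x; rewrite in_setD => /andP[xW xL].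
  have [i ik ei] := esurj x xL; apply/imsetP; exists (Ordinal ik) => //.
  by rewrite in_set /= ei leqNgt; apply: contra xW => h; rewrite in_set xL.
have cE : 2 * k <= E + (z + 1).
  have g1 : good 1 by apply: long_good; rewrite lev1; lia.
  have := exc_bound dec_le g1 zkS few_dec; rewrite lev1 subnn muln0 addn0 => ex.
  apply: leq_trans (_ : E + #|exc O X 1| <= _); last by rewrite leq_add2l.
  apply: leq_trans (_ : E + #|[set i : 'I_k | sq i \in exc O X 1]| <= _); last first.
    rewrite leq_add2l; apply: (@card_into _ _ _ _ (fun i : 'I_k => sq i)).
      by move=> i j _ _ /(sq_inj sdec) h; apply/val_inj/h.
    by move=> i; rewrite in_set.
  rewrite -sum1dep_card big_mkcond /= /E -big_split /=.
  rewrite -{1}(card_ord k) mulnC -sum_nat_const; apply: leq_sum => i _.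
  case: ifPn => [_|nx]; last by rewrite addn0; apply: nexc_dn => //; apply: sqL.
  rewrite addn1 ltnS; apply: (@dn_gt0 _ O X 0); exact: sqL.
have U0 : 0 < U by apply: (@bin_U0 k s z).
have AU := bin_A_le sz zk; have hA := bin_A_ge sz zk; rewrite -/U in AU hA.
suff lt : k * (c1 + U) + q * U < #|homs (inc O) k X| + #|homs (dec O) k X|.
  by split=> [|_]; [apply: ltnW|].
apply: leq_trans (leq_addr _ _); apply: leq_trans wc.
move: 'C(q - 2, _) AU hA => A AU hA.
have t1 : k * A <= (#|W3| + 2 * (z + 2 * s + 3)) * A by rewrite leq_mul2r cW3 orbT.
have t2 : 2 * (z + 2 * s + 3) * A <= 2 * (z + 2 * s + 3) * U by rewrite leq_mul2l AU orbT.
have t3 : 2 * k * U <= (E + (z + 1)) * U by rewrite leq_mul2r cE orbT.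
have t4 : (2 * (z + 2 * s + 3) + (z + 1) + s + s) * U < k * U by rewrite ltn_pmul2r; lia.
move: t1 t2 t3 t4 hA; rewrite !mulnDl mulnDr; clear; move: #|W3| => w; lia.
Qed.

End ExactFirst.

(** * Configurations without long monotone sets *)

Lemma mono_flip (T : finType) (O : biorder T) (S : {set T}) :
  mono (inc (flip O)) S = mono (inc O) S.
Proof.
by apply/monoP/monoP => h x y xS yS xy; have := h x y xS yS xy; rewrite orbC.
Qed.

Lemma homs_flip (T : finType) (O : biorder T) k (X : {set T}) :
  homs (inc (flip O)) k X = homs (inc O) k X.
Proof. by apply/setP => S; rewrite !inE mono_flip. Qed.

(** The theorem of Erdos and Szekeres, by counting levels. *)
Lemma card_two_monos (T : finType) (O : biorder T) (X : {set T}) a b :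
  (forall S : {set T}, S \subset X -> mono (inc O) S -> #|S| <= a) ->
  (forall S : {set T}, S \subset X -> mono (dec O) S -> #|S| <= b) -> #|X| <= a * b.
Proof.
move=> ia db; rewrite (@card_lev_sum _ O X a); last by move=> v; apply: hgt_le.
apply: leq_trans (_ : \sum_(1 <= i < a.+1) b <= _).
  by apply: leq_sum => i _; apply: db; [apply: lev_sub|apply: lev_dec].
by rewrite sum_nat_const_nat subn1.
Qed.

Section Flip.
Variables (T : finType) (O : biorder T) (X : {set T}) (k q : nat).
Implicit Types (S N : {set T}) (x y u v a : T).
Hypothesis inc_le : forall S, S \subset X -> mono (inc O) S -> #|S| <= q.
Hypothesis up : forall j v, 0 < j < q -> v \in lev O X j -> exists2 u, u \in lev O X j.+1 & inc O v u.

(** If every point below level q has an upper neighbour, then chains upward from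
    v reach all higher levels, and they cannot be longer. *)
Lemma flip_hgt v : v \in X -> hgt (flip O) X v + hgt O X v = q.+1.
Proof.
move=> vX; have hq u : u \in X -> hgt O X u <= q by apply: hgt_le.
apply/eqP; rewrite eqn_leq; apply/andP; split.
  have [S [SX mS vS top <-]] := walk_down (flip O) vX; rewrite mono_flip in mS.
  suff : #|S| <= q - hgt O X v + 1 by have := hq v vX; arith.
  have ge y : y \in S -> hgt O X v <= hgt O X y.
    by move=> yS; have [->//|yv] := eqVneq y v; apply/ltnW/(hgt_lt vX)/top.
  apply: (@card_inj_bound _ _ (fun y => hgt O X y - hgt O X v + 1)).
    move=> x y xS yS e; apply: (hgt_inj SX mS) => //.
    by have := ge x xS; have := ge y yS; arith.
  by move=> y yS; have := ge y yS; have := hq y (subsetP SX _ yS); arith.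
have [d] : exists d, d = q - hgt O X v by exists (q - hgt O X v).
elim: d v vX => [|d IH] v vX ed; first by have := hq v vX; have := hgt_gt0 (flip O) X v; arith.
have [|u /levP[uX hu] vu] := @up (hgt O X v) v _ (introT (levP _ _ _ _) (conj vX erefl)).
  by have := hgt_gt0 O X v; have := hq v vX; arith.
have := IH u uX; have := @hgt_lt _ (flip O) X u v uX vu; rewrite hu => h /(_ ltac:(lia)).
by arith.
Qed.

Lemma flip_lev j : 0 < j <= q -> lev (flip O) X j = lev O X (q.+1 - j).
Proof.
move=> jb; apply/setP => v; rewrite !inE; case vX: (v \in X) => //=.
by have := flip_hgt vX; have := hgt_gt0 O X v; have := hgt_gt0 (flip O) X v;
  move=> h1 h2 h3; apply/eqP/eqP; arith.
Qed.

End Flip.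

Section Core.
Variables (T : finType) (k s z r : nat) (X : {set T}).
Notation q := (k + s).
Hypothesis zk : 4000 * z ^ 2 <= k.
Hypothesis sz : 0 < s <= z.
Hypothesis r1 : 0 < r.
Hypothesis cX : #|X| = k * q + r.

Let zzk : 4000 * z <= k.
Proof. by move: zk; rewrite -mulnn; nia. Qed.

Notation goal O :=
  (k * 'C(q, k.+1) + r * 'C(q, k) <= #|homs (inc O) k X| + #|homs (dec O) k X| /\
  ((s == 1) && (r == 1) = false ->
    k * 'C(q, k.+1) + r * 'C(q, k) < #|homs (inc O) k X| + #|homs (dec O) k X|)).

(** The long level is either the first one or the last one.  In the latter
    case every point has an upper neighbour, since otherwise it could be added to
    the next level, so [flip] reverses the order of the levels. *)
Lemma core_few (O : biorder T) :
  (forall S : {set T}, S \subset X -> mono (inc O) S -> #|S| <= q) ->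
  (forall S : {set T}, S \subset X -> mono (dec O) S -> #|S| <= q) ->
  #|homs (dec O) k X| < 2 ^ z -> good_count O X k q < 13 * z -> goal O.
Proof.
move=> inc_le dec_le few_dec Gz.
have [lt|[ers [l [lb lq lk lg]]]] := few_good inc_le dec_le zk sz few_dec cX r1 Gz.
  have h : k * 'C(q, k.+1) + r * 'C(q, k) < #|homs (inc O) k X| + #|homs (dec O) k X|.
    by apply: leq_trans lt _; rewrite leq_addr.
  by split=> [|_]; [apply: ltnW|].
suff [h1 h2] : k * 'C(q, k.+1) + s * 'C(q, k) <= #|homs (inc O) k X| + #|homs (dec O) k X| /\
  (1 < s -> k * 'C(q, k.+1) + s * 'C(q, k) < #|homs (inc O) k X| + #|homs (dec O) k X|).
  rewrite ers; split => // /negbT; rewrite andbb => s1; apply: h2.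
  by move: s1 sz; case: (s) => [|[]].
case/orP: lb => /eqP el; rewrite {}el in lq lk lg.
  apply: (exact_first dec_le zk sz few_dec lq).
    by move=> j jb; apply: lk; [arith|apply/eqP; arith].
  by move=> j jb; apply/negP => gj; have := lg j ltac:(arith) gj; arith.
have up j v : 0 < j < q -> v \in lev O X j -> exists2 u, u \in lev O X j.+1 & inc O v u.
  move=> jb vL; have [/exists_inP//|/exists_inPn no] := boolP [exists u in lev O X j.+1, inc O v u]; exfalso.
  pose S := v |: lev O X j.+1.
  have [vX hv] := levP _ _ _ _ vL.
  have mS : mono (dec O) S.
    apply: monoU1; first exact: lev_dec.
    move=> y yL yv; have /andP[/(bi_total O) + nyv] := lev_slot vL yL.
    by rewrite (negbTE (no y yL)) (negbTE nyv).
  have cS : #|S| = #|lev O X j.+1|.+1.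
    by rewrite cardsU1 (_ : v \notin _) //; apply/negP => /levP[_]; rewrite hv; lia.
  have [jq|jq] := eqVneq j.+1 q.
    have : #|S| <= q; last by rewrite cS jq lq ltnn.
    by apply: dec_le => //; rewrite subUset sub1set vX lev_sub.
  have gj : good O X k j.
    apply: (goodP _ mS); last by rewrite cS lk //; arith.
    by apply: setSU; rewrite sub1set.
  have := lg j jb gj; rewrite (negbTE jq) orbF => /eqP; arith.
have fl j : 0 < j <= q -> lev (flip O) X j = lev O X (q.+1 - j).
  exact: (flip_lev inc_le up).
rewrite -(homs_flip O); apply: (@exact_first _ (flip O) X k s z dec_le zk sz few_dec).
- by rewrite fl ?subSS ?subn0 //; lia.
- by move=> j jb; rewrite fl; [apply: lk; [arith|apply/eqP; arith]|arith].
move=> j jb; apply/negP => /existsP[S /and3P[SL mS cS]].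
have mS' : mono (dec O) S by exact: mS.
have SL' : S \subset lev O X (q - j) :|: lev O X (q - j).+1.
  apply: subset_trans SL _; rewrite !fl; [|arith|arith].
  by rewrite subSS setUC subSn ?subxx //; lia.
have gj := goodP SL' mS' cS.
by have := lg (q - j) ltac:(arith) gj; case/orP => /eqP; arith.
Qed.

(** With many good slots for both orders, two sets of k * s / 2 points hit all
    homogeneous sets, and at most k ^ 2 points remain. *)
Lemma core (O : biorder T) :
  (forall S : {set T}, S \subset X -> mono (inc O) S -> #|S| <= q) ->
  (forall S : {set T}, S \subset X -> mono (dec O) S -> #|S| <= q) ->
  #|homs (inc O) k X| < 2 ^ z -> #|homs (dec O) k X| < 2 ^ z -> goal O.
Proof.
move=> inc_le dec_le few_inc few_dec.
have [lt|manyI] := ltnP (good_count O X k q) (13 * z); first exact: core_few.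
have [lt|manyD] := ltnP (good_count (dual O) X k q) (13 * z).
  have [h1 h2] := @core_few (dual O) dec_le inc_le few_inc lt.
  by split; rewrite [#|homs (inc O) k X| + _]addnC.
have zk1 : 100 * z ^ 2 <= k by lia.
have big : k * q < #|X| by rewrite cX; lia.
have [Y [cY hY]] := many_good inc_le dec_le zk1 sz few_inc few_dec big manyI.
have [Y' [cY' hY']] := @many_good _ (dual O) X k s z dec_le inc_le zk1 sz few_dec few_inc big manyD.
pose Z := X :\: (Y :|: Y').
have small r' : (forall C, C \in homs r' k X -> exists2 y, y \in C & y \in Y :|: Y') ->
    forall S : {set T}, S \subset Z -> mono r' S -> #|S| <= k.
  move=> hit S SZ mS; rewrite leqNgt; apply/negP => kS.
  have [C CS cC] := subset_of_card kS.
  have [|y yC yY] := hit C.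
    apply/homsP; split=> //; last exact: monoW mS.
    exact: subset_trans CS (subset_trans SZ (subsetDl _ _)).
  by have := subsetP SZ y (subsetP CS _ yC); rewrite in_setD yY.
have : #|Z| <= k * k.
  apply: (@card_two_monos _ O); apply: small => C.
    by move=> /hY[y yC yY]; exists y; rewrite // in_setU yY.
  by move=> /hY'[y yC yY]; exists y; rewrite // in_setU yY orbT.
have : #|X| <= #|Z| + #|Y :|: Y'|.
  by rewrite -(cardsID (Y :|: Y') X) addnC leq_add2l subset_leq_card // subsetIr.
have [+ _] := leq_card_setU Y Y'.
rewrite cX; lia.
Qed.

End Core.

(** * Induction on the number of points *)

Definition block_count k n := \sum_(0 <= i < n) 'C(i %/ k, k).

Section BlockCount.
Variable k : nat.
Hypothesis k0 : 0 < k.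
Notation F := (block_count k).

Lemma block_countS n : F n.+1 = F n + 'C(n %/ k, k).
Proof. by rewrite /block_count big_nat_recr. Qed.

Lemma block_count_mono m n : m <= n -> F m <= F n.
Proof.
elim: n => [|n IH]; first by rewrite leqn0 => /eqP->.
rewrite leq_eqVlt => /orP[/eqP->//|]; rewrite ltnS => /IH h.
by rewrite block_countS; apply: leq_trans h (leq_addr _ _).
Qed.

Lemma block_count_row m r : r <= k -> F (k * m + r) = F (k * m) + r * 'C(m, k).
Proof.
elim: r => [|r IH] rk; first by rewrite !addn0.
rewrite addnS block_countS IH ?(ltnW rk) // mulnC divnMDl // divn_small // addn0.
by rewrite mulSn addnAC addnA.
Qed.

Lemma block_count_full m : F (k * m) = k * 'C(m, k.+1).
Proof.
elim: m => [|m IH]; first by rewrite !muln0 /block_count big_geq.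
by rewrite mulnS addnC block_count_row // IH binS mulnDr.
Qed.

Lemma block_countE m r : r <= k -> F (k * m + r) = k * 'C(m, k.+1) + r * 'C(m, k).
Proof. by move=> rk; rewrite block_count_row // block_count_full. Qed.

End BlockCount.

Definition hom_count (T : finType) (O : biorder T) k (X : {set T}) :=
  #|homs (inc O) k X| + #|homs (dec O) k X|.

Definition degree (T : finType) (O : biorder T) k (X : {set T}) y :=
  #|[set S in homs (inc O) k X | y \in S]| + #|[set S in homs (dec O) k X | y \in S]|.

Section Removal.
Variables (T : finType) (O : biorder T) (k : nat) (X : {set T}).
Implicit Types (S C : {set T}) (y : T).

Lemma homs_D1 r y : homs r k (X :\ y) = [set S in homs r k X | y \notin S].
Proof.
apply/setP => S; rewrite !inE subsetD1 -!andbA; congr (_ && _).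
by case: (y \notin S); rewrite ?andbT ?andbF.
Qed.

Lemma card_homs_D1 r y : #|homs r k X| = #|homs r k (X :\ y)| + #|[set S in homs r k X | y \in S]|.
Proof.
rewrite homs_D1 addnC -(cardsID [set S : {set T} | y \in S]); congr (_ + _).
  by apply: eq_card => S; rewrite !inE.
by apply: eq_card => S; rewrite !inE andbC.
Qed.

Lemma hom_count_D1 y : hom_count O k X = hom_count O k (X :\ y) + degree O k X y.
Proof.
rewrite /hom_count /degree (card_homs_D1 (inc O) y) (card_homs_D1 (dec O) y).
by rewrite addnACA.
Qed.

Lemma star_sub r C y : mono r C -> C \subset X ->
  [set S : {set T} | [&& [set y] \subset S, S \subset C & #|S| == k.+1]] \subset
  [set S in homs r k X | y \in S].
Proof.
move=> mC CX; apply/subsetP => S; rewrite !inE sub1set => /and3P[-> SC ->].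
by rewrite (subset_trans SC CX) (monoW SC mC).
Qed.

Lemma star_card C y q : y \in C -> #|C| = q.+1 ->
  'C(q, k) <= #|[set S : {set T} | [&& [set y] \subset S, S \subset C & #|S| == k.+1]]|.
Proof.
move=> yC cC; have := @card_draws_between _ [set y] C 1 k.+1.
by rewrite sub1set yC cards1 cC !subn1 /=; apply.
Qed.

Lemma degree_ge C y q : mono (inc O) C -> C \subset X -> y \in C -> #|C| = q.+1 ->
  'C(q, k) <= degree O k X y.
Proof.
move=> mC CX yC cC; apply: leq_trans (star_card yC cC) _.
by apply: leq_trans (subset_leq_card (star_sub y mC CX)) (leq_addr _ _).
Qed.

(** The subsets of C through y already account for the whole degree of y. *)
Lemma degree_tight C y q : mono (inc O) C -> C \subset X -> y \in C -> #|C| = q.+1 ->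
  degree O k X y <= 'C(q, k) ->
  (forall S, S \in homs (inc O) k X -> y \in S -> S \subset C) /\
  (forall S, S \in homs (dec O) k X -> y \notin S).
Proof.
move=> mC CX yC cC; rewrite /degree => le.
have c1 := star_card yC cC; have sub := star_sub y mC CX; have c2 := subset_leq_card sub.
split=> S SH.
  move=> yS; have SI : S \in [set S in homs (inc O) k X | y \in S] by rewrite in_set SH.
  have : S \in [set S : {set T} | [&& [set y] \subset S, S \subset C & #|S| == k.+1]].
    suff -> : [set S : {set T} | [&& [set y] \subset S, S \subset C & #|S| == k.+1]] =
      [set S in homs (inc O) k X | y \in S] by [].
    apply/eqP; rewrite eqEcard sub; exact: leq_trans (leq_addr _ _) (leq_trans le c1).
  by rewrite inE => /and3P[].
apply/negP => yS; have : 0 < #|[set S in homs (dec O) k X | y \in S]|.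
  by apply/card_gt0P; exists S; rewrite in_set SH.
by move: le c1 c2; set u := #|_|; set v := #|_|; set w := #|_|; lia.
Qed.

End Removal.

(** A chain whose length is the number of levels meets each of them. *)
Lemma level_hit (T : finType) (O : biorder T) (X S : {set T}) m i :
  S \subset X -> mono (inc O) S -> #|S| = m -> (forall v, v \in X -> hgt O X v <= m) ->
  0 < i <= m -> exists2 c, c \in S & c \in lev O X i.
Proof.
move=> SX mS cS hm im.
have [/exists_inP[c cC /eqP hc]|/exists_inPn no] := boolP [exists c in S, hgt O X c == i].
  by exists c => //; apply/levP; split=> //; apply: (subsetP SX).
have := @uniq_leq_size _ (i :: [seq hgt O X c | c <- enum S]) (iota 1 m).
rewrite /= size_map -cardE size_iota cS ltnn => h; exfalso.
suff : false by []; apply: h.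
  rewrite map_inj_in_uniq ?enum_uniq ?andbT; last first.
    by move=> x y; rewrite !mem_enum; apply: (hgt_inj SX mS).
  apply/mapP => -[c]; rewrite mem_enum => cS' e; have := no c cS'.
  by rewrite e eqxx.
move=> j; rewrite inE mem_iota => /orP[/eqP->|/mapP[c]]; first by arith.
rewrite mem_enum => cS' ->; have := hm c (subsetP SX _ cS'); have := hgt_gt0 O X c; arith.
Qed.

Lemma big_level (T : finType) (O : biorder T) (X : {set T}) m b :
  (forall v, v \in X -> hgt O X v <= m) -> m * b < #|X| ->
  exists2 i, 0 < i <= m & b < #|lev O X i|.
Proof.
move=> hm big; have [/hasP[i]|/hasPn no] := boolP (has (fun i => b < #|lev O X i|) (iota 1 m)).
  by rewrite mem_iota add1n ltnS => im bi; exists i.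
move: big; rewrite (card_lev_sum hm) ltnNge => /negP; case.
apply: leq_trans (_ : \sum_(1 <= i < m.+1) b <= _); last by rewrite sum_nat_const_nat subn1.
rewrite big_nat_cond [X in _ <= X]big_nat_cond; apply: leq_sum => i /andP[im _].
by have := no i; rewrite mem_iota add1n im => /(_ isT); rewrite -leqNgt.
Qed.

Lemma level_hom (T : finType) (O : biorder T) (X : {set T}) k i c :
  k < #|lev O X i| -> c \in lev O X i -> exists2 S, S \in homs (dec O) k X & c \in S.
Proof.
move=> big cL; have c1 : [set c] \subset lev O X i by rewrite sub1set.
have c1k : #|[set c]| <= k.+1 by rewrite cards1.
have [S [cS SL eS]] := subset_card_between c1 c1k big.
exists S; last by rewrite -sub1set.
apply/homsP; split=> //; first exact: subset_trans SL (lev_sub _ _ _).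
exact: monoW SL (lev_dec _ _ _).
Qed.

Section Induction.
Variables (T : finType) (k z N : nat).
Implicit Types (O : biorder T) (S C X : {set T}).
Notation F := (block_count k).
Notation hc O X := (hom_count O k X).
Hypothesis zk : 4000 * z ^ 2 <= k.
Hypothesis z0 : 0 < z.
Hypothesis FN : F N < 2 ^ z.
Hypothesis Nk : N <= k ^ 2 + k * z.

Let k0 : 0 < k.
Proof. by apply: leq_trans zk; rewrite muln_gt0 expn_gt0 z0. Qed.

Definition both O X := (0 < #|homs (inc O) k X|) && (0 < #|homs (dec O) k X|).

(** In a configuration violating the strict bound all points of C have minimal
    degree, so that deleting one of them keeps both types and again violates the
    strict bound. *)
Lemma shorten O X C q : k < q -> mono (inc O) C -> C \subset X -> #|C| = q.+1 ->
  both O X -> hc O X <= F #|X|.-1 + 'C(q, k) ->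
  (forall y, y \in X -> F #|X|.-1 <= hc O (X :\ y)) ->
  forall y, y \in C -> [/\ both O (X :\ y), hc O (X :\ y) <= F #|X|.-1 &
    (forall S, S \in homs (dec O) k X -> y \notin S)].
Proof.
move=> kq mC CX cC /andP[_ /card_gt0P[A AH]] le IH y yC.
have e := hom_count_D1 O k X y; have g := degree_ge k mC CX yC cC.
have yX := subsetP CX _ yC; have f := IH y yX.
have dle : degree O k X y <= 'C(q, k) by arith.
have [_ avoid] := degree_tight mC CX yC cC dle.
split=> //; last by arith.
apply/andP; split; apply/card_gt0P; last first.
  by exists A; rewrite homs_D1 in_set AH avoid.
have c1 := cardsD1 y C; rewrite yC cC add1n in c1; case: c1 => c1.
have kC : k < #|C :\ y| by rewrite -c1.
have [S SC cS] := subset_of_card kC.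
exists S; apply/homsP; split=> //; first exact: subset_trans SC (setSD _ CX).
exact: monoW (subset_trans SC (subsetDl _ _)) mC.
Qed.

(** All homogeneous sets are pairwise disjoint here.  Deleting one point of each
    decreasing one leaves more than k ^ 2 points without decreasing homogeneous
    set, so some level of the other order is a long increasing chain.  What is
    left of a decreasing homogeneous set still meets all k levels, so some point
    would have degree two. *)
Lemma first_row O X : k ^ 2 < #|X| -> hc O X <= #|X| - k ^ 2 -> both O X ->
  (forall y, y \in X -> degree O k X y <= 1) -> False.
Proof.
move=> bigX le /andP[/card_gt0P[C CH] /card_gt0P[A AH]] deg1.
have [AX mA cA] := homsP _ _ _ _ AH.
have /card_gt0P[x0 _] : 0 < #|A| by rewrite cA.
pose rep (S : {set T}) := odflt x0 [pick x in S].
have repP S : S \in homs (dec O) k X -> rep S \in S.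
  move=> /homsP[_ _ cS]; rewrite /rep; case: pickP => [//|no].
  by move: cS; rewrite (eq_card0 no).
pose Rm := [set rep S | S in homs (dec O) k X].
pose X' := X :\: Rm.
have uniqD S S' y : S \in homs (dec O) k X -> S' \in homs (dec O) k X -> y \in S -> y \in S' -> S = S'.
  move=> SH S'H yS yS'; have [SX _ _] := homsP _ _ _ _ SH.
  have le1 := leq_trans (leq_addl _ _) (deg1 y (subsetP SX _ yS)).
  by apply: (card_le1_eqP le1); rewrite in_set ?SH ?S'H.
have no_both S S' y : S \in homs (inc O) k X -> S' \in homs (dec O) k X -> y \in S -> y \in S' -> False.
  move=> SH S'H yS yS'; have [SX _ _] := homsP _ _ _ _ SH.
  have := deg1 y (subsetP SX _ yS); rewrite /degree.
  have : 0 < #|[set S in homs (inc O) k X | y \in S]| by apply/card_gt0P; exists S; rewrite in_set SH.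
  have : 0 < #|[set S in homs (dec O) k X | y \in S]| by apply/card_gt0P; exists S'; rewrite in_set S'H.
  move: #|_| #|_|; lia.
have cX' : k * k < #|X'|.
  have : #|Rm| <= #|homs (dec O) k X| by apply: leq_imset_card.
  have : 0 < #|homs (inc O) k X| by apply/card_gt0P; exists C.
  have : #|X| <= #|X'| + #|Rm|.
    by rewrite -(cardsID Rm X) addnC leq_add2l subset_leq_card ?subsetIr.
  by move: bigX le; rewrite /hom_count -mulnn; arith.
have X'X : X' \subset X by apply: subsetDl.
have dk v : v \in X' -> hgt (dual O) X' v <= k.
  apply: hgt_le => S SX' mS; rewrite leqNgt; apply/negP => kS.
  have [D DS cD] := subset_of_card kS.
  have DH : D \in homs (dec O) k X.
    apply/homsP; split=> //; last exact: monoW DS mS.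
    exact: subset_trans DS (subset_trans SX' X'X).
  have := subsetP SX' _ (subsetP DS _ (repP D DH)).
  by rewrite in_setD => /andP[/negP]; case; apply: imset_f.
have [i ik ibig] := big_level dk cX'.
have AX' : A :\ rep A \subset X'.
  apply/subsetP => x; rewrite in_setD1 => /andP[xr xA]; rewrite in_setD (subsetP AX) // andbT.
  apply/imsetP => -[S SH xS]; have xS' : x \in S by rewrite xS repP.
  by have := uniqD _ _ _ AH SH xA xS' => e; rewrite xS e eqxx in xr.
have cA' : #|A :\ rep A| = k.
  by have := cardsD1 (rep A) A; rewrite (repP _ AH) cA add1n => -[].
have [c cA'' cL] := level_hit AX' (monoW (subsetDl _ _) mA : mono (inc (dual O)) _) cA' dk ik.
have [S SH cS] := level_hom ibig cL.
have SH' : S \in homs (inc O) k X.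
  by have [SX mS eS] := homsP _ _ _ _ SH; apply/homsP; split => //; apply: subset_trans SX X'X.
by apply: (no_both S A c) => //; move: cA''; rewrite in_setD1 => /andP[].
Qed.

(** Deleting a point of C by [shorten] contradicts the strict induction
    hypothesis unless k ^ 2 + k + 1 points remain.  In that case a chain with
    k + 2 elements could be shortened once more; hence there are k + 1 levels,
    one of them has more than k elements, and C meets it in a point lying on a
    decreasing homogeneous set. *)
Lemma long_chain O X C q : k < q -> q = #|X|.-1 %/ k -> mono (inc O) C -> C \subset X -> #|C| = q.+1 ->
  both O X -> hc O X <= F #|X| ->
  (forall m X', #|X'| = m -> m < #|X| -> F m <= hc O X' /\
     (both O X' -> m <> k ^ 2 + k + 1 -> F m < hc O X')) ->
  False.
Proof.
move=> kq eq mC CX cC bX le IH.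
have cX0 : 0 < #|X| by apply: leq_trans (subset_leq_card CX); rewrite cC.
have FX : F #|X| = F #|X|.-1 + 'C(q, k) by rewrite eq -block_countS prednK.
rewrite FX in le.
have cD1 (X' : {set T}) y : y \in X' -> #|X' :\ y| = #|X'|.-1 by move=> yX; rewrite (cardsD1 y X') yX.
have IH1 y : y \in X -> F #|X|.-1 <= hc O (X :\ y).
  by move=> yX; have [] := IH #|X|.-1 (X :\ y); rewrite ?cD1 ?prednK.
have sh := shorten kq mC CX cC bX le IH1.
have /card_gt0P[y yC] : 0 < #|C| by rewrite cC.
have [b1 h1 _] := sh y yC; have yX := subsetP CX _ yC.
have [_ st] := IH #|X|.-1 (X :\ y) (cD1 _ _ yX) ltac:(by rewrite prednK).
have [e|ne] := eqVneq #|X|.-1 (k ^ 2 + k + 1); last first.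
  by have := st b1 (elimN eqP ne); rewrite ltnNge h1.
have k2 : 1 < k by apply: leq_trans zk; rewrite -mulnn; nia.
have qk : q = k.+1.
  rewrite eq e -mulnn; have -> : k * k + k + 1 = k.+1 * k + 1 by lia.
  by rewrite divnMDl // divn_small ?addn0.
pose X' := X :\ y; have cX' : #|X'| = k ^ 2 + k + 1 by rewrite /X' cD1.
have inc_le S : S \subset X' -> mono (inc O) S -> #|S| <= k.+1.
  move=> SX mS; rewrite leqNgt; apply/negP => kS.
  have [D DS cD] := subset_of_card kS.
  have DX : D \subset X' := subset_trans DS SX.
  have FX' : F #|X'| = F #|X'|.-1 + 'C(k.+1, k).
    rewrite cX' addn1 block_countS /=; congr (_ + 'C(_, _)).
    by rewrite -mulnn -mulSnr mulnK.
  have le' : hc O X' <= F #|X'|.-1 + 'C(k.+1, k) by rewrite -FX' cX' -e.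
  have lt2 : #|X'|.-1 < #|X| by rewrite cX'; arith.
  have IH2 y' : y' \in X' -> F #|X'|.-1 <= hc O (X' :\ y').
    by move=> yX'; exact: (proj1 (IH _ _ (cD1 _ _ yX') lt2)).
  have /card_gt0P[y' yD] : 0 < #|D| by rewrite cD.
  have [b2 h2 _] := shorten (ltnSn k) (monoW DS mS) DX cD b1 le' IH2 yD.
  have [_ st2] := IH #|X'|.-1 (X' :\ y') (cD1 _ _ (subsetP DX _ yD)) lt2.
  have ne2 : #|X'|.-1 <> k ^ 2 + k + 1 by rewrite cX' addn1 /=; clear; lia.
  have := st2 b2 ne2.
  by rewrite ltnNge h2.
have hk v : v \in X' -> hgt O X' v <= k.+1 by apply: hgt_le.
have big : k.+1 * k < #|X'| by rewrite cX' -mulnn; lia.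
have [i ik ibig] := big_level hk big.
have cC' : #|C :\ y| = k.+1 by rewrite cD1 // cC qk.
have [c cCy cL] := level_hit (setSD _ CX) (monoW (subsetDl _ _) mC) cC' hk ik.
have [S SH cS] := level_hom ibig cL.
have [_ _ av] := sh c (subsetP (subsetDl _ _) _ cCy).
have SH' : S \in homs (dec O) k X.
  by have [SX mS eS] := homsP _ _ _ _ SH; apply/homsP; split => //; apply: subset_trans SX (subsetDl _ _).
by have := av S SH'; rewrite cS.
Qed.

(** If all monotone sets have at most q elements, then [core] applies: q > k by
    [card_two_monos], and q - k <= z by the bound on N. *)
Lemma lower_bound n : n <= N -> forall O X, #|X| = n -> F n <= hc O X /\
  (both O X -> n <> k ^ 2 + k + 1 -> F n < hc O X).
Proof.
elim/ltn_ind: n => n IH nN O X cX.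
have [F0|F0] := posnP (F n).
  rewrite F0; split => // /andP[h _] _; exact: leq_trans h (leq_addr _ _).
case: n => [|n] in IH nN cX F0 *; first by rewrite /block_count big_geq in F0.
set q := n %/ k; have FS : F n.+1 = F n + 'C(q, k) by rewrite block_countS.
have cD1 y : y \in X -> #|X :\ y| = n by move=> yX; have := cardsD1 y X; rewrite yX cX add1n => -[].
have IH1 O' y : y \in X -> F n <= hc O' (X :\ y).
  by move=> yX; have [] := IH n (ltnSn n) (ltnW nN) O' _ (cD1 y yX).
have qk : k <= q.
  rewrite leqNgt; apply/negP => qk; move: F0; rewrite lt0n => /negP; apply.
  rewrite /block_count big_nat_cond big1 // => i /andP[ib _].
  by rewrite bin_small //; apply: leq_ltn_trans qk; apply: leq_div2r; lia.
have [/exists_inP[y yX dy]|/exists_inPn deg] :=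
    boolP [exists y in X, 'C(q, k) < degree O k X y].
  have lt : F n.+1 < hc O X.
    by rewrite FS (hom_count_D1 O k X y) -addnS; apply: leq_add => //; apply: IH1.
  by split=> [|_ _]; [apply: ltnW|].
have {}deg y : y \in X -> degree O k X y <= 'C(q, k) by move=> yX; rewrite leqNgt deg.
have eqn : n = q * k + n %% k := divn_eq n k.
have nk : n %% k < k by rewrite ltn_mod.
have long O' C : (forall Y, hc O' Y = hc O Y) -> (both O' X = both O X) -> mono (inc O') C -> C \subset X -> q < #|C| ->
    F n.+1 <= hc O X /\ (both O X -> n.+1 <> k ^ 2 + k + 1 -> F n.+1 < hc O X).
  move=> hcO bO mC0 CX0 cC0.
  have [C' CC' cC] := subset_of_card cC0.
  have mC := monoW CC' mC0; have CX := subset_trans CC' CX0.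
  have /card_gt0P[y yC] : 0 < #|C'| by rewrite cC.
  have first : F n.+1 <= hc O X.
    rewrite FS -hcO (hom_count_D1 O' k X y).
    exact: (leq_add (IH1 O' y (subsetP CX _ yC)) (degree_ge k mC CX yC cC)).
  split=> // bX nn; rewrite ltnNge; apply/negP => le.
  have [kq|kq] := ltnP k q.
    apply: (@long_chain O' X C' q) => //; rewrite ?cX ?bO ?hcO //.
    by move=> m X' cX' lt; apply: IH => //; arith.
  have qe : q = k by arith.
  apply: (@first_row O X) => //.
  - by rewrite cX -mulnn; rewrite qe in eqn; lia.
  - apply: leq_trans le _; rewrite cX.
    have -> : n.+1 = k * k + (n %% k).+1 by rewrite {1}eqn qe addnS.
    rewrite block_countE // bin_small // muln0 binn muln1 mulnn; lia.
  - by move=> x xX; have := deg x xX; rewrite qe binn.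
have [/existsP[C /and3P[CX mC cC]]|noI] :=
    boolP [exists C : {set T}, [&& C \subset X, mono (inc O) C & q < #|C|]].
  exact: (long O C).
have [/existsP[C /and3P[CX mC cC]]|noD] :=
    boolP [exists C : {set T}, [&& C \subset X, mono (dec O) C & q < #|C|]].
  apply: (long (dual O) C) => //.
    by move=> Y; rewrite /hom_count addnC.
  by rewrite /both andbC.
have inc_le S : S \subset X -> mono (inc O) S -> #|S| <= q.
  by move=> SX mS; rewrite leqNgt; apply: contra noI => h; apply/existsP; exists S; rewrite SX mS.
have dec_le S : S \subset X -> mono (dec O) S -> #|S| <= q.
  by move=> SX mS; rewrite leqNgt; apply: contra noD => h; apply/existsP; exists S; rewrite SX mS.
have [manyI|fewI] := leqP (2 ^ z) #|homs (inc O) k X|.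
  have lt : F n.+1 < hc O X.
    apply: leq_trans (leq_ltn_trans (block_count_mono k nN) FN) _.
    by apply: leq_trans manyI (leq_addr _ _).
  by split=> [|_ _]; [apply: ltnW|].
have [manyD|fewD] := leqP (2 ^ z) #|homs (dec O) k X|.
  have lt : F n.+1 < hc O X.
    apply: leq_trans (leq_ltn_trans (block_count_mono k nN) FN) _.
    by apply: leq_trans manyD (leq_addl _ _).
  by split=> [|_ _]; [apply: ltnW|].
have es := card_two_monos inc_le dec_le; rewrite cX in es.
have kq : k < q.
  rewrite ltn_neqAle qk andbT; apply/negP => /eqP e.
  by rewrite -e in es eqn; lia.
pose s := q - k; have qs : q = k + s by rewrite /s; lia.
have sz : 0 < s <= z.
  apply/andP; split; first by rewrite /s; lia.
  have : k * q < k * (k + z) by rewrite mulnDr mulnn; move: nN Nk; rewrite [k * q]mulnC; lia.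
  by rewrite ltn_pmul2l // /s; lia.
pose r := (n %% k).+1.
have cXr : #|X| = k * (k + s) + r by rewrite cX /r addnS -qs [k * q]mulnC -eqn.
rewrite qs in inc_le dec_le.
have [h1 h2] := core zk sz (ltn0Sn _ : 0 < r) cXr inc_le dec_le fewI fewD.
have eF : F n.+1 = k * 'C(k + s, k.+1) + r * 'C(k + s, k).
  by rewrite -cX cXr block_countE.
rewrite eF; split => // _ nn; apply: h2; apply/negP => /andP[/eqP s1 /eqP r1].
by apply: nn; rewrite -cX cXr s1 r1 -mulnn; lia.
Qed.

End Induction.

(** * Permutations and the permutation tau *)

Section PermBiorder.
Variables (n : nat) (s : 'S_n).

Definition perm_inc : rel 'I_n := fun i j => (i < j) && (s i < s j).
Definition perm_dec : rel 'I_n := fun i j => (i < j) && (s j < s i).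

Lemma perm_inc_irr : irreflexive perm_inc.
Proof. by move=> i; rewrite /perm_inc ltnn. Qed.

Lemma perm_dec_irr : irreflexive perm_dec.
Proof. by move=> i; rewrite /perm_dec ltnn. Qed.

Lemma perm_inc_trans : transitive perm_inc.
Proof.
by move=> j i l /andP[a b] /andP[c d]; rewrite /perm_inc (ltn_trans a c) (ltn_trans b d).
Qed.

Lemma perm_dec_trans : transitive perm_dec.
Proof.
by move=> j i l /andP[a b] /andP[c d]; rewrite /perm_dec (ltn_trans a c) (ltn_trans d b).
Qed.

Lemma perm_total i j : i != j ->
  [|| perm_inc i j, perm_inc j i, perm_dec i j | perm_dec j i].
Proof.
rewrite /perm_inc /perm_dec => ij.
have sij : s i != s j by apply: contra ij => /eqP/perm_inj->.
by move: ij sij; rewrite -!val_eqE /=; case: (ltngtP i j) => // _ _; case: (ltngtP (s i) (s j)).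
Qed.

Lemma perm_excl i j : perm_inc i j -> ~~ perm_dec i j && ~~ perm_dec j i.
Proof. by rewrite /perm_inc /perm_dec => /andP[a b]; rewrite a /= -leqNgt (ltnW b) /= negb_and -leqNgt (ltnW a). Qed.

Definition perm_biorder : biorder 'I_n :=
  Biorder perm_inc_irr perm_dec_irr perm_inc_trans perm_dec_trans perm_total perm_excl.

Lemma position_mono (r : rel nat) (A : {set 'I_n}) :
  [forall i in A, forall j in A, (i < j) ==> r (s i) (s j)] =
  mono (fun i j : 'I_n => (i < j) && r (s i) (s j)) A.
Proof.
apply/forall_inP/monoP => [h i j iA jA ij|h i iA].
  have [lt|lt|/val_inj e] := ltngtP i j; last by rewrite e eqxx in ij.
    by move/forall_inP: (h i iA) => /(_ j jA); rewrite lt /= => ->.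
  by move/forall_inP: (h j jA) => /(_ i iA); rewrite lt.
apply/forall_inP => j jA; apply/implyP => lt.
have ij : i != j by rewrite -val_eqE /= neq_ltn lt.
by have /orP[] := h i j iA jA ij => /andP[]//; rewrite ltnNge (ltnW lt).
Qed.

Lemma increasing_mono A : increasing_on s A = mono (inc perm_biorder) A.
Proof. exact: (position_mono (fun u v => u < v)). Qed.

Lemma decreasing_mono A : decreasing_on s A = mono (dec perm_biorder) A.
Proof. exact: (position_mono (fun u v => v < u)). Qed.

Lemma mono_countE k : 0 < k -> mono_count k s = hom_count perm_biorder k setT.
Proof.
move=> k0; rewrite /hom_count /mono_count.
rewrite -cardsU_disj => [|A /homsP[_ mI cA] /homsP[_ mD _]]; last first.
  by have := mono_inc_dec mI mD; rewrite cA; lia.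
apply: eq_card => A.
by rewrite !inE subsetT -increasing_mono -decreasing_mono /= -andb_orl andbC.
Qed.

Lemma has_increasingP k : has_increasing k s <-> 0 < #|homs (inc perm_biorder) k setT|.
Proof.
split=> [[A [cA iA]]|/card_gt0P[A /homsP[_ mA cA]]].
  by apply/card_gt0P; exists A; apply/homsP; split; rewrite ?subsetT -?increasing_mono.
by exists A; rewrite increasing_mono.
Qed.

Lemma has_decreasingP k : has_decreasing k s <-> 0 < #|homs (dec perm_biorder) k setT|.
Proof.
split=> [[A [cA iA]]|/card_gt0P[A /homsP[_ mA cA]]].
  by apply/card_gt0P; exists A; apply/homsP; split; rewrite ?subsetT -?decreasing_mono.
by exists A; rewrite decreasing_mono.
Qed.

End PermBiorder.

Section Tau.
Variables (k n : nat).
Hypothesis k0 : 0 < k.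

(** v belongs to block j when j * n < (v + 1) * k <= (j + 1) * n; blocks are
    numbered from 0. *)
Definition block_of v := (v.+1 * k).-1 %/ n.

Lemma block_ofP j v : v \in tau_block k n j.+1 = (j * n < v.+1 * k <= j.+1 * n).
Proof.
rewrite /tau_block mem_iota subnKC /=; last by apply: leq_div2r; rewrite leq_mul2r leqnSn orbT.
by rewrite -[_ <= v]ltnS ltn_divLR // leq_divRL.
Qed.

Lemma block_of_in j v : 0 < n -> v \in tau_block k n j.+1 -> block_of v = j.
Proof.
move=> n0; rewrite block_ofP /block_of => /andP[h1 h2]; apply/eqP; rewrite eqn_leq.
rewrite -ltnS ltn_divLR // leq_divRL // prednK ?muln_gt0 ?k0 // h2 /=; lia.
Qed.

Definition tau_rel u v := ((block_of u == block_of v) && (u < v)) || (block_of v < block_of u).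

(** Blocks are concatenated by decreasing index, so an earlier entry either lies
    in a higher block or in the same block, where it is smaller. *)
Lemma tau_pairwise : 0 < n -> pairwise tau_rel (tau_seq k n).
Proof.
move=> n0; rewrite /tau_seq.
suff h m : pairwise tau_rel (flatten [seq tau_block k n j | j <- rev (iota 1 m)]) by apply: h.
elim: m => // m IH.
have -> : rev (iota 1 m.+1) = m.+1 :: rev (iota 1 m).
  by rewrite -[in LHS](addn1 m) iotaD rev_cat /= add1n.
rewrite /= pairwise_cat IH andbT; apply/andP; split.
  apply/allrelP => u v /(block_of_in n0) bu /flattenP[_ /mapP[j + ->]].
  rewrite mem_rev mem_iota; case: j => // j jm /(block_of_in n0) bv.
  by rewrite /tau_rel bu bv; apply/orP; right; lia.
have : pairwise ltn (tau_block k n m.+1) by rewrite -(sorted_pairwise ltn_trans) iota_ltn_sorted.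
apply: (@sub_in_pairwise _ (mem (tau_block k n m.+1))); last by apply/allP.
by move=> u v /(block_of_in n0) bu /(block_of_in n0) bv; rewrite /tau_rel bu bv eqxx /ltn /= => ->.
Qed.

Lemma tau_relP (i j : 'I_n) : i < j -> tau_rel (tau k n i) (tau k n j).
Proof.
move=> ij; have n0 : 0 < n by apply: leq_ltn_trans (ltn_ord i).
have sz : size (tau_seq k n) = n by rewrite (perm_size (perm_tau_seq n k0)) size_iota.
rewrite !permE !val_tau_fun (set_nth_default 0) ?sz //.
rewrite [X in tau_rel _ X](set_nth_default 0) ?sz //.
by apply: (pairwiseP 0 (tau_pairwise n0)); rewrite ?inE ?sz.
Qed.

Lemma block_of_lt v : v < n -> block_of v < k.
Proof.
move=> vn; have n0 : 0 < n by apply: leq_ltn_trans vn.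
by rewrite /block_of ltn_divLR // prednK ?muln_gt0 ?k0 // mulnC leq_mul2l vn orbT.
Qed.

Lemma block_of_mono u v : u <= v -> block_of u <= block_of v.
Proof. by move=> uv; apply: leq_div2r; rewrite -!subn1 leq_sub2r // leq_mul2r ltnS uv orbT. Qed.

Notation O := (perm_biorder (tau k n)).

(** A decreasing set meets each of the k blocks at most once. *)
Lemma tau_no_dec : homs (dec O) k setT = set0.
Proof.
apply/setP => A; rewrite in_set0; apply/negP => /homsP[_ mA cA].
have : #|A| <= k; last by rewrite cA ltnn.
apply: (@card_inj_bound _ _ (fun i => (block_of (tau k n i)).+1)); last first.
  by move=> i _; rewrite /= block_of_lt.
move=> i j iA jA [e]; apply/eqP/negPn/negP => ij.
have [] := orP (monoP _ _ mA i j iA jA ij) => /andP[lt lt'].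
  by have := tau_relP lt; rewrite /tau_rel e ltnn eqxx orbF /= ltnNge (ltnW lt').
by have := tau_relP lt; rewrite /tau_rel e ltnn eqxx orbF /= ltnNge (ltnW lt').
Qed.

Definition positions (b : nat) : {set 'I_n} := [set i | block_of (tau k n i) == b].

Lemma tau_inc_block A : A \in homs (inc O) k setT ->
  exists2 b : 'I_k, A \subset positions b & #|A| = k.+1.
Proof.
move=> /homsP[_ mA cA]; have /card_gt0P[i iA] : 0 < #|A| by rewrite cA.
exists (Ordinal (block_of_lt (ltn_ord (tau k n i)))) => //.
apply/subsetP => j jA; rewrite inE /=.
have [->|ij] := eqVneq j i; first by [].
have [] := orP (monoP _ _ mA j i jA iA ij) => /andP[lt lt'];
  have := tau_relP lt; rewrite /tau_rel => /orP[/andP[/eqP-> _]|]; rewrite ?eqxx //.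
  by rewrite ltnNge (block_of_mono (ltnW lt')).
by rewrite ltnNge (block_of_mono (ltnW lt')).
Qed.

Definition block_size b := (b.+1 * n) %/ k - (b * n) %/ k.

Lemma card_positions b : #|positions b| <= block_size b.
Proof.
rewrite cardE -(size_map (fun i : 'I_n => val (tau k n i))) -[X in _ <= X](size_iota ((b * n) %/ k)).
apply: uniq_leq_size.
  by rewrite map_inj_uniq ?enum_uniq // => i j /val_inj/perm_inj.
move=> _ /mapP[i + ->]; rewrite mem_enum inE => /eqP ib.
have n0 : 0 < n by apply: leq_ltn_trans (ltn_ord i).
rewrite -[iota _ _]/(tau_block k n b.+1) block_ofP; move: ib; rewrite /block_of /=.
set m := _.+1 * k; have m0 : 0 < m by rewrite muln_gt0 k0.
move=> e; have := leq_trunc_div m.-1 n; have := ltn_ceil m.-1 n0; rewrite e; lia.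
Qed.

Lemma block_size_cases b : b < k -> block_size b = n %/ k \/ block_size b = (n %/ k).+1.
Proof.
move=> bk; rewrite /block_size; set m := n %/ k; pose r := n %% k.
have en : n = m * k + r := divn_eq n k.
have rk : r < k by rewrite ltn_mod.
have e j : (j * n) %/ k = j * m + (j * r) %/ k.
  by rewrite {1}en mulnDr mulnA divnMDl.
rewrite !e !mulSn.
have h1 : b * r %/ k <= (r + b * r) %/ k by apply: leq_div2r; apply: leq_addl.
have h2 : (r + b * r) %/ k <= (b * r %/ k).+1.
  rewrite -ltnS ltn_divLR // mulSn; have := ltn_ceil (b * r) k0; lia.
lia.
Qed.

Lemma sum_block_size : \sum_(b < k) block_size b = n.
Proof.
have -> : \sum_(b < k) block_size b = \sum_(0 <= b < k) ((b.+1 * n) %/ k - (b * n) %/ k).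
  by rewrite big_mkord.
rewrite telescope_sumn => [|i j ij]; last by apply: leq_div2r; rewrite leq_mul2r ij orbT.
by rewrite mul0n div0n subn0 mulKn.
Qed.

(** An increasing set lies in one block.  The block sizes are n %/ k or one more
    and add up to n, so \sum_b 'C(block_size b, k.+1) is F(n). *)
Lemma tau_upper : mono_count k (tau k n) <= block_count k n.
Proof.
rewrite mono_countE // /hom_count tau_no_dec cards0 addn0.
apply: (@leq_trans (\sum_(b < k) 'C(block_size b, k.+1))).
  apply: (@leq_trans (\sum_(b < k) #|[set A : {set 'I_n} | A \subset positions b & #|A| == k.+1]|)).
    apply: (@leq_trans #|\bigcup_(b < k) [set A : {set 'I_n} | A \subset positions b & #|A| == k.+1]|).
      apply: subset_leq_card; apply/subsetP => A /tau_inc_block[b Ab cA].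
      by apply/bigcupP; exists b => //; rewrite inE Ab cA eqxx.
    elim/big_rec2: _ => [|b y1 Y _ IH]; first by rewrite cards0.
    by apply: leq_trans (leq_card_setU _ _) _; rewrite leq_add2l.
  apply: leq_sum => b _; rewrite cards_draws; apply: leq_bin2l; exact: card_positions.
pose m := n %/ k; have en : n = k * m + n %% k by rewrite mulnC -divn_eq.
have sum : \sum_(b < k) block_size b = k * m + n %% k by rewrite sum_block_size.
rewrite [X in block_count _ X]en block_countE ?(ltnW (ltn_pmod _ _)) //.
have -> : n %% k = \sum_(b < k) (block_size b - m).
  rewrite -(addnK (k * m) (n %% k)) addnC -sum -[X in _ - X * _](card_ord k) -sum_nat_const.
  rewrite -sumnB // => b _; case: (block_size_cases (ltn_ord b)) => ->; rewrite -/m //.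
have -> : k * 'C(m, k.+1) = \sum_(b < k) 'C(m, k.+1) by rewrite sum_nat_const card_ord.
rewrite big_distrl -big_split /=.
apply: leq_sum => b _; case: (block_size_cases (ltn_ord b)) => ->; rewrite -/m.
  by rewrite subnn mul0n addn0.
by rewrite subSnn mul1n binS.
Qed.

End Tau.

(** * The range of n *)

Import Order.TTheory GRing.Theory Num.Theory.

Lemma bin_le_expn n m : 'C(n, m) <= n ^ m.
Proof.
elim: m => [|m IH]; first by rewrite bin0.
have h := mul_bin_left n m; have : 'C(n, m.+1) <= m.+1 * 'C(n, m.+1) by rewrite leq_pmull.
move/leq_trans; apply; rewrite h expnS; apply: leq_mul => //; exact: leq_subr.
Qed.

Lemma sqrt_floor k : exists z, 4000 * z ^ 2 <= k < 4000 * z.+1 ^ 2.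
Proof.
elim: k => [|k [z /andP[h1 h2]]]; first by exists 0.
have [lt|ge] := ltnP k.+1 (4000 * z.+1 ^ 2); first by exists z; rewrite lt andbT leqW.
exists z.+1; rewrite ge /=; apply: (leq_ltn_trans h2).
by rewrite ltn_pmul2l // ltn_sqr.
Qed.

(** F(k * (k + t + 1)) = k * 'C(k + t + 1, k + 1), and this binomial coefficient
    equals 'C(k + t + 1, t), which is at most (2 * k) ^ t. *)
Lemma block_count_small k n z t : 0 < k -> n <= k ^ 2 + k * t.+1 ->
  (2 * k) ^ t.+1 < 2 ^ z -> z <= k -> block_count k n < 2 ^ z /\ n <= k ^ 2 + k * z.
Proof.
move=> k0 nt small zk; have tz : t.+1 < z.
  rewrite -(@ltn_exp2l 2) //; apply: leq_ltn_trans small.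
  by rewrite leq_exp2r // leq_pmulr.
split; last by apply: leq_trans nt _; rewrite leq_add2l leq_mul2l ltnW ?orbT.
apply: leq_ltn_trans small.
have -> : (2 * k) ^ t.+1 = (2 * k) * (2 * k) ^ t by rewrite expnS.
apply: leq_trans (block_count_mono k nt) _; rewrite -mulnn -mulnDr block_count_full //.
apply: leq_mul; first by rewrite leq_pmull.
have -> : 'C(k + t.+1, k.+1) = 'C(k + t.+1, t).
  by rewrite -bin_sub; [congr 'C(_, _); lia|lia].
apply: leq_trans (bin_le_expn _ _) _; case: t {nt} tz => // t tz.
by rewrite leq_exp2r //; lia.
Qed.

Local Open Scope ring_scope.

Section Estimate.
Variable R : realType.
Implicit Types (x y l : R).

Lemma ln2_ge : 1 / 2 <= ln (2 : R).
Proof.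
have := @le_ln1Dx R (- (1 / 2)); have -> : 1 + - (1 / 2) = (2 : R)^-1 by field.
by rewrite lnV ?posrE // => /(_ ltac:(lra)); lra.
Qed.

(** In terms of y = sqrt (z + 1) one has sqrt k <= 64 * y ^ 2 and
    ln k <= 4 * ln (8 * y) <= 32 * y.  Hence (t + 1) * ln (2 * k) is at most
    0.128 * y ^ 2 + 64 * y, while z * ln 2 >= (y ^ 2 - 1) / 2. *)
Lemma log_estimate (k z t : nat) : (400 * 400 <= z.+1)%N -> (1 < k)%N -> (k < 4000 * z.+1 ^ 2)%N ->
  t%:R * ln (k%:R : R) <= 1 / 1000 * Num.sqrt k%:R -> ((2 * k) ^ t.+1 < 2 ^ z)%N.
Proof.
move=> zbig k1 kz ht.
pose y : R := Num.sqrt z.+1%:R; have y2 : y ^+ 2 = z.+1%:R by rewrite sqr_sqrtr.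
have y0 : 0 <= y by apply: sqrtr_ge0.
have y400 : 400 <= y.
  have h : (400 : R) ^+ 2 <= y ^+ 2 by rewrite y2 expr2 -natrM ler_nat.
  by rewrite ler_pXn2r ?nnegrE // in h; lra.
pose x : R := Num.sqrt k%:R; have x2 : x ^+ 2 = k%:R by rewrite sqr_sqrtr.
have x0 : 0 <= x by apply: sqrtr_ge0.
have kR : (k%:R : R) <= 4000 * (y ^+ 2) ^+ 2.
  by rewrite y2 -natrX -natrM ler_nat ltnW.
have xy : x <= 64 * y ^+ 2.
  have h : x ^+ 2 <= (64 * y ^+ 2) ^+ 2.
    by rewrite x2; apply: le_trans kR _; rewrite exprMn; have := sqr_ge0 (y ^+ 2); nra.
  by rewrite ler_pXn2r ?nnegrE // in h; nra.
have kpos : (0 : R) < k%:R by rewrite ltr0n ltnW.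
set l := ln k%:R in ht *.
have l32 : l <= 32 * y.
  have h : (k%:R : R) <= (8 * y) ^+ 4.
    apply: le_trans kR _; have -> : (y ^+ 2) ^+ 2 = y ^+ 4 by rewrite -exprM.
    rewrite (_ : (8 * y) ^+ 4 = 4096 * y ^+ 4); last by ring.
    by apply: ler_wpM2r; [apply: exprn_ge0|lra].
  have y8 : 0 < 8 * y by lra.
  have := h; rewrite -ler_ln ?posrE ?exprn_gt0 // lnXn //.
  have := ln_sublinear y8; rewrite -/l mulr_natl; lra.
have l2 : ln 2 <= l by rewrite ler_ln ?posrE // (ler_nat R 2).
have ln2 := ln2_ge.
have main : (t.+1)%:R * (ln 2 + l) < z%:R * ln 2.
  have ez : z%:R = y ^+ 2 - 1 :> R by rewrite y2 -natr1; ring.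
  have h1 : (t.+1)%:R * (ln 2 + l) <= 2 * (t%:R * l) + 2 * l.
    rewrite -natr1; have t0 : (0 : R) <= t%:R by rewrite ler0n.
    have : (t%:R + 1) * (ln 2 + l) <= (t%:R + 1) * (l + l) by apply: ler_wpM2l; lra.
    lra.
  have h2 : (y ^+ 2 - 1) * (1 / 2) <= (y ^+ 2 - 1) * ln 2 by apply: ler_wpM2l => //; nra.
  have h3 : 400 * y <= y ^+ 2 by rewrite expr2; apply: ler_wpM2r.
  rewrite ez; move: ht xy h1 h2 h3 l32; rewrite -/x; lra.
have k20 : (0 < 2 * k)%N by rewrite muln_gt0 /= (ltnW k1).
rewrite -(ltr_nat R) !natrX -ltr_ln ?posrE ?exprn_gt0 ?ltr0n //.
rewrite !lnXn ?ltr0n //.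
by rewrite natrM lnM ?posrE // -[_ *+ t.+1]mulr_natl -[_ *+ z]mulr_natl. 
Qed.

(** z is the largest integer with 4000 * z ^ 2 <= k, and t * k is about
    n - k ^ 2. *)
Lemma threshold (k n : nat) : (4000 * (400 * 400) ^ 2 <= k)%N ->
  n%:R <= (k%:R : R) ^+ 2 + 1 / 1000 * (k%:R `^ (3 / 2)) / ln k%:R ->
  exists z, [/\ (0 < z)%N, (4000 * z ^ 2 <= k)%N, (block_count k n < 2 ^ z)%N &
    (n <= k ^ 2 + k * z)%N].
Proof.
have [w ew] : exists w, w = (400 * 400)%N by exists (400 * 400)%N.
have w400 : (400 <= w)%N by rewrite ew leq_pmulr.
rewrite -ew => kbig hn.
have [z /andP[zk kz]] := sqrt_floor k.
have wz : (w <= z)%N.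
  have := leq_ltn_trans kbig kz; rewrite ltn_pmul2l // ltn_sqr ltnS //.
have z0 : (0 < z)%N by apply: leq_trans wz; apply: leq_trans w400.
have z4 : (4000 * z <= k)%N by apply: leq_trans zk; rewrite leq_mul2l -mulnn leq_pmulr.
have zlek : (z <= k)%N by apply: leq_trans z4; rewrite leq_pmull.
have k1 : (1 < k)%N by apply: leq_trans z4; rewrite -[2%N]muln1 leq_mul.
pose t := ((n - k ^ 2) %/ k)%N.
have kpos : (0 : R) < k%:R by rewrite ltr0n ltnW.
have lpos : 0 < ln (k%:R : R) by rewrite ln_gt0 // (ltr_nat R 1).
have ht : t%:R * ln (k%:R : R) <= 1 / 1000 * Num.sqrt k%:R.
  have [le|lt] := leqP n (k ^ 2).
    have -> : t = 0%N by rewrite /t (eqP (_ : n - k ^ 2 == 0)%N) ?div0n // subn_eq0.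
    by rewrite mul0r mulr_ge0 // ?sqrtr_ge0 //; lra.
  have e : k%:R `^ (3 / 2) = k%:R * Num.sqrt k%:R :> R.
    have -> : (3 / 2 : R) = 1 + 2^-1 by field.
    by rewrite powRD ?powRr1 ?powR12_sqrt ?ler0n //; apply/implyP => _; rewrite gt_eqF.
  have tk : (t * k + k ^ 2 <= n)%N.
    by rewrite /t addnC -(leq_subRL _ (ltnW lt)) leq_trunc_div.
  move: hn; rewrite e => hn.
  have hn' : t%:R * k%:R + (k%:R : R) ^+ 2 <= n%:R by rewrite -natrX -natrM -natrD ler_nat.
  have h : t%:R * k%:R <= 1 / 1000 * (k%:R * Num.sqrt k%:R) / ln (k%:R : R) by lra.
  rewrite ler_pdivlMr // in h.
  rewrite -(ler_pM2r kpos); lra.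
have small := @log_estimate k z t.
exists z; have [||||h1 h2] := @block_count_small k n z t.
- exact: ltnW.
- by rewrite -leq_subLR mulnC ltnW // ltn_ceil // ltnW.
- by apply: small => //; rewrite -ew; apply: leq_trans wz _.
- exact: zlek.
by [].
Qed.

End Estimate.

Theorem theorem1p3 (R : realType) :
  exists (k0 : nat) (c : R), 0 < c /\
    forall k n : nat, (0 < k)%N -> (0 < n)%N -> (k0 <= k)%N ->
      n%:R <= k%:R ^+ 2 + c * (k%:R `^ (3 / 2)) / ln k%:R ->
      min_mono_count k n = mono_count k (tau k n) /\
      (n <> (k ^ 2 + k + 1)%N ->
       forall s : 'S_n, mono_count k s = min_mono_count k n ->
       ~ (has_increasing k s /\ has_decreasing k s)).
Proof.
(* With k this large, z.+1 is at least 400 * 400, from where on the square root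
   dominates the logarithms in [log_estimate]. *)
exists (4000 * (400 * 400) ^ 2)%N, (1 / 1000); split; first by lra.
move=> k n k0 _ kbig hn.
have [z [z0 zk small nz]] := threshold kbig hn.
have lb (s : 'S_n) := lower_bound zk z0 small nz (leqnn n) (perm_biorder s)
  (etrans (cardsT _) (card_ord n)).
have ub : (mono_count k (tau k n) <= block_count k n)%N by apply: tau_upper.
have ge (s : 'S_n) : (block_count k n <= mono_count k s)%N.
  by rewrite mono_countE //; exact: (proj1 (lb s)).
have min_le : (min_mono_count k n <= mono_count k (tau k n))%N.
  by rewrite /min_mono_count; case: arg_minnP => // s _; apply.
have min_ge : (block_count k n <= min_mono_count k n)%N by apply: ge.
have eq_min : min_mono_count k n = mono_count k (tau k n).
  by apply/eqP; rewrite eqn_leq min_le (leq_trans ub min_ge).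
split=> // nn s es [/has_increasingP hi /has_decreasingP hd].
have := proj2 (lb s) _ nn; rewrite /both hi hd => /(_ isT).
by rewrite -mono_countE // es eq_min ltnNge ub.
Qed.
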